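(* Let $N\ge 2$ be a prime, let $\{b_k\}_{k=1}^\infty$ be a sequence of integers with $|b_k|\ge 2$, let $\{t_k\}_{k=1}^\infty$ be a bounded sequence of integers with $|t_k|\ge 1$, and let $D_k=\{0,1,\dots,N-1\}\,t_k$ for $k\ge1$. Let $$\mu_{\{b_k\},\{D_k\}}=\delta_{b_1^{-1}D_1}\ast\delta_{b_1^{-1}b_2^{-1}D_2}\ast\delta_{b_1^{-1}b_2^{-1}b_3^{-1}D_3}\ast\cdots$$ and let $\mathbf{s}_k=\tau_N(b_1b_2\cdots b_k)-\tau_N(Nt_k)$ for $k\ge 1$. Suppose that there exists an integer $m_0\ge 1$ such that $|b_k|>(N-1)|t_k|$ for all $k\ge m_0$. Then the following statements are equivalent. (i) $\mu_{\{b_k\},\{D_k\}}$ is a spectral measure. (ii) $\mathbf{s}_i\ne\mathbf{s}_j$ for all $i\ne j\in\mathbb{N}^+$. (iii) $D_k\oplus b_kD_{k-1}\oplus b_kb_{k-1}D_{k-2}\oplus\cdots\oplus b_kb_{k-1}\cdots b_2D_1$ is an integer tile for all $k\in\mathbb{N}^+$ (in particular, these sums are direct).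
   Context: For a finite set $E\subset\mathbb{R}$, $\delta_E=\frac{1}{\#E}\sum_{e\in E}\delta_e$ with $\delta_e$ the Dirac mass at $e$; $cE=\{ce:e\in E\}$; $\{0,1,\dots,N-1\}t=\{0,t,\dots,(N-1)t\}$. The infinite convolution is the weak limit of the finite convolutions $\delta_{b_1^{-1}D_1}\ast\cdots\ast\delta_{b_1^{-1}\cdots b_k^{-1}D_k}$ (it exists here and is a compactly supported Borel probability measure). A compactly supported Borel probability measure $\mu$ on $\mathbb{R}$ is a spectral measure if there is $\Lambda\subset\mathbb{R}$ (a spectrum of $\mu$) such that $\{e^{2\pi i\lambda x}:\lambda\in\Lambda\}$ is an orthogonal basis of $L^2(\mu)$. For a nonzero integer $A$, $\tau_N(A)=\max\{k\in\{0,1,2,\dots\}:N^k\mid A\}$. $A_1\oplus\cdots\oplus A_m$ denotes the sumset $A_1+\cdots+A_m$ together with the assertion that the sum is direct (unique representations). A finite set $D\subset\mathbb{Z}$ is an integer tile if there exist an integer $p\ge 1$ and $L\subset\mathbb{Z}$ with $D\oplus L=\mathbb{Z}/p\mathbb{Z}$, i.e. the sums $d+l$ represent each residue class modulo $p$ exactly once. *)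

(* Defs.v *)
From HB Require Import structures.
From mathcomp Require Import all_boot all_order all_algebra finmap.
From mathcomp Require Import all_classical all_reals all_analysis.
From mathcomp Require Import measurable_realfun.
From mathcomp Require Import complex.

Set Implicit Arguments.
Unset Strict Implicit.
Unset Printing Implicit Defensive.
Import Order.TTheory GRing.Theory Num.Theory.
Import numFieldNormedType.Exports.

Local Open Scope classical_set_scope.
Local Open Scope ring_scope.
Local Open Scope complex_scope.

Section convolution.
Context {R : realType}.
Local Notation probR := (probability (measurableTypeR R) R).

Definition addR2 (z : measurableTypeR R * measurableTypeR R) :
  measurableTypeR R := (z.1 : R) + (z.2 : R).

Lemma measurable_addR2 : measurable_fun [set: _] addR2.
Proof.
by apply: measurable_funD; [exact: measurable_fst|exact: measurable_snd].
Qed.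

HB.instance Definition _ := isMeasurableFun.Build _ _ _ _ addR2 measurable_addR2.

(* The law of the sum of two independent variables of laws mu and nu. *)
Definition convolution (mu nu : probR) : probR := distribution (mu \x nu)%E addR2.

(* (#E)^-1 times the sum of the Dirac masses at the points of E; mnormalize
   returns its second argument only for E empty. *)
Definition uniform_fset (E : {fset R}) : probR :=
  mnormalize (msum (fun i => \d_(E`_i : measurableTypeR R)) #|` E|)
    (\d_(0 : measurableTypeR R)).

Definition scaled_fset (b : nat -> int) (D : nat -> {fset int}) (k : nat) :
    {fset R} :=
  [fset (\prod_(1 <= i < k.+1) (b i)%:~R)^-1 * d%:~R | d in D k]%fset.

(* Sequences are indexed from 1: the values b 0 and D 0 are never used, and
   the unit mass at 0 is the empty convolution. *)
Fixpoint finite_convolution (b : nat -> int) (D : nat -> {fset int}) (k : nat) :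
    probR :=
  if k is k'.+1 then
    convolution (finite_convolution b D k') (uniform_fset (scaled_fset b D k))
  else \d_(0 : measurableTypeR R).

Definition weak_limit (mu_ : nat -> probR) (mu : probR) : Prop :=
  forall f : R -> R, continuous f -> (exists M : R, forall x, `|f x| <= M) ->
    \int[mu_ n]_x f x @[n --> \oo] --> \int[mu]_x f x.

(* Weak limits of probability measures are unique; get returns the limit
   when there is one, and an arbitrary probability measure otherwise. *)
Definition infinite_convolution (b : nat -> int) (D : nat -> {fset int}) :
    probR :=
  get [set mu | weak_limit (finite_convolution b D) mu].

End convolution.
Arguments infinite_convolution : clear implicits.

Section spectral.
Context {R : realType} (mu : probability (measurableTypeR R) R).

Definition cRintegral (f : R -> R[i]) : R[i] :=
  (\int[mu]_x complex.Re (f x)) +i* (\int[mu]_x complex.Im (f x)).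

Definition L2sqnorm (f : R -> R[i]) : \bar R :=
  (\int[mu]_x ((complex.Re (f x)) ^+ 2 + (complex.Im (f x)) ^+ 2)%:E)%E.

Definition cL2 (f : R -> R[i]) : Prop :=
  [/\ measurable_fun [set: R] (fun x => complex.Re (f x)),
      measurable_fun [set: R] (fun x => complex.Im (f x)) &
      (L2sqnorm f < +oo)%E].

Definition expi (l : R) (x : R) : R[i] :=
  cos (2 * pi * l * x) +i* sin (2 * pi * l * x).

Definition orthogonal_exponentials (L : set R) : Prop :=
  forall l m, L l -> L m -> l <> m ->
    cRintegral (fun x => expi l x * conjc (expi m x)) = 0.

(* The linear span of the exponentials is dense in L^2(mu); together with
   orthogonality, they form an orthogonal basis. *)
Definition total_exponentials (L : set R) : Prop :=
  forall f, cL2 f -> forall e : R, 0 < e ->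
    exists (s : {fset R}) (c : R -> R[i]),
      [set` s] `<=` L /\
      (L2sqnorm (fun x => f x - \sum_(l <- s) c l * expi l x)%R < (e ^+ 2)%:E)%E.

Definition is_spectrum (L : set R) : Prop :=
  orthogonal_exponentials L /\ total_exponentials L.

Definition compactly_supported : Prop :=
  exists2 K : set R, compact K & mu (~` K) = 0%E.

Definition spectral_measure : Prop :=
  compactly_supported /\ exists L, is_spectrum L.

End spectral.

Definition digits (N : nat) (t : int) : {fset int} :=
  [fset i%:Z * t | i in iota 0 N]%fset.

(* For N prime, logn N is the N-adic valuation. *)
Definition tau (N : nat) (A : int) : nat := logn N `|A|%N.

Definition s_seq (N : nat) (b t : nat -> int) (k : nat) : int :=
  (tau N (\prod_(1 <= i < k.+1) b i))%:Z - (tau N (N%:Z * t k))%:Z.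

Definition sumset2 (A B : {fset int}) : {fset int} :=
  [fset (x + y)%R | x in A, y in B]%fset.

Definition sumset (n : nat) (A : 'I_n -> {fset int}) : {fset int} :=
  \big[sumset2/[fset 0]%fset]_(j < n) A j.

Definition direct_sumset (n : nat) (A : 'I_n -> {fset int}) : Prop :=
  forall x y : 'I_n -> int,
    (forall j, x j \in A j) -> (forall j, y j \in A j) ->
    \sum_j x j = \sum_j y j -> forall j, x j = y j.

(* Every residue class modulo p is represented by exactly one pair. *)
Definition integer_tile (D : {fset int}) : Prop :=
  exists (p : nat) (L : set int), (1 <= p)%N /\
    forall n : int, exists! u : int * int,
      [/\ u.1 \in D, L u.2 & (u.1 + u.2 = n %[mod p%:Z])%Z].

(* The j-th term, 0 <= j < k, of
   D_k, b_k D_(k-1), b_k b_(k-1) D_(k-2), and so on up to b_k ... b_2 D_1. *)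
Definition tile_term (b : nat -> int) (D : nat -> {fset int}) (k : nat)
    (j : 'I_k) : {fset int} :=
  [fset (\prod_((k - j).+1 <= i < k.+1) b i) * d | d in D (k - j)%N]%fset.

(* Main.v *)
(* Write x_k = t_k / (b_1 .. b_k) for the k-th digit step.

   (ii) <-> (iii). The k-th sumset is made of the multiples j c_i, 0 <= j < N, of
   c_i = t_i b_(i+1) .. b_k, and s_i determines the N-adic valuation of c_i. If the
   valuations are distinct, adjoining the missing powers of N gives a complete
   residue system modulo a power of N, by the ultrametric inequality. If c_u and
   c_v have the same valuation, the complement of each of their digit sets is
   invariant under scaling that digit set by an integer prime to N; so both may be
   given the same step, which contradicts uniqueness.

   (ii) -> (i). Order the digits by N-adic valuation (their level). The digits of
   level < q form a finite measure whose spectra are built one level at a time, by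
   adding multiples of a period of the lower levels. Each frequency may further be
   moved by such periods; with boundedly many exceptions, handled one N-adic digit
   at a time, the condition |b_k| > (N-1)|t_k| then keeps the Fourier transform of
   the remaining digits bounded below at all frequencies. This gives a lower frame
   bound for the residuals of Lipschitz functions, hence completeness.

   (i) -> (ii). If s_i = s_j, then every zero of the masks of x_i and x_j is a zero
   of the mask of a common step z. Exponentials orthogonal for mu are thus also
   orthogonal when the two digits i, j are merged into the single digit z. Test
   with a function carried near the leftmost point: merging multiplies the mass
   there by N, so Bessel's inequality for the merged measure contradicts
   completeness for mu. *)
Require Import Defs.
From HB Require Import structures.
From mathcomp Require Import all_boot all_order all_algebra finmap zify ring lra.
From mathcomp Require Import all_classical all_reals all_analysis.
From mathcomp Require Import measurable_realfun complex.
Set Implicit Arguments.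
Unset Strict Implicit.
Unset Printing Implicit Defensive.
Import Order.TTheory GRing.Theory Num.Theory.
Import numFieldNormedType.Exports.
Local Open Scope classical_set_scope.
Local Open Scope ring_scope.
Local Open Scope complex_scope.

(** * Valuations and integer tiles *)

(** The measure is reached through the finite averages [avgs]: each inequality is proved for the
    first K digits with constants independent of K, then passed to the limit against bounded
    Lipschitz functions. The obstacle to completeness is that valuations need not increase with the
    index, so the digits of low level are not an initial segment. Boundedness of t_k repairs this:
    the level of k exceeds the valuation of P_k = b_1 .. b_k by at most C, so for each q at most C
    digits are out of order. For the remaining digits, those after some index h, the point of |b_k|
    > (N-1)|t_k| is that the mask first vanishes at 1/N: a frequency reduced by multiples of P_h to
    size at most |P_h|/2 gives arguments that are bounded by some kappa < 1/N and decrease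
    geometrically. Nested orthogonal families may fail to be complete in the limit. The lower bound
    on the tail excludes this: up to a small error, it bounds the energy of the residual at one
    level by the gain in Bessel's sum up to a later level, and these gains tend to 0. *)

Section valuation.
Variables (N : nat) (N_prime : prime N).
Implicit Types (A B : int).

Lemma tauM A B : A != 0 -> B != 0 -> tau N (A * B) = (tau N A + tau N B)%N.
Proof. by move=> A0 B0; rewrite /tau abszM lognM // absz_gt0. Qed.

Lemma dvdz_tau e A : A != 0 -> (N%:Z ^+ e %| A)%Z = (e <= tau N A)%N.
Proof.
by move=> A0; rewrite dvdzE abszX absz_nat pfactor_dvdn // absz_gt0.
Qed.

Lemma tau_small A : A != 0 -> `|A| < N%:Z -> tau N A = 0%N.
Proof.
move=> A0 AN; apply/eqP; rewrite -leqn0 leqNgt -[X in ~~ X]dvdz_tau // expr1.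
apply/negP; rewrite dvdzE absz_nat => /dvdn_leq; rewrite absz_gt0 => /(_ A0).
by lia.
Qed.

Lemma tau_coprime A : A != 0 -> tau N A = 0%N -> coprime `|A| N.
Proof.
move=> A0 tA; rewrite coprime_sym prime_coprime // -[N]/(`|N%:Z|%N) -dvdzE.
by rewrite -[N%:Z]expr1 dvdz_tau // tA.
Qed.

Lemma tau_decomp A : A != 0 ->
  exists w, [/\ A = N%:Z ^+ tau N A * w, w != 0 & tau N w = 0%N].
Proof.
move=> A0; have : (N%:Z ^+ tau N A %| A)%Z by rewrite dvdz_tau.
move=> /dvdzP[w Aw]; exists w; have w0 : w != 0.
  by apply: contra_neq A0 => w0; rewrite Aw w0 mul0r.
have N0 : N%:Z ^+ tau N A != 0.
  by rewrite expf_eq0 negb_and orbC -lt0n; have := prime_gt0 N_prime; lia.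
split=> //; first by rewrite mulrC.
have /eqP := tauM w0 N0; rewrite -Aw.
have -> : tau N (N%:Z ^+ tau N A) = tau N A.
  by rewrite {1}/tau abszX absz_nat pfactorK.
by lia.
Qed.

(* Ultrametric principle: in a sum of terms of distinct valuations the smallest
   valuation survives. *)
Lemma digits_unique (I : finType) (c d : I -> int) (E : nat) :
  (forall i, c i != 0) -> injective (fun i => tau N (c i)) ->
  (forall i, (tau N (c i) < E)%N) -> (forall i, `|d i| < N%:Z) ->
  (N%:Z ^+ E %| \sum_i d i * c i)%Z -> forall i, d i = 0.
Proof.
move=> c0 cinj cE dN div i; apply/eqP/negP => /negP di.
case: (@arg_minnP _ i (fun i => d i != 0) (fun i => tau N (c i)) di) => k dk kmin.
have Ek : (N%:Z ^+ (tau N (c k)).+1 %| N%:Z ^+ E)%Z by rewrite dvdz_exp2l // cE.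
have := dvdz_trans Ek div.
rewrite (bigD1 k) //= rpredDr; last first.
  apply: rpred_sum => j jk; have [->|dj] := eqVneq (d j) 0; first by rewrite mul0r rpred0.
  apply: dvdz_mull; rewrite dvdz_tau // ltn_neqAle kmin // andbT.
  by apply: contra jk => /eqP /cinj ->.
by rewrite dvdz_tau ?mulf_neq0 // tauM // (tau_small dk) // add0n ltnn.
Qed.

(** Pigeonhole: by [digits_unique] the N ^ E digit vectors have distinct sums modulo N ^ E, so every
    residue occurs. *)
Lemma digits_exist (I : finType) (c : I -> int) :
  (forall i, c i != 0) -> injective (fun i => tau N (c i)) ->
  (forall i, (tau N (c i) < #|I|)%N) -> forall n : int,
  exists a : I -> 'I_N, (N%:Z ^+ #|I| %| n - \sum_i (a i)%:Z * c i)%Z.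
Proof.
move=> c0 cinj cE n; set E := #|I|; have N0 := prime_gt0 N_prime.
have NE0 : (N ^ E > 0)%N by rewrite expn_gt0 N0.
have NEz : N%:Z ^+ E != 0 by rewrite expf_eq0; lia.
have mod_lt x : (`|(x %% N%:Z ^+ E)%Z| < N ^ E)%N.
  have := ltz_mod x NEz; have := modz_ge0 x NEz.
  by rewrite -natz -natrX natz; move: (modz _ _) => u; lia.
pose f (a : {ffun I -> 'I_N}) : 'I_(N ^ E) :=
  Ordinal (mod_lt (\sum_i (a i)%:Z * c i)).
have f_inj : injective f.
  move=> a a' /(congr1 val) /= /(congr1 (fun m => m%:Z)).
  rewrite !gez0_abs ?modz_ge0 // => /eqP; rewrite eqz_mod_dvd -sumrB => div.
  apply/ffunP => i; apply/val_inj => /=; apply/eqP; rewrite -eqz_nat -subr_eq0.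
  apply/eqP; move: i.
  apply: (@digits_unique _ c _ E) => // [i|]; first by have := ltn_ord (a i); have := ltn_ord (a' i); lia.
  by move: div; under eq_bigr do rewrite -mulrBl.
have card_eq : #|{ffun I -> 'I_N}| = #|'I_(N ^ E)| by rewrite card_ffun !card_ord.
have [g gK fK] := inj_card_bij f_inj (eq_leq (esym card_eq)).
exists (g (Ordinal (mod_lt n))); rewrite -eqz_mod_dvd; apply/eqP.
have /(congr1 val) /= := fK (Ordinal (mod_lt n)).
by move=> /(congr1 (fun m => m%:Z)); rewrite !gez0_abs ?modz_ge0.
Qed.

End valuation.

(** * Tilings of the integers by one digit set *)

Section tile_scaling.
Variable N : nat.
Hypothesis N_gt0 : (0 < N)%N.

(** That is, Z is the direct sum of B and {0, c, .., (N-1)c}. B is a mere predicate because it will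
    be a complement enlarged by another digit set. *)
Definition tiles_with (B : int -> Prop) (c : int) :=
  forall n, (exists2 a, (a < N)%N & B (n - a%:Z * c)) /\
    (forall a a', (a < N)%N -> (a' < N)%N ->
      B (n - a%:Z * c) -> B (n - a'%:Z * c) -> a = a').

(* The complement of {0, c, .., (N-1)c} is invariant under translation by N c,
   and a |-> a m permutes the residues mod N. *)
Lemma tiles_with_scale B c m : coprime `|m| N ->
  tiles_with B c -> tiles_with B (m * c).
Proof.
move=> mN T.
have addN n : B n -> B (n + N%:Z * c).
  (* If n + N c had a positive digit a + 1, then n + (N-1) c would have both digits N - 1 and a,
     forcing a + 1 = N, which is out of range. *)
  move=> Bn; have [[[|a] aN Ba] _] := T (n + N%:Z * c); first by rewrite mul0r subr0 in Ba.
  have [_ /(_ N.-1 a)] := T (n + N.-1%:Z * c).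
  rewrite addrK; case: (posnP N) => [?|N0]; first by lia.
  suff <- : n + N%:Z * c - a.+1%:Z * c = n + N.-1%:Z * c - a%:Z * c.
    by move=> /(_ _ _ Bn Ba); lia.
  have -> : N%:Z = N.-1%:Z + 1 by lia.
  by rewrite (_ : a.+1%:Z = a%:Z + 1); [move: (N.-1%:Z) (a%:Z) => u v; ring | lia].
have subN n : B n -> B (n - N%:Z * c).
  move=> Bn; have [[a aN Ba] _] := T (n - N%:Z * c).
  have {}Ba' := addN _ Ba; have [_ /(_ a 0%N aN N_gt0)] := T n.
  rewrite mul0r subr0.
  have -> : n - a%:Z * c = n - N%:Z * c - a%:Z * c + N%:Z * c by ring.
  by move=> /(_ Ba' Bn) a0; move: Ba; rewrite a0 mul0r subr0.
have subNz n (k : int) : B n -> B (n - k * N%:Z * c).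
  elim: k => [|k IH|k IH] Bn; first by rewrite !mul0r subr0.
    by have /subN := IH Bn; congr B; rewrite (_ : k.+1%:Z = k%:Z + 1); [ring | lia].
  by have /addN := IH Bn; congr B; rewrite (_ : - k.+1%:Z = - k%:Z - 1); [ring | lia].
have per n (u v : int) : (u = v %[mod N])%Z -> B (n - u * c) -> B (n - v * c).
  move=> /eqP; rewrite eqz_mod_dvd => /dvdzP[k uv] Bu.
  have := subNz _ (- k) Bu; have -> : v = u - k * N%:Z by rewrite -uv; ring.
  by congr B; ring.
have Nz : N%:Z != 0 :> int by lia.
(* By [per], membership of n - u c in B depends only on u modulo N. Existence thus needs an inverse
   of m modulo N, and uniqueness the cancellation of m. *)
move=> n; have [[a aN Ba] uniq_a] := T n; split.
  have [u [v uv]] : exists u v : int, u * m + v * N%:Z = 1.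
    by have [u [v uvE]] := Bezoutz m N%:Z; exists u, v; rewrite uvE /gcdz absz_nat (eqP mN).
  exists `|(a%:Z * u %% N%:Z)%Z|%N.
    by have := ltz_mod (a%:Z * u) Nz; have := modz_ge0 (a%:Z * u) Nz; lia.
  rewrite mulrA; apply: per Ba; rewrite gez0_abs ?modz_ge0 // modzMml.
  apply/eqP; rewrite eqz_mod_dvd; apply/dvdzP; exists (a%:Z * v).
  have -> : a%:Z * v * N%:Z = a%:Z * (u * m + v * N%:Z) - a%:Z * u * m by ring.
  by rewrite uv mulr1.
move=> a1 a2 a1N a2N; rewrite !mulrA => B1 B2.
have mod_lt u : (`|(u %% N%:Z)%Z| < N)%N.
  by have := ltz_mod u Nz; have := modz_ge0 u Nz; lia.
have red a' : B (n - a'%:Z * m * c) -> B (n - `|(a'%:Z * m %% N%:Z)%Z|%N%:Z * c).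
  by apply: per; rewrite gez0_abs ?modz_ge0 // modz_mod.
have := uniq_a _ _ (mod_lt _) (mod_lt _) (red _ B1) (red _ B2).
move=> /(congr1 (fun m => m%:Z)); rewrite !gez0_abs ?modz_ge0 // => /eqP.
rewrite eqz_mod_dvd -mulrBl Gauss_dvdzl; last by rewrite /coprimez /gcdz absz_nat gcdnC; move: mN => /eqP ->.
rewrite -eqz_mod_dvd !modz_small //; first by move=> /eqP [].
all: lia.
Qed.

End tile_scaling.

Lemma sumset_bigP (I : eqType) (r : seq I) (A : I -> {fset int}) (x : int) :
  uniq r ->
  (x \in \big[sumset2/[fset 0]%fset]_(j <- r) A j)%fset <->
  exists2 y : I -> int, (forall j, j \in r -> y j \in A j) & x = \sum_(j <- r) y j.
Proof.
elim: r x => [|i r IH] x /=.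
  move=> _; rewrite big_nil inE; split=> [/eqP->|[y _]].
    by exists (fun=> 0) => //; rewrite big_nil.
  by rewrite big_nil => ->.
case/andP=> ir ur; rewrite big_cons; split.
  case/imfset2P => /= u uA [v vA ->]; have [y yA vE] := (IH v ur).1 vA.
  exists (fun j => if j == i then u else y j).
    move=> j; rewrite inE; case: eqP => [-> //|_ /=]; exact: yA.
  rewrite big_cons eqxx vE; congr (_ + _); rewrite !big_seq; apply: eq_bigr => j jr.
  by case: eqP jr ir => // -> ->.
case=> y yA ->; rewrite big_cons; apply/imfset2P => /=.
exists (y i); first by apply: yA; rewrite mem_head.
exists (\sum_(j <- r) y j) => //; apply/(IH _ ur); exists y => // j jr.
by apply: yA; rewrite inE jr orbT.
Qed.

Lemma sumsetP (n : nat) (A : 'I_n -> {fset int}) (x : int) :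
  x \in sumset A <->
  exists2 y : 'I_n -> int, (forall j, y j \in A j) & x = \sum_j y j.
Proof.
rewrite /sumset sumset_bigP ?index_enum_uniq //; split=> -[y yA ->]; exists y => // j.
by apply: yA; rewrite mem_index_enum.
Qed.

(** * Sumsets of the digit sets *)

Section tiles.
Variables (N : nat) (b t : nat -> int).
Hypothesis N_prime : prime N.
Hypothesis b_neq0 : forall k, (1 <= k)%N -> b k != 0.
Hypothesis t_neq0 : forall k, (1 <= k)%N -> t k != 0.

Definition denom (k : nat) : int := \prod_(1 <= i < k.+1) b i.

Lemma denom_neq0 k : denom k != 0.
Proof.
rewrite /denom big_seq; elim/big_ind: _ => // [x y x0 y0|i]; first by rewrite mulf_neq0.
by rewrite mem_index_iota => /andP[i1 _]; exact: b_neq0.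
Qed.

Lemma denomS k : denom k.+1 = denom k * b k.+1.
Proof. by rewrite /denom big_nat_recr. Qed.

Lemma denom_cat i k : (i <= k)%N ->
  denom k = denom i * \prod_(i.+1 <= l < k.+1) b l.
Proof. by move=> ik; rewrite /denom -big_cat_nat. Qed.

(** For i <= k this is the step t_i / (b_1 .. b_i) with the common denominator b_1 .. b_k
    cleared. *)
Definition numer (k i : nat) : int := t i * \prod_(i.+1 <= l < k.+1) b l.

Lemma denom_numer k i : (i <= k)%N -> denom i * numer k i = denom k * t i.
Proof. by move=> ik; rewrite (denom_cat ik) /numer; ring. Qed.

Lemma numer_neq0 k i : (1 <= i <= k)%N -> numer k i != 0.
Proof.
move=> /andP[i1 ik]; have := mulf_neq0 (denom_neq0 k) (t_neq0 i1).
by rewrite -denom_numer //; apply: contra_neq => ->; rewrite mulr0.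
Qed.

Lemma tau_numer k i : (1 <= i <= k)%N ->
  (tau N (denom i) + tau N (numer k i))%N = (tau N (denom k) + tau N (t i))%N.
Proof.
move=> ik; have /andP[i1 ilek] := ik.
by rewrite -!tauM ?denom_neq0 ?t_neq0 ?numer_neq0 // denom_numer.
Qed.

Lemma tau_Nt k : (1 <= k)%N -> tau N (N%:Z * t k) = (tau N (t k)).+1.
Proof.
move=> k1; have N0 : N%:Z != 0 by have := prime_gt0 N_prime; lia.
by rewrite tauM ?t_neq0 // {1}/tau absz_nat (pfactorK 1).
Qed.

Lemma s_seqE k : (1 <= k)%N ->
  s_seq N b t k = (tau N (denom k))%:Z - (tau N (t k))%:Z - 1.
Proof. by move=> k1; rewrite /s_seq tau_Nt // -/(denom k); lia. Qed.

Lemma s_seq_numer k i : (1 <= i <= k)%N ->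
  s_seq N b t i = (tau N (denom k))%:Z - 1 - (tau N (numer k i))%:Z.
Proof. by move=> ik; rewrite s_seqE; [have := tau_numer ik|]; lia. Qed.

Let D k := digits N (t k).

Lemma tile_termP k (j : 'I_k) (x : int) :
  x \in tile_term b D j <-> exists a : 'I_N, x = a%:Z * numer k (k - j).
Proof.
split.
  case/imfsetP => d /= /imfsetP[a /=]; rewrite mem_iota /= => aN -> ->.
  by exists (Ordinal aN) => /=; rewrite /numer; ring.
case=> a ->; apply/imfsetP; exists (a%:Z * t (k - j)); last by rewrite /numer; ring.
by apply/imfsetP; exists (a : nat) => //=; rewrite mem_iota /=.
Qed.

Definition injective_s := forall i j, (1 <= i)%N -> (1 <= j)%N -> i <> j ->
  s_seq N b t i <> s_seq N b t j.

Lemma ord_sub_range k (j : 'I_k) : (1 <= k - j <= k)%N.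
Proof. by have := ltn_ord j; lia. Qed.

Lemma injective_s_tile : injective_s -> forall k, (1 <= k)%N ->
  direct_sumset (tile_term b D (k := k)) /\
  integer_tile (sumset (tile_term b D (k := k))).
Proof.
move=> inj_s k k1; have N0 := prime_gt0 N_prime.
pose c (j : 'I_k) := numer k (k - j).
have c0 j : c j != 0 by rewrite numer_neq0 // ord_sub_range.
have c_inj : injective (fun j => tau N (c j)).
  move=> i j /= ij; apply/val_inj/eqP/negPn/negP => /= /eqP neq.
  apply: (inj_s (k - i)%N (k - j)%N); [by case/andP: (ord_sub_range i)|
    by case/andP: (ord_sub_range j)| by have := ltn_ord i; have := ltn_ord j; lia|].
  by rewrite !(@s_seq_numer k) ?ord_sub_range // -/(c i) -/(c j) ij.
pose E := (\max_j tau N (c j)).+1.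
have cE j : (tau N (c j) < E)%N by rewrite ltnS (leq_bigmax j).
have c_digits (a a' : 'I_k -> 'I_N) :
    \sum_j (a j)%:Z * c j = \sum_j (a' j)%:Z * c j -> a =1 a'.
  move=> eq_sum j; apply/val_inj => /=; apply/eqP; rewrite -eqz_nat -subr_eq0; apply/eqP.
  apply: (@digits_unique N N_prime _ c (fun j => (a j)%:Z - (a' j)%:Z) E) => // [i|].
    by have := ltn_ord (a i); have := ltn_ord (a' i); lia.
  by under eq_bigr do rewrite mulrBl; rewrite sumrB eq_sum subrr dvdz0.
have termE (x : 'I_k -> int) : (forall j, x j \in tile_term b D j) ->
    exists a : 'I_k -> 'I_N, forall j, x j = (a j)%:Z * c j.
  move=> xD; have /boolp.choice[a aE] : forall j, exists a : 'I_N, x j = a%:Z * c j.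
    by move=> j; apply/tile_termP.
  by exists a.
split.
  move=> x y /termE[a xE] /termE[a' yE].
  under eq_bigr do rewrite xE; under [in RHS]eq_bigr do rewrite yE.
  by move=> /c_digits aa' j; rewrite xE yE aa'.
(* The exponents below E that are missing among the valuations. With these powers of N adjoined,
   each of 0, .., E - 1 is a valuation exactly once, and their digit sums form the complement L. *)
pose J := {e : 'I_E | [forall j, tau N (c j) != e]}.
pose I := ('I_k + J)%type.
pose cc (i : I) := match i with inl j => c j | inr e => N%:Z ^+ val (val e) end.
have tau_exp e : tau N (N%:Z ^+ e) = e by rewrite /tau abszX absz_nat pfactorK.
have cc0 i : cc i != 0.
  by case: i => [j|e] /=; rewrite ?c0 // expf_eq0; lia.
have cc_inj : injective (fun i => tau N (cc i)).
  case=> [i|e] [j|e'] //=; rewrite ?tau_exp => ij.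
  - by rewrite (c_inj i j).
  - by have /forallP/(_ i) := valP e'; rewrite ij eqxx.
  - by have /forallP/(_ j) := valP e; rewrite ij eqxx.
  - by congr inr; apply/val_inj/val_inj.
have ccE i : (tau N (cc i) < E)%N by case: i => [j|e] //=; rewrite tau_exp.
have cardI : #|{: I}| = E.
  rewrite -[RHS]card_ord; apply: (@bij_eq_card _ _ (fun i => Ordinal (ccE i))).
  apply: inj_card_bij; first by move=> i j /(congr1 val) /= /cc_inj.
  rewrite -(card_codom (f := fun i => Ordinal (ccE i))); last first.
    by move=> i j /(congr1 val) /= /cc_inj.
  apply/subset_leq_card/fintype.subsetP => e _; apply/codomP.
  have [/existsP[j /eqP je]|] := boolP [exists j, tau N (c j) == e].
    by exists (inl j); apply/val_inj.
  rewrite negb_exists => eP; exists (inr (exist _ e eP)); apply/val_inj => /=.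
  by rewrite tau_exp.
exists (N ^ E)%N, [set l | exists a : J -> 'I_N, l = \sum_e (a e)%:Z * N%:Z ^+ val (val e)]%classic.
split; first by rewrite expn_gt0 N0.
move=> n; have -> : (N ^ E)%N%:Z = N%:Z ^+ E by rewrite -!natz natrX.
have [a] := digits_exist N_prime cc0 cc_inj (fun i => leq_trans (ccE i) (eq_leq (esym cardI))) n.
rewrite cardI big_sumType /= => na.
have join (x y : int) (aJ : J -> 'I_N) (aj : 'I_k -> 'I_N) :
    x = \sum_j (aj j)%:Z * c j -> y = \sum_e (aJ e)%:Z * N%:Z ^+ val (val e) ->
    (x + y = n %[mod N%:Z ^+ E])%Z -> aj =1 (a \o inl) /\ aJ =1 (a \o inr).
  move=> xE yE /eqP; rewrite eqz_mod_dvd => xyn.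
  pose d (i : I) : int := (match i with inl j => (aj j)%:Z | inr e => (aJ e)%:Z end) - (a i)%:Z.
  have d0 : forall i, d i = 0.
    apply: (@digits_unique N N_prime _ cc d E) => //.
      case=> i; rewrite /d.
        by have := ltn_ord (a (inl i)); have := ltn_ord (aj i); lia.
      by have := ltn_ord (a (inr i)); have := ltn_ord (aJ i); lia.
    rewrite big_sumType /= /d; under eq_bigr do rewrite mulrBl.
    under [X in _ + X]eq_bigr do rewrite mulrBl.
    rewrite !sumrB -xE -yE; have := rpredD xyn na.
    by rewrite [X in X \in _ -> _](_ : _ = (x - \sum_j (a (inl j))%:Z * c j) +
      (y - \sum_e (a (inr e))%:Z * N%:Z ^+ sval e)) //; ring.
  by split=> i; apply/val_inj => /=; [have := d0 (inl i) | have := d0 (inr i)];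
    rewrite /d => /eqP; rewrite subr_eq0 => /eqP [].
exists (\sum_j (a (inl j))%:Z * c j, \sum_e (a (inr e))%:Z * N%:Z ^+ val (val e)).
split=> [|[x y] /= [xD [aJ yE] xyn]].
  split=> /=.
  - apply/sumsetP; exists (fun j => (a (inl j))%:Z * c j) => // j.
    by apply/tile_termP; exists (a (inl j)).
  - by exists (a \o inr).
  - by apply/eqP; rewrite eqz_mod_dvd -rpredN opprB.
have [x' /termE[aj x'E] xE] := (sumsetP _ _).1 xD.
have {}xE : x = \sum_j (aj j)%:Z * c j by rewrite xE; apply: eq_bigr => j _.
have [ajE aJE] := join x y aJ aj xE yE xyn.
by rewrite xE yE; congr (_, _); apply: eq_bigr => i _; rewrite ?ajE ?aJE.
Qed.

Lemma tile_injective_s : (forall k, (1 <= k)%N ->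
  direct_sumset (tile_term b D (k := k)) /\
  integer_tile (sumset (tile_term b D (k := k)))) -> injective_s.
Proof.
move=> tiles.
suff lt_s i j : (1 <= i)%N -> (i < j)%N -> s_seq N b t i <> s_seq N b t j.
  move=> i j i1 j1 /eqP; rewrite neq_ltn => /orP[ij|ji]; first exact: lt_s.
  by apply/nesym/lt_s.
move=> i1 ij s_eq; set k := j.
have N0 := prime_gt0 N_prime; have N1 := prime_gt1 N_prime.
have k1 : (1 <= k)%N by rewrite /k; lia.
have [direct [p [L [p0 tile]]]] := tiles k k1.
pose c (l : 'I_k) := numer k (k - l).
have c0 l : c l != 0 by rewrite numer_neq0 // ord_sub_range.
(* Terms are numbered backwards: u carries the digit i, and v, numbered 0, the digit j = k. *)
have ltu : (k - i < k)%N by rewrite /k; lia.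
have ltv : (0 < k)%N by [].
pose u := Ordinal ltu; pose v := Ordinal ltv.
have uv : u != v by rewrite -val_eqE /=; rewrite /k; lia.
have tau_uv : tau N (c u) = tau N (c v).
  have ui : (k - u)%N = i by rewrite /= /k; lia.
  move: s_eq; rewrite -{1}ui -[j]/k -[in X in _ = s_seq _ _ _ X](subn0 k).
  rewrite (@s_seq_numer k (k - u)) ?ord_sub_range // (@s_seq_numer k (k - 0)) //; last by lia.
  by rewrite /c /=; lia.
have [w [cuE w0 tw]] := tau_decomp N_prime (c0 u).
have [w' [cvE w'0 tw']] := tau_decomp N_prime (c0 v).
have termP (a : 'I_k -> nat) : (forall l, (a l < N)%N) -> forall l,
    (a l)%:Z * c l \in tile_term b D l.
  by move=> aN l; apply/tile_termP; exists (Ordinal (aN l)).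
(* The common complement of the two digit sets u and v: all the other digits together with L, modulo
   p. *)
pose B (n : int) := exists (a : 'I_k -> nat) (l : int),
  [/\ forall l, (a l < N)%N, a u = 0%N, a v = 0%N, L l &
      (\sum_l (a l)%:Z * c l + l = n %[mod p%:Z])%Z].
pose upd (a : 'I_k -> nat) (x y : nat) l := if l == u then x else if l == v then y else a l.
have upd_u a x y : upd a x y u = x by rewrite /upd eqxx.
have upd_v a x y : upd a x y v = y by rewrite /upd eq_sym (negbTE uv) eqxx.
have updE a x y : a u = 0%N -> a v = 0%N ->
    \sum_l (upd a x y l)%:Z * c l = x%:Z * c u + y%:Z * c v + \sum_l (a l)%:Z * c l.
  move=> au av; rewrite (bigD1 u) //= (bigD1 v) /=; last by rewrite eq_sym.
  rewrite [in RHS](bigD1 u) //= [in RHS](bigD1 v) /=; last by rewrite eq_sym.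
  rewrite au av !mul0r !add0r addrA upd_u upd_v.
  congr (_ + _); apply: eq_bigr => l /andP[lu lv].
  by rewrite /upd (negbTE lu) (negbTE lv).
have rep n : exists x y : nat, [/\ (x < N)%N, (y < N)%N & B (n - x%:Z * c u - y%:Z * c v)].
  have [[d l] /= [[dD Ll dl] _]] := tile n.
  have [y yD dE] := (sumsetP _ _).1 dD.
  have /boolp.choice[a aE] : forall l, exists a : 'I_N, y l = a%:Z * c l.
    by move=> m; apply/tile_termP.
  exists (a u), (a v); split=> //; exists (upd a 0 0)%N, l.
  have aa : (fun l => a l : nat) =1 upd (upd a 0 0)%N (a u) (a v).
    by move=> m; rewrite /upd; case: eqP => [->//|_]; case: eqP => [->|].
  split=> //; first by move=> m; rewrite /upd; case: ifP => // _; case: ifP.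
  apply/eqP; rewrite eqz_mod_dvd; move/eqP: dl; rewrite eqz_mod_dvd.
  congr (_ %| _)%Z; rewrite dE; under eq_bigr do rewrite aE aa.
  by rewrite (updE (upd _ _ _) (a u) (a v)) /= ?upd_u ?upd_v //; ring.
have uniq_rep n x y x' y' : (x < N)%N -> (y < N)%N -> (x' < N)%N -> (y' < N)%N ->
    B (n - x%:Z * c u - y%:Z * c v) -> B (n - x'%:Z * c u - y'%:Z * c v) ->
    x = x' /\ y = y'.
  move=> xN yN x'N y'N [a [l [aN au av Ll al]]] [a' [l' [a'N a'u a'v Ll' al']]].
  have [[d0 l0] /= [_ uniq0]] := tile n.
  have updN f z z' : (forall l, (f l < N)%N) -> (z < N)%N -> (z' < N)%N ->
      forall l, (upd f z z' l < N)%N.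
    by move=> fN zN z'N m; rewrite /upd; case: ifP => // _; case: ifP.
  have sum_in f : (forall l, (f l < N)%N) ->
      \sum_l (f l)%:Z * c l \in sumset (tile_term b D (k := k)).
    by move=> fN; apply/sumsetP; exists (fun l => (f l)%:Z * c l) => // m; apply: termP.
  have e1 : (d0, l0) = (\sum_l (upd a x y l)%:Z * c l, l).
    apply: uniq0; split=> //=; first by apply/sum_in/updN.
    apply/eqP; rewrite eqz_mod_dvd; move/eqP: al; rewrite eqz_mod_dvd.
    by congr (_ %| _)%Z; rewrite updE //; ring.
  have e2 : (d0, l0) = (\sum_l (upd a' x' y' l)%:Z * c l, l').
    apply: uniq0; split=> //=; first by apply/sum_in/updN.
    apply/eqP; rewrite eqz_mod_dvd; move/eqP: al'; rewrite eqz_mod_dvd.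
    by congr (_ %| _)%Z; rewrite updE //; ring.
  have : \sum_l (upd a x y l)%:Z * c l = \sum_l (upd a' x' y' l)%:Z * c l.
    by move: e1; rewrite e2 => -[].
  move=> /(direct _ _ (termP _ (updN _ _ _ aN xN yN)) (termP _ (updN _ _ _ a'N x'N y'N))) eqs.
  have := eqs u; have := eqs v; rewrite !upd_u !upd_v.
  by move=> /(mulIf (c0 v)) [->] /(mulIf (c0 u)) [->].
pose Bu (n : int) := exists2 y, (y < N)%N & B (n - y%:Z * c v).
have Tu : tiles_with N Bu (c u).
  move=> n; split; first by have [x [y [xN yN Bn]]] := rep n; exists x => //; exists y.
  by move=> x x' xN x'N [y yN By] [y' y'N By']; have [] := uniq_rep n x y x' y'.
(* Each step is multiplied by the part of the other that is prime to N; since the valuations agree,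
   the two products coincide ([wE]). *)
have Tu' : tiles_with N Bu (w' * c u).
  by apply: tiles_with_scale => //; exact: tau_coprime.
pose Bv (n : int) := exists2 x, (x < N)%N & B (n - x%:Z * (w' * c u)).
have Tv : tiles_with N Bv (c v).
  move=> n; split.
    have [[x xN [y yN By]] _] := Tu' n; exists y => //; exists x => //.
    by move: By; congr B; ring.
  move=> y y' yN y'N [x xN Bx] [x' x'N Bx'].
  have Bu1 : Bu (n - x%:Z * (w' * c u)).
    by exists y => //; move: Bx; congr B; ring.
  have Bu2 : Bu (n - x'%:Z * (w' * c u)).
    by exists y' => //; move: Bx'; congr B; ring.
  have xx' : x = x' := (Tu' n).2 _ _ xN x'N Bu1 Bu2; subst x'.
  have [] := uniq_rep (n - x%:Z * (w' * c u)) 0%N y 0%N y' => //.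
    by move: Bx; congr B; ring.
  by move: Bx'; congr B; ring.
have {}Tv : tiles_with N Bv (w * c v).
  by apply: tiles_with_scale => //; exact: tau_coprime.
have wE : w' * c u = w * c v by rewrite cuE cvE tau_uv; ring.
(* With equal steps, n + w c_v for n in B is reached both by the first digit 1 and by the second
   digit 1. *)
have [x [y [xN yN Bn]]] := rep 0; set n := _ - _ - _ in Bn.
have B1 : Bv (n + w * c v - 0%:Z * (w * c v)).
  by exists 1%N => //; rewrite wE; move: Bn; congr B; ring.
have B2 : Bv (n + w * c v - 1%:Z * (w * c v)).
  by exists 0%N => //; move: Bn; congr B; ring.
by have := (Tv (n + w * c v)).2 0%N 1%N N0 N1 B1 B2.
Qed.

End tiles.

(** * Averages over digit sums and their Fourier transforms *)

Lemma lt_norm_of_sqr (R : realDomainType) (u e : R) :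
  0 <= e -> u ^+ 2 < e ^+ 2 -> `|u| < e.
Proof.
by move=> e0; rewrite -[u ^+ 2]real_normK ?num_real // ltr_pXn2r // nnegrE.
Qed.

Section squared_modulus.
Variable R : realType.
Implicit Types z w : R[i].

Definition nsq (z : R[i]) : R := complex.Re z ^+ 2 + complex.Im z ^+ 2.

Lemma nsqE z : (nsq z)%:C = z * conjc z.
Proof. by case: z => a b; rewrite /nsq; simpc; congr (_ +i* _); ring. Qed.

Lemma nsqM z w : nsq (z * w) = nsq z * nsq w.
Proof. by case: z w => a b [c d]; rewrite /nsq; simpc => /=; ring. Qed.

Lemma nsq_ge0 z : 0 <= nsq z.
Proof. by rewrite addr_ge0 ?sqr_ge0. Qed.

Lemma nsqN z : nsq (- z) = nsq z.
Proof. by case: z => a b; rewrite /nsq /= !sqrrN. Qed.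

Lemma nsq_conj z : nsq (conjc z) = nsq z.
Proof. by case: z => a b; rewrite /nsq /= !sqrrN. Qed.

Lemma nsq_real (x : R) : nsq x%:C = x ^+ 2.
Proof. by rewrite /nsq /= expr0n addr0. Qed.

Lemma nsq0 : nsq 0 = 0. Proof. by rewrite /nsq /= expr0n addr0. Qed.
Lemma nsq1 : nsq 1 = 1. Proof. by rewrite /nsq /= expr0n expr1n addr0. Qed.

Lemma nsq_eq0 z : nsq z = 0 -> z = 0.
Proof.
case: z => a b /eqP; rewrite /nsq paddr_eq0 ?sqr_ge0 // !sqrf_eq0 /=.
by case/andP => /eqP -> /eqP ->.
Qed.

Lemma nsqD_le z w : nsq (z + w) <= 2 * nsq z + 2 * nsq w.
Proof.
case: z w => a b [c d]; rewrite /nsq /= -subr_ge0.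
rewrite (_ : _ - _ = (a - c) ^+ 2 + (b - d) ^+ 2); last by ring.
by rewrite addr_ge0 ?sqr_ge0.
Qed.

Lemma nsq_Re z : complex.Re z ^+ 2 <= nsq z.
Proof. by rewrite lerDl sqr_ge0. Qed.

Lemma nsq_Im z : complex.Im z ^+ 2 <= nsq z.
Proof. by rewrite lerDr sqr_ge0. Qed.

Lemma ReD z w : complex.Re (z + w) = complex.Re z + complex.Re w.
Proof. by case: z w => a b [c d]. Qed.
Lemma ImD z w : complex.Im (z + w) = complex.Im z + complex.Im w.
Proof. by case: z w => a b [c d]. Qed.
Lemma ReM_real (x : R) z : complex.Re (x%:C * z) = x * complex.Re z.
Proof. by case: z => a b /=; ring. Qed.
Lemma ImM_real (x : R) z : complex.Im (x%:C * z) = x * complex.Im z.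
Proof. by case: z => a b /=; ring. Qed.
Lemma Re_sum (I : Type) (r : seq I) (F : I -> R[i]) :
  complex.Re (\sum_(i <- r) F i) = \sum_(i <- r) complex.Re (F i).
Proof. by elim/big_rec2: _ => // i x y _ <-; rewrite ReD. Qed.
Lemma Im_sum (I : Type) (r : seq I) (F : I -> R[i]) :
  complex.Im (\sum_(i <- r) F i) = \sum_(i <- r) complex.Im (F i).
Proof. by elim/big_rec2: _ => // i x y _ <-; rewrite ImD. Qed.

Lemma nsq_prod (I : Type) (r : seq I) (F : I -> R[i]) :
  nsq (\prod_(i <- r) F i) = \prod_(i <- r) nsq (F i).
Proof. by elim/big_rec2: _ => [|i x y _ <-]; rewrite ?nsq1 ?nsqM. Qed.

Lemma conjcM z w : conjc (z * w) = conjc z * conjc w.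
Proof. exact: rmorphM. Qed.
Lemma conjcB z w : conjc (z - w) = conjc z - conjc w.
Proof. exact: rmorphB. Qed.
Lemma conjc_sum (I : Type) (r : seq I) (F : I -> R[i]) :
  conjc (\sum_(i <- r) F i) = \sum_(i <- r) conjc (F i).
Proof. exact: rmorph_sum. Qed.
Lemma conjc_natV n : conjc (n%:R^-1 : R[i]) = n%:R^-1.
Proof. by rewrite conjc_inv conjc_nat. Qed.

Lemma natcV_real n : (n%:R^-1 : R[i]) = (n%:R^-1)%:C.
Proof. by rewrite fmorphV rmorph_nat. Qed.

End squared_modulus.

Section averages.
Variables (R : realType) (N : nat).
Hypothesis N_gt0 : (0 < N)%N.

Section field.
Variable F : numFieldType.
Implicit Types (f g : R -> F) (x y : R) (xs ys : seq R).

(* avgs xs f y integrates f (y + .) against the convolution of the uniform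
   measures on {0, x, .., (N-1)x} for x in xs. *)
Definition avg x f y : F := N%:R^-1 * \sum_(j < N) f (y + j%:R * x).
Definition avgs xs f : R -> F := foldr avg f xs.

Let NF : N%:R != 0 :> F. Proof. by rewrite pnatr_eq0 -lt0n. Qed.

Lemma avgsS x xs f y : avgs (x :: xs) f y = avg x (avgs xs f) y.
Proof. by []. Qed.

Lemma eq_avgs xs f g : f =1 g -> avgs xs f =1 avgs xs g.
Proof. by move=> /boolp.funext ->. Qed.

Lemma avg_comm x x' f : avg x (avg x' f) = avg x' (avg x f).
Proof.
apply/boolp.funext => y; rewrite /avg; congr (_ * _).
rewrite -!mulr_sumr exchange_big /=; congr (_ * _).
by apply: eq_bigr => i _; apply: eq_bigr => j _; congr f; ring.
Qed.

Lemma avgs_cat xs ys f : avgs (xs ++ ys) f = avgs xs (avgs ys f).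
Proof. by rewrite /avgs foldr_cat. Qed.

Lemma avg_avgs x xs f : avg x (avgs xs f) = avgs xs (avg x f).
Proof. by elim: xs => //= x' xs <-; rewrite avg_comm. Qed.

Lemma avgs_perm xs ys f : perm_eq xs ys -> avgs xs f = avgs ys f.
Proof.
elim: xs ys => [|x xs IH] ys; first by rewrite perm_sym => /perm_nilP ->.
move=> pxy; have xys : x \in ys by rewrite -(perm_mem pxy) mem_head.
case/splitPr: xys pxy => y1 y2; rewrite perm_sym -cat1s perm_catCA perm_cons perm_sym => p12.
by rewrite /= -/(avgs xs f) (IH _ p12) !avgs_cat /= avg_avgs.
Qed.

Lemma avgsD xs f g y : avgs xs (fun z => f z + g z) y = avgs xs f y + avgs xs g y.
Proof.
elim: xs y => //= x xs IH y; rewrite /avg -mulrDr -big_split /=.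
by congr (_ * _); apply: eq_bigr => j _; rewrite IH.
Qed.

Lemma avgsZ xs c f y : avgs xs (fun z => c * f z) y = c * avgs xs f y.
Proof.
elim: xs y => //= x xs IH y; rewrite /avg mulrCA [in RHS]mulr_sumr.
by congr (_ * _); apply: eq_bigr => j _; rewrite IH.
Qed.

Lemma avgsN xs f y : avgs xs (fun z => - f z) y = - avgs xs f y.
Proof.
by rewrite -mulN1r -avgsZ; apply: eq_avgs => z; rewrite mulN1r.
Qed.

Lemma avgsB xs f g y : avgs xs (fun z => f z - g z) y = avgs xs f y - avgs xs g y.
Proof. by rewrite avgsD avgsN. Qed.

Lemma avgs_sum (I : Type) (r : seq I) xs (f : I -> R -> F) y :
  avgs xs (fun z => \sum_(i <- r) f i z) y = \sum_(i <- r) avgs xs (f i) y.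
Proof.
elim: r => [|i r IH]; last first.
  by rewrite big_cons -IH -avgsD; apply: eq_avgs => z; rewrite big_cons.
rewrite big_nil -[RHS](mul0r (avgs xs (fun=> 0) y)) -avgsZ.
by apply: eq_avgs => z; rewrite big_nil mul0r.
Qed.

Lemma avg_const c x y : avg x (fun=> c) y = c.
Proof. by rewrite /avg sumr_const card_ord -[c *+ N]mulr_natl mulKf. Qed.

Lemma avgs_const c xs y : avgs xs (fun=> c) y = c.
Proof.
elim: xs y => //= x xs IH y; rewrite -[RHS](avg_const c x y) /avg; congr (_ * _).
by apply: eq_bigr => j _; rewrite IH.
Qed.

Lemma avgs_shift xs f a y : avgs xs (fun z => f (z + a)) y = avgs xs f (y + a).
Proof.
elim: xs y => //= x xs IH y; rewrite /avg; congr (_ * _).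
by apply: eq_bigr => j _; rewrite IH addrAC.
Qed.

End field.

Implicit Types (x y : R) (xs ys : seq R).

Definition width xs : R := \sum_(x <- xs) N%:R * `|x|.

Lemma width_ge0 xs : 0 <= width xs.
Proof. by apply: sumr_ge0 => x _; rewrite mulr_ge0. Qed.

(** The average at y only sees points within [width xs] of y. This locality is what turns Lipschitz
    bounds into bounds on averages. *)
Lemma avgs_le xs (f g : R -> R) y :
  (forall z, `|z - y| <= width xs -> f z <= g z) -> avgs xs f y <= avgs xs g y.
Proof.
elim: xs y => [|x xs IH] y fg /=; first by apply: fg; rewrite subrr normr0 width_ge0.
rewrite /avg ler_wpM2l ?invr_ge0 //; apply: ler_sum => j _; apply: IH => z zy.
apply: fg; rewrite (_ : z - y = (z - (y + j%:R * x)) + j%:R * x); last by ring.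
rewrite (le_trans (ler_normD _ _)) // /width big_cons addrC lerD //.
by rewrite normrM normr_nat ler_wpM2r // ler_nat ltnW.
Qed.

Lemma avgs_ge0 xs (f : R -> R) y : (forall z, 0 <= f z) -> 0 <= avgs xs f y.
Proof.
by move=> f0; rewrite -(avgs_const 0 xs y); apply: avgs_le.
Qed.

Lemma avgs_Re xs (f : R -> R[i]) y :
  complex.Re (avgs xs f y) = avgs xs (fun z => complex.Re (f z)) y.
Proof.
elim: xs y => //= x xs IH y; rewrite /avg natcV_real ReM_real Re_sum.
by congr (_ * _); apply: eq_bigr => j _; rewrite IH.
Qed.

Lemma avgs_Im xs (f : R -> R[i]) y :
  complex.Im (avgs xs f y) = avgs xs (fun z => complex.Im (f z)) y.
Proof.
elim: xs y => //= x xs IH y; rewrite /avg natcV_real ImM_real Im_sum.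
by congr (_ * _); apply: eq_bigr => j _; rewrite IH.
Qed.

(* The variance of [f] under the average is non-negative. *)
Lemma nsq_avgs xs (f : R -> R[i]) y :
  nsq (avgs xs f y) <= avgs xs (fun z => nsq (f z)) y.
Proof.
have sq_avgs (g : R -> R) : (avgs xs g y) ^+ 2 <= avgs xs (fun z => g z ^+ 2) y.
  set m := avgs xs g y; rewrite -subr_ge0.
  have : 0 <= avgs xs (fun z => (g z - m) ^+ 2) y by apply: avgs_ge0 => z; exact: sqr_ge0.
  rewrite (@eq_avgs _ _ _ (fun z => g z ^+ 2 + ((- 2 * m) * g z + m ^+ 2))); last by move=> z; ring.
  rewrite avgsD avgsD avgsZ avgs_const -/m; congr (_ <= _); ring.
rewrite /nsq avgs_Re avgs_Im avgsD.
by apply: lerD; apply: sq_avgs.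
Qed.

End averages.

(** * The exponential and elementary trigonometric bounds *)

Section cis.
Variable R : realType.
Implicit Types x y : R.

Definition cis (y : R) : R[i] := cos (2 * pi * y) +i* sin (2 * pi * y).

Lemma expiE l x : expi l x = cis (l * x).
Proof. by rewrite /expi /cis mulrA. Qed.

Lemma cisD x y : cis (x + y) = cis x * cis y.
Proof.
rewrite /cis mulrDr sinD cosD; simpc; congr (_ +i* _); ring.
Qed.

Lemma cis0 : cis 0 = 1.
Proof. by rewrite /cis mulr0 sin0 cos0. Qed.

Lemma conjc_cis x : conjc (cis x) = cis (- x).
Proof. by rewrite /cis mulrN sinN cosN. Qed.

Lemma nsq_cis x : nsq (cis x) = 1.
Proof. by rewrite /nsq /= cos2Dsin2. Qed.

Lemma cis_nat n : cis n%:R = 1.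
Proof.
elim: n => [|n IH]; first exact: cis0.
rewrite -natr1 cisD IH mul1r /cis mulr1.
by rewrite mulr2n mulrDl !mul1r -mulr2n cos2pi sin2pi.
Qed.

Lemma cis_int (a : int) : cis a%:~R = 1.
Proof.
case: a => n; first exact: cis_nat.
by rewrite NegzE mulrNz -conjc_cis cis_nat conjc1.
Qed.

Lemma cisD_int x (a : int) : cis (x + a%:~R) = cis x.
Proof. by rewrite cisD cis_int mulr1. Qed.

(** For the fractional part r, 1 - cos (2 pi r) = 2 sin^2 (pi r), which is positive when 0 < r <
    1. *)
Lemma cis_eq1 x : cis x = 1 -> exists a : int, x = a%:~R.
Proof.
move=> x1; exists (Num.floor x); apply/eqP; rewrite -subr_eq0; apply/negPn/negP => r0.
set r := x - _ in r0; have : cis r = 1.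
  by rewrite /r -mulrNz cisD_int.
have r_ge0 : 0 <= r by rewrite subr_ge0 ge_floor.
have r_lt1 : r < 1 by rewrite ltrBlDl -intrD1 floorD1_gt.
rewrite /cis => /(congr1 (@complex.Re R)) /=.
have -> : 2 * pi * r = (pi * r) *+ 2 by rewrite -mulr_natr; ring.
rewrite cos_mulr2n cos2sin2 => /eqP; rewrite -subr_eq0.
rewrite (_ : _ - 1 - 1 = - 2 * sin (pi * r) ^+ 2); last by ring.
rewrite mulf_eq0 oppr_eq0 pnatr_eq0 /= sqrf_eq0 gt_eqF // sin_gt0_pi //.
have r_gt0 : 0 < r by rewrite lt_neqAle eq_sym r0.
by rewrite mulr_gt0 ?pi_gt0 // gtr_pMr ?pi_gt0.
Qed.

Lemma norm_sin_le x : `|sin x| <= `|x|.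
Proof.
wlog x0 : x / 0 <= x => [H|].
  have [/H //|/ltW xneg] := leP 0 x.
  by have := H (- x); rewrite sinN !normrN oppr_ge0 => /(_ xneg).
have [c _] : exists2 c, c \in `[0, x] & sin x - sin 0 = cos c * (x - 0).
  apply: MVT_segment => //.
  by apply: continuous_subspaceT => y; exact: continuous_sin.
rewrite sin0 !subr0 => ->; rewrite normrM ler_piMl //; exact: cos_max.
Qed.

(** From cos x = 1 - 2 sin^2 (x/2) and sin^2 <= |sin|. A linear bound is enough, because the
    arguments to which it is applied decrease geometrically. *)
Lemma cos_ge x : 1 - `|x| <= cos x.
Proof.
have -> : x = (x / 2) *+ 2 by rewrite -mulr_natr mulfVK // pnatr_eq0.
rewrite cos_mulr2n cos2sin2; set s := sin (x / 2).
have sx : `|s| <= `|x / 2| by exact: norm_sin_le.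
have s2 : s ^+ 2 <= `|s|.
  by rewrite -[leLHS]ger0_norm ?sqr_ge0 // normrX expr2 ler_piMl // sin_max.
have -> : `|x / 2 *+ 2| = 2 * `|x / 2| by rewrite normrMn mulr_natl.
by rewrite mulr2n; lra.
Qed.

Lemma nsq_cisB x y : nsq (cis x - cis y) <= (2 * pi) ^+ 2 * (x - y) ^+ 2.
Proof.
have -> : nsq (cis x - cis y) = 4 * sin (pi * (x - y)) ^+ 2.
  have -> : cis x - cis y = (cis (x - y) - 1) * cis y.
    by rewrite mulrBl -cisD subrK mul1r.
  rewrite nsqM nsq_cis mulr1 /nsq /cis /=.
  have -> : 2 * pi * (x - y) = (pi * (x - y)) *+ 2 by rewrite -mulr_natr; ring.
  rewrite cos_mulr2n sin_mulr2n subr0; set u := pi * _.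
  rewrite -[(cos u * sin u) *+ 2]mulr_natr !exprMn cos2sin2; ring.
have : sin (pi * (x - y)) ^+ 2 <= (pi * (x - y)) ^+ 2.
  by rewrite -[leLHS]real_normK ?num_real // -[leRHS]real_normK ?num_real // lerXn2r ?nnegrE ?norm_sin_le.
rewrite !exprMn; lra.
Qed.

End cis.

(** * The mask of a digit set and its zeros *)

Section dirichlet.
Variables (R : realType) (N : nat).
Hypothesis N_prime : prime N.
Let N_gt0 : (0 < N)%N := prime_gt0 N_prime.
Implicit Types x y : R.

(* The Fourier transform of the uniform measure on {0, .., N-1}. *)
Definition dirichlet (y : R) : R[i] := N%:R^-1 * \sum_(j < N) cis (j%:R * y).

Let NC : N%:R != 0 :> R[i]. Proof. by rewrite pnatr_eq0 -lt0n. Qed.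
Let NR : N%:R != 0 :> R. Proof. by rewrite pnatr_eq0 -lt0n. Qed.

Lemma avgs_cis l xs y :
  avgs N xs (fun z => cis (l * z)) y = cis (l * y) * \prod_(x <- xs) dirichlet (l * x).
Proof.
elim: xs y => [|x xs IH] y /=; first by rewrite big_nil mulr1.
rewrite big_cons /avg /dirichlet mulrCA -!mulrA; congr (_ * _).
rewrite mulrA !mulr_suml; apply: eq_bigr => j _; rewrite IH -/(dirichlet _).
by rewrite mulrDr cisD mulrCA; congr (_ * _); rewrite mulrC.
Qed.

Lemma dirichlet0 : dirichlet 0 = 1.
Proof.
by rewrite /dirichlet; under eq_bigr do rewrite mulr0 cis0; rewrite sumr_const card_ord mulVf.
Qed.

Lemma dirichletD_int y (a : int) : dirichlet (y + a%:~R) = dirichlet y.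
Proof.
rewrite /dirichlet; congr (_ * _); apply: eq_bigr => j _.
by rewrite mulrDr -[j%:R in X in cis (_ + X)]/((j%:Z)%:~R) -intrM cisD_int.
Qed.

Lemma dirichlet_int (a : int) : dirichlet a%:~R = 1.
Proof. by rewrite -[a%:~R]add0r dirichletD_int dirichlet0. Qed.

Lemma dirichletN y : dirichlet (- y) = conjc (dirichlet y).
Proof.
rewrite /dirichlet conjcM conjc_sum conjc_natV; congr (_ * _).
by apply: eq_bigr => j _; rewrite conjc_cis mulrN.
Qed.

Let geometric y : (cis y - 1) * \sum_(j < N) cis (j%:R * y) = cis (N%:R * y) - 1.
Proof.
have cisX n : cis (n%:R * y) = cis y ^+ n.
  by elim: n => [|n IH]; rewrite ?mul0r ?cis0 // -natr1 mulrDl mul1r cisD IH exprSr.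
by rewrite cisX subrX1; congr (_ * _); apply: eq_bigr => j _; rewrite cisX.
Qed.

Lemma dirichlet_eq0 y (a : int) : N%:R * y = a%:~R -> ~~ (N%:Z %| a)%Z -> dirichlet y = 0.
Proof.
move=> Ny Na; have := geometric y; rewrite Ny cis_int subrr => /eqP.
rewrite mulf_eq0 => /orP[|/eqP S0]; last by rewrite /dirichlet S0 mulr0.
rewrite subr_eq0 => /eqP /cis_eq1[c yc]; case/negP: Na; apply/dvdzP; exists c.
apply/eqP; rewrite -(eqr_int R) -Ny yc mulrC intrM; apply/eqP.
by rewrite -[N%:R]/((N%:Z)%:~R).
Qed.

Lemma dirichlet_eq0P y : dirichlet y = 0 -> exists2 a : int, N%:R * y = a%:~R & ~~ (N%:Z %| a)%Z.
Proof.
move=> y0; have S0 : \sum_(j < N) cis (j%:R * y) = 0.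
  by apply/eqP; move/eqP: y0; rewrite /dirichlet mulf_eq0 invr_eq0 (negbTE NC).
have := geometric y; rewrite S0 mulr0 => /esym/eqP; rewrite subr_eq0 => /eqP.
move=> /cis_eq1[a Ny]; exists a => //; apply/negP => /dvdzP[c ac].
have yc : y = c%:~R.
  by apply: (mulfI NR); rewrite Ny ac intrM mulrC.
by move: y0; rewrite yc dirichlet_int => /eqP; rewrite oner_eq0.
Qed.

(** Parseval on Z/NZ. Summing over j turns the cross term of i and i' into the mask at (i' - i) w /
    N, which vanishes for i <> i' because N divides neither factor of (i' - i) w. *)
Lemma dft_parseval (w : int) (H : 'I_N -> R[i]) : ~~ (N%:Z %| w)%Z ->
  \sum_(j < N) nsq (N%:R^-1 * \sum_(i < N) cis (- (j%:R * i%:R * (w%:~R / N%:R))) * H i) =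
  N%:R^-1 * \sum_(i < N) nsq (H i).
Proof.
move=> Nw; apply: complexI; rewrite rmorph_sum rmorphM rmorph_sum /= -natcV_real.
set th : R := w%:~R / N%:R.
transitivity (\sum_(i < N) \sum_(i' < N) N%:R^-1 * H i * conjc (H i') *
    dirichlet ((i'%:R - i%:R) * th)).
  under eq_bigr => j _.
    rewrite nsqE conjcM conjc_sum conjc_natV.
    rewrite mulrACA big_distrlr /= mulr_sumr.
    over.
  rewrite exchange_big /=; apply: eq_bigr => i _.
  under eq_bigr do rewrite mulr_sumr.
  rewrite exchange_big /=; apply: eq_bigr => i' _.
  rewrite /dirichlet !mulr_sumr; apply: eq_bigr => j _.
  rewrite conjcM conjc_cis opprK.
  rewrite (_ : j%:R * ((i'%:R - i%:R) * th) = - (j%:R * i%:R * th) + j%:R * i'%:R * th); last by ring.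
  by rewrite cisD; ring.
rewrite mulr_sumr; apply: eq_bigr => i _; rewrite (bigD1 i) //= big1 ?addr0.
  by rewrite subrr mul0r dirichlet0 mulr1 nsqE mulrA.
move=> i' i'i; rewrite (@dirichlet_eq0 _ ((i'%:Z - i%:Z) * w)) ?mulr0 //.
  by rewrite intrM intrB /th mulrCA [N%:R * _]mulrC mulfVK.
rewrite dvdzE abszM absz_nat Euclid_dvdM // negb_or -[N]/(`|N%:Z|%N) -!dvdzE Nw andbT.
apply/negP => /dvdzP[c cE]; have := ltn_ord i; have := ltn_ord i'.
move/negP: i'i; rewrite -val_eqE /= => i'i iN i'N.
apply: i'i; move: cE iN i'N; move: (i : nat) (i' : nat) => u v cE uN vN.
have [c1|c1|c0] := ltgtP c 0; last by lia.
  have : c * N%:Z <= - N%:Z by rewrite -mulN1r ler_wpM2r //; lia.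
  by lia.
have : N%:Z <= c * N%:Z by rewrite -[leLHS]mul1r ler_wpM2r //; lia.
by lia.
Qed.

End dirichlet.

(** * Bounded Lipschitz test functions *)

Section bounded_lipschitz.
Variable R : realType.

Lemma lipschitz_continuous (f : R -> R) (B : R) :
  (forall x y, (f x - f y) ^+ 2 <= B * (x - y) ^+ 2) -> continuous f.
Proof.
move=> fB x; apply/cvgrPdist_lt => e e0.
set B' := Num.max B 1; have B'0 : 0 < B' by rewrite lt_max ltr01 orbT.
have d0 : 0 < e / Num.sqrt B' by rewrite divr_gt0 ?sqrtr_gt0.
near=> y; apply: lt_norm_of_sqr; first exact: ltW.
apply: le_lt_trans (fB x y) _; apply: (@le_lt_trans _ _ (B' * (x - y) ^+ 2)).
  by rewrite ler_wpM2r ?sqr_ge0 // le_max lexx.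
have xy : `|x - y| < e / Num.sqrt B' by near: y; exact: cvgr_dist_lt.
rewrite mulrC -ltr_pdivlMr // -[B' in ltRHS]sqr_sqrtr ?ltW // -expr_div_n.
move: xy; rewrite ltr_norml => /andP[xy1 xy2]; rewrite -subr_gt0 subr_sqr.
by rewrite mulr_gt0 //; lra.
Unshelve. all: by end_near. Qed.

(** Both bounds are put on squared moduli, so that they combine with [nsq] without square roots. The
    class contains exponentials and cut-offs, is stable under the operations used below, and is
    admissible in weak limits. *)
Definition bounded_lipschitz (f : R -> R[i]) := exists2 B : R, 0 <= B &
  (forall x, nsq (f x) <= B) /\ (forall x y, nsq (f x - f y) <= B * (x - y) ^+ 2).

Lemma bounded_lipschitzD f g : bounded_lipschitz f -> bounded_lipschitz g ->
  bounded_lipschitz (fun x => f x + g x).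
Proof.
move=> [B B0 [fb fl]] [C C0 [gb gl]]; exists (2 * B + 2 * C); first by lra.
split=> [x|x y]; first by have := nsqD_le (f x) (g x); have := fb x; have := gb x; lra.
rewrite (_ : _ - _ = (f x - f y) + (g x - g y)); last by ring.
by have := nsqD_le (f x - f y) (g x - g y); have := fl x y; have := gl x y; lra.
Qed.

Lemma bounded_lipschitzM f g : bounded_lipschitz f -> bounded_lipschitz g ->
  bounded_lipschitz (fun x => f x * g x).
Proof.
move=> [B B0 [fb fl]] [C C0 [gb gl]]; exists (4 * (B * C) + B * C).
  by rewrite addr_ge0 ?mulr_ge0.
split=> [x|x y].
  rewrite nsqM; apply: le_trans (_ : B * C <= _); first by rewrite ler_pM ?nsq_ge0.
  by rewrite lerDr ?mulr_ge0.
rewrite (_ : _ - _ = f x * (g x - g y) + (f x - f y) * g y); last by ring.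
have := nsqD_le (f x * (g x - g y)) ((f x - f y) * g y); rewrite !nsqM.
have : nsq (f x) * nsq (g x - g y) <= B * (C * (x - y) ^+ 2).
  by rewrite ler_pM ?nsq_ge0.
have : nsq (f x - f y) * nsq (g y) <= B * (x - y) ^+ 2 * C.
  by rewrite ler_pM ?nsq_ge0.
have : 0 <= B * C * (x - y) ^+ 2 by rewrite mulr_ge0 ?sqr_ge0 ?mulr_ge0.
by lra.
Qed.

Lemma bounded_lipschitz_cst c : bounded_lipschitz (fun=> c).
Proof.
exists (nsq c); rewrite ?nsq_ge0 //; split=> // x y.
by rewrite subrr nsq0 mulr_ge0 ?nsq_ge0 ?sqr_ge0.
Qed.

Lemma bounded_lipschitzN f : bounded_lipschitz f -> bounded_lipschitz (fun x => - f x).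
Proof.
move=> [B B0 [fb fl]]; exists B => //; split=> [x|x y]; first by rewrite nsqN.
by rewrite -opprD nsqN.
Qed.

Lemma bounded_lipschitz_conj f : bounded_lipschitz f ->
  bounded_lipschitz (fun x => conjc (f x)).
Proof.
move=> [B B0 [fb fl]]; exists B => //; split=> [x|x y]; first by rewrite nsq_conj.
by rewrite -conjcB nsq_conj.
Qed.

Lemma bounded_lipschitz_cis l : bounded_lipschitz (fun x => cis (l * x)).
Proof.
exists (1 + (2 * pi) ^+ 2 * l ^+ 2); first by apply: addr_ge0 => //; apply: mulr_ge0; exact: sqr_ge0.
split=> [x|x y]; first by rewrite nsq_cis lerDl mulr_ge0 ?sqr_ge0.
apply: le_trans (nsq_cisB _ _) _; have := sqr_ge0 (x - y); lra.
Qed.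

Lemma bounded_lipschitz_sum (I : Type) (r : seq I) (f : I -> R -> R[i]) :
  (forall i, bounded_lipschitz (f i)) ->
  bounded_lipschitz (fun x => \sum_(i <- r) f i x).
Proof.
move=> fl; elim: r => [|i r IH].
  by under boolp.eq_fun do rewrite big_nil; exact: bounded_lipschitz_cst.
by under boolp.eq_fun do rewrite big_cons; exact: bounded_lipschitzD.
Qed.

Lemma bounded_lipschitz_Re f : bounded_lipschitz f -> continuous (fun x => complex.Re (f x)).
Proof.
move=> [B B0 [fb fl]]; apply: (@lipschitz_continuous _ B) => x y.
by apply: le_trans (fl x y); apply: le_trans (nsq_Re _); rewrite raddfB.
Qed.

Lemma bounded_lipschitz_Im f : bounded_lipschitz f -> continuous (fun x => complex.Im (f x)).
Proof.
move=> [B B0 [fb fl]]; apply: (@lipschitz_continuous _ B) => x y.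
by apply: le_trans (fl x y); apply: le_trans (nsq_Im _); rewrite raddfB.
Qed.

Lemma bounded_lipschitz_nsq f : bounded_lipschitz f ->
  bounded_lipschitz (fun x => (nsq (f x))%:C).
Proof.
move=> fl; under boolp.eq_fun do rewrite nsqE.
by apply: bounded_lipschitzM => //; exact: bounded_lipschitz_conj.
Qed.

Definition clamp (z : R) : R := Num.min 1 (Num.max 0 z).

Lemma clamp01 z : 0 <= clamp z <= 1.
Proof. by rewrite /clamp le_min ge_min lexx ler01 le_max lexx. Qed.

Lemma clamp_lipschitz z z' : (clamp z - clamp z') ^+ 2 <= (z - z') ^+ 2.
Proof.
wlog zz : z z' / z' <= z => [H|].
  have [|/ltW] := leP z' z; first exact: H.
  by move=> /H; rewrite -sqrrN opprB -[(z' - z) ^+ 2]sqrrN opprB.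
have : 0 <= clamp z - clamp z' <= z - z'.
  by rewrite /clamp /Num.min /Num.max; do !case: ifPn => //; rewrite -?leNgt => *; lra.
by move=> /andP[d0 d1]; rewrite lerXn2r // nnegrE subr_ge0.
Qed.

Lemma bounded_lipschitz_clamp (p q : R) :
  bounded_lipschitz (fun y => (clamp (p * y + q))%:C).
Proof.
exists (1 + p ^+ 2); first by rewrite addr_ge0 ?sqr_ge0.
split=> [y|y z].
  rewrite nsq_real; have /andP[c0 c1] := clamp01 (p * y + q).
  by apply: (@le_trans _ _ 1); rewrite ?lerDl ?sqr_ge0 // expr_le1.
rewrite -rmorphB nsq_real; apply: le_trans (clamp_lipschitz _ _) _.
rewrite (_ : p * y + q - (p * z + q) = p * (y - z)); last by ring.
by rewrite exprMn ler_wpM2r ?sqr_ge0 // lerDr.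
Qed.

End bounded_lipschitz.

(** * Lower bounds for masks *)

Section dirichlet_bounds.
Variables (R : realType) (N : nat).
Hypothesis N_prime : prime N.
Let N_gt0 : (0 < N)%N := prime_gt0 N_prime.

Implicit Types y : R.

Let NR_gt0 : 0 < N%:R :> R. Proof. by rewrite ltr0n. Qed.

Lemma dirichlet_avgs (y : R) : dirichlet N y = avgs N [:: 1] (fun z => cis (y * z)) 0.
Proof. by rewrite avgs_cis big_seq1 mulr0 cis0 mul1r mulr1. Qed.

Lemma nsq_dirichlet_le1 y : nsq (dirichlet N y) <= 1.
Proof.
rewrite dirichlet_avgs; apply: le_trans (nsq_avgs N_gt0 _ _ _) _.
by rewrite (@eq_avgs _ _ _ _ _ (fun=> 1)) ?avgs_const // => z; exact: nsq_cis.
Qed.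

Lemma nsq_dirichlet_ge y : 1 - 4 * pi * N%:R * `|y| <= nsq (dirichlet N y).
Proof.
have Re_ge : 1 - 2 * pi * N%:R * `|y| <= complex.Re (dirichlet N y).
  rewrite dirichlet_avgs avgs_Re -[leLHS](@avgs_const R N N_gt0 R _ [:: 1] 0).
  apply: avgs_le => // z; rewrite subr0 /width big_seq1 normr1 mulr1 => zN.
  apply: le_trans (cos_ge _); rewrite lerD2l lerN2 !normrM (ger0_norm (pi_ge0 R)) normr_nat.
  rewrite -!mulrA ler_wpM2l // ler_wpM2l ?pi_ge0 // mulrC ler_wpM2r //.
apply: le_trans (nsq_Re _).
move: Re_ge; set r := complex.Re _; set a := `|y| => Re_ge.
by have := sqr_ge0 (r - 1); rewrite sqrrB1 -mulr_natr; lra.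
Qed.

(** The zeros are the a/N with N not dividing a, so none lies in the compact interval
    [-kappa, kappa], where the minimum is attained. *)
Lemma dirichlet_gt0_on (kappa : R) : 0 <= kappa -> kappa < N%:R^-1 ->
  exists2 c : R, 0 < c & forall y, `|y| <= kappa -> c <= nsq (dirichlet N y).
Proof.
move=> k0 kN; have le_k : - kappa <= kappa by lra.
have cont : continuous (fun y => nsq (dirichlet N y)).
  have bl : bounded_lipschitz (@dirichlet R N).
    apply: bounded_lipschitzM; first exact: bounded_lipschitz_cst.
    by apply: bounded_lipschitz_sum => j; exact: bounded_lipschitz_cis.
  exact: bounded_lipschitz_Re (bounded_lipschitz_nsq bl).
have [c] := EVT_min le_k (continuous_subspaceT cont).
rewrite in_itv /= => /andP[ck kc] cmin.
exists (nsq (dirichlet N c)) => [|y yk]; last first.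
  by apply: cmin; rewrite in_itv /= -ler_norml.
rewrite lt_neqAle nsq_ge0 andbT eq_sym; apply/eqP => /nsq_eq0 /(dirichlet_eq0P N_prime)[a Nc Na].
have : `|N%:R * c| < 1.
  rewrite normrM normr_nat mulrC -ltr_pdivlMr // div1r.
  by apply: le_lt_trans kN; rewrite ler_norml ck.
rewrite Nc -intr_norm -[1]/(1%:~R) ltr_int => a0; case/negP: Na.
by have -> : a = 0 by lia.
Qed.

(** The first k1 factors are at least the minimum c on [-kappa, kappa]. The factor k differs from 1
    by at most A / 2^k, so the later ones multiply to at least 1/2, whatever n is. *)
Lemma dirichlet_prod_ge (kappa : R) : 0 <= kappa -> kappa < N%:R^-1 ->
  exists2 c : R, 0 < c & forall n (y : nat -> R),
    (forall k, `|y k| <= kappa / 2 ^+ k) -> c <= \prod_(k < n) nsq (dirichlet N (y k)).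
Proof.
move=> k0 kN; have [c c0 cP] := dirichlet_gt0_on k0 kN.
have c1 : c <= 1.
  by have := cP 0; rewrite normr0 => /(_ k0) /le_trans; apply; exact: nsq_dirichlet_le1.
pose A : R := 4 * pi * N%:R * kappa.
have A0 : 0 <= A by rewrite /A !mulr_ge0 ?pi_ge0.
(* Then 4 A < k1 + 1 <= 2 ^ k1. The same device provides an explicit exponent several times
   below. *)
pose k1 := Num.truncn (4 * A).
have Ak : A / 2 ^+ k1 <= 1 / 4.
  rewrite ler_pdivrMr ?exprn_gt0 //.
  have : 4 * A < k1.+1%:R by exact: truncnS_gt.
  have : (k1.+1%:R : R) <= 2 ^+ k1 by rewrite -natrX ler_nat ltn_expl.
  by lra.
exists (c ^+ k1 / 2); first by rewrite divr_gt0 ?exprn_gt0.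
move=> n y yk.
have ge_c k : c <= nsq (dirichlet N (y k)).
  apply: cP; apply: le_trans (yk k) _; rewrite ler_pdivrMr ?exprn_gt0 //.
  by rewrite ler_peMr // exprn_ege1 // ler1n.
have head m : c ^+ m <= \prod_(k < m) nsq (dirichlet N (y k)).
  by rewrite -[X in c ^+ X]card_ord -prodr_const; apply: ler_prod => k _; rewrite ge_c ltW.
have [nk|kn] := leqP n k1.
  apply: le_trans (head n); apply: le_trans (_ : c ^+ k1 <= _).
    by rewrite ler_pdivrMr // ler_peMr ?exprn_ge0 ?ltW // ltr1n.
  by rewrite ler_wiXn2l // ltW.
rewrite -(subnKC (ltnW kn)) big_split_ord /=; apply: ler_pM => //.
  by rewrite exprn_ge0 // ltW.
move: (n - k1)%N => m.
set e := A / 2 ^+ k1 in Ak.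
have e0 : 0 <= e by rewrite divr_ge0 ?exprn_ge0.
(* This is 1 minus the geometric sum of the defects e / 2^i, i < m; as e <= 1/4 it stays at least
   1/2. *)
suff : 1 - 2 * e + 2 * (e / 2 ^+ m) <= \prod_(i < m) nsq (dirichlet N (y (k1 + i)%N)).
  have : 0 <= e / 2 ^+ m by rewrite divr_ge0 ?exprn_ge0.
  by lra.
elim: m => [|m IH]; first by rewrite big_ord0 expr0 divr1; lra.
rewrite big_ord_recr /=; set d := e / 2 ^+ m in IH.
have d0 : 0 <= d by rewrite divr_ge0 ?exprn_ge0.
have de : d <= e by rewrite ler_pdivrMr ?exprn_gt0 // ler_peMr // exprn_ege1 // ler1n.
have -> : e / 2 ^+ m.+1 = d / 2 by rewrite /d exprS; field; rewrite expf_neq0.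
have yd : 1 - d <= nsq (dirichlet N (y (k1 + m)%N)).
  apply: le_trans (nsq_dirichlet_ge _); rewrite lerD2l lerN2 /d /e /A.
  apply: le_trans (_ : 4 * pi * N%:R * (kappa / 2 ^+ (k1 + m)) <= _).
    by rewrite ler_wpM2l // !mulr_ge0 ?pi_ge0.
  by rewrite exprD invfM !mulrA.
apply: le_trans (_ : (1 - 2 * e + 2 * d) * (1 - d) <= _); last by apply: ler_pM => //; lra.
have : 0 <= d * (e - d) by rewrite mulr_ge0 // subr_ge0.
by nra.
Qed.

(** By [dft_parseval] the N squared values sum to 1, so one of them is at least 1/N. *)
Lemma dirichlet_digit (y : R) (w : int) : ~~ (N%:Z %| w)%Z ->
  exists2 j, (j < N)%N & N%:R^-1 <= nsq (dirichlet N (y + j%:R * (w%:~R / N%:R))).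
Proof.
move=> Nw; apply/boolp.notP => no_j.
have := dft_parseval N_prime (fun i : 'I_N => cis (i%:R * y)) (_ : ~~ (N%:Z %| - w)%Z).
rewrite rpredN => /(_ Nw).
under [in RHS]eq_bigr do rewrite nsq_cis.
rewrite sumr_const card_ord mulVf ?gt_eqF // => /eqP; apply/negP; rewrite lt_eqF //.
suff H : forall G : 'I_N -> R, (forall j, G j < N%:R^-1) -> \sum_j G j < 1.
  apply: H => j; rewrite ltNge; apply/negP => le_j; apply: no_j; exists (j : nat) => //.
  apply: le_trans le_j _; rewrite le_eqVlt; apply/orP; left; apply/eqP; congr nsq.
  rewrite /dirichlet; congr (_ * _); apply: eq_bigr => i _; rewrite -cisD; congr cis.
  by rewrite intrN; ring.
move=> G GN; have -> : 1 = \sum_(j < N) N%:R^-1 :> R.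
  by rewrite sumr_const card_ord -[RHS]mulr_natl mulfV ?gt_eqF.
apply: ltr_sum => //; apply/hasP; exists (Ordinal N_gt0) => //; exact: mem_index_enum.
Qed.

(** The multiplier m is built in base N. Induction, applied to the c_i / N, serves the indices of
    positive valuation. A new top digit a then moves each argument by a c_i / N: an integer, hence
    harmless, for those indices, and free to be chosen for the only possible index of valuation
    0. *)
Lemma dirichlet_digits (I : eqType) (r : seq I) (c : I -> int) (y : I -> R) (E : nat) :
  (forall i, i \in r -> c i != 0) ->
  {in r &, injective (fun i => tau N (c i))} ->
  (forall i, i \in r -> (tau N (c i) < E)%N) ->
  exists m : nat, forall i, i \in r ->
    N%:R^-1 <= nsq (dirichlet N (y i + m%:R * ((c i)%:~R / N%:R ^+ E))).
Proof.
elim: E r c => [|E IH] r c c0 c_inj cE.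
  by exists 0%N => i ir; have := cE i ir.
pose r' := [seq i <- r | (0 < tau N (c i))%N].
pose c' i := (c i %/ N%:Z)%Z.
have cc' i : i \in r' -> c i = N%:Z * c' i.
  rewrite mem_filter => /andP[ci ir]; rewrite mulrC divzK //.
  by rewrite -[N%:Z]expr1 dvdz_tau ?c0.
have Nz : N%:Z != 0 by have := N_gt0; lia.
have c'0 i : i \in r' -> c' i != 0.
  move=> ir'; have := c0 i; rewrite (cc' i ir'); move: ir'; rewrite mem_filter => /andP[_ ->].
  by move=> /(_ isT); rewrite mulf_eq0 negb_or => /andP[].
have tau_c' i : i \in r' -> tau N (c i) = (tau N (c' i)).+1.
  move=> ir'; rewrite (cc' i ir') tauM ?c'0 //.
  by rewrite {1}/tau absz_nat (pfactorK 1).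
have r'r i : i \in r' -> i \in r by rewrite mem_filter => /andP[].
have [|||m mP] := IH r' c'.
- exact: c'0.
- by move=> i j ir jr /= ij; apply: c_inj; rewrite ?r'r // !tau_c' // ij.
- by move=> i ir; have := cE i (r'r i ir); rewrite tau_c'.
have digit_shift (a : nat) i : y i + (m + a * N ^ E)%:R * ((c i)%:~R / N%:R ^+ E.+1) =
    y i + m%:R * ((c i)%:~R / N%:R ^+ E.+1) + a%:R * ((c i)%:~R / N%:R).
  rewrite natrD natrM natrX exprS; field; rewrite expf_neq0 ?gt_eqF //.
have [a aP] : exists a : nat, forall i, i \in r -> tau N (c i) = 0%N ->
    N%:R^-1 <= nsq (dirichlet N (y i + (m + a * N ^ E)%:R * ((c i)%:~R / N%:R ^+ E.+1))).
  have [/hasP[i0 i0r /eqP i0P]|/hasPn no_i] := boolP (has (fun i => tau N (c i) == 0%N) r); last first.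
    by exists 0%N => i /no_i /eqP.
  have Nc : ~~ (N%:Z %| c i0)%Z.
    by rewrite -[N%:Z]expr1 dvdz_tau ?c0 // i0P.
  have [a aN aP] := dirichlet_digit (y i0 + m%:R * ((c i0)%:~R / N%:R ^+ E.+1)) Nc.
  exists a => i ir iP; rewrite digit_shift (_ : i = i0) //.
  by apply: c_inj => //=; rewrite iP.
exists (m + a * N ^ E)%N => i ir; have [ci|] := posnP (tau N (c i)); first exact: aP.
move=> ci; have ir' : i \in r' by rewrite mem_filter ci.
apply: le_trans (mP i ir') _; rewrite digit_shift (cc' i ir') intrM.
rewrite (_ : a%:R * _ = (a%:Z * c' i)%:~R); last first.
  by rewrite intrM -[(N%:Z)%:~R]/(N%:R) [N%:R * _]mulrC mulfK ?gt_eqF.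
rewrite dirichletD_int (_ : N%:~R * _ / _ = (c' i)%:~R / N%:R ^+ E) //.
rewrite exprS -[N%:~R]/(N%:R); field; rewrite expf_neq0 ?gt_eqF //.
Qed.

End dirichlet_bounds.

(** * Levels of the digits *)

Lemma prod_ge_exp (R : numDomainType) (I : eqType) (r : seq I) (c : R) (F : I -> R) :
  0 <= c -> (forall i, i \in r -> c <= F i) -> c ^+ size r <= \prod_(i <- r) F i.
Proof.
move=> c0; elim: r => [|i r IH] cF; first by rewrite big_nil.
rewrite big_cons exprS ler_pM ?exprn_ge0 // ?cF ?mem_head // IH // => j jr.
by rewrite cF // inE jr orbT.
Qed.

Section levels.
Variables (R : realType) (N : nat) (b t : nat -> int) (C : nat).
Hypothesis N_prime : prime N.
Hypothesis b_neq0 : forall k, (1 <= k)%N -> b k != 0.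
Hypothesis t_neq0 : forall k, (1 <= k)%N -> t k != 0.
Hypothesis tau_t : forall k, (1 <= k)%N -> (tau N (t k) <= C)%N.
Hypothesis inj_s : injective_s N b t.

Local Notation P := (denom b).
Let P_neq0 k : P k != 0 := denom_neq0 b_neq0 k.

Definition digit_step (k : nat) : R := (t k)%:~R / (P k)%:~R.

(* The N-adic valuation of the inverse of the k-th digit step, shifted by C so
   that the subtraction is not truncated. *)
Definition level (k : nat) : nat := (tau N (P k) + C - tau N (t k))%N.

(** The range is long enough to catch every positive index of level below q ([mem_low_indices]). *)
Definition low_indices (q : nat) := [seq k <- iota 1 (q + C) | (level k < q)%N].

Lemma level_inj i j : (1 <= i)%N -> (1 <= j)%N -> level i = level j -> i = j.
Proof.
move=> i1 j1 ij; apply/eqP/negPn/negP => /eqP /(inj_s i1 j1); apply.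
rewrite !(s_seqE b N_prime t_neq0) //; move: ij; rewrite /level.
by have := tau_t i1; have := tau_t j1; lia.
Qed.

Lemma tau_denom_le i j : (i <= j)%N -> (tau N (P i) <= tau N (P j))%N.
Proof.
move=> ij; have := P_neq0 j; rewrite (denom_cat b ij) mulf_eq0 negb_or => /andP[? ?].
by rewrite tauM // leq_addr.
Qed.

Lemma tau_denom_level k : (1 <= k)%N -> (tau N (P k) <= level k <= tau N (P k) + C)%N.
Proof. by move=> k1; have := tau_t k1; rewrite /level; lia. Qed.

(** Pigeonhole: the indices 1, .., k have distinct levels, all below q + C. *)
Lemma denom_index_bound k q : (tau N (P k) < q)%N -> (k <= q + C)%N.
Proof.
move=> kq; rewrite -(size_iota 1 k) -(size_iota 0 (q + C)) -(size_map level).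
apply: uniq_leq_size.
  rewrite map_inj_in_uniq ?iota_uniq // => i j.
  by rewrite !mem_iota => /andP[i1 _] /andP[j1 _]; exact: level_inj.
move=> _ /mapP[i ik ->]; move: ik; rewrite !mem_iota add0n /= => /andP[i1 ik].
have := tau_denom_level i1; have : (tau N (P i) <= tau N (P k))%N by apply: tau_denom_le; lia.
by lia.
Qed.

Lemma level_index_bound k q : (1 <= k)%N -> (level k < q)%N -> (k <= q + C)%N.
Proof.
by move=> k1 kq; apply: denom_index_bound; have := tau_denom_level k1; lia.
Qed.

Lemma mem_low_indices k q : (k \in low_indices q) = (1 <= k)%N && (level k < q)%N.
Proof.
rewrite mem_filter mem_iota andbC; case: (ltnP (level k) q); rewrite ?andbF ?andbT //.
move=> kq; case: (posnP k) => [->//|k1] /=.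
by rewrite add1n ltnS level_index_bound.
Qed.

Lemma low_indices_split q K : (q + C <= K)%N ->
  perm_eq (iota 1 K) (low_indices q ++ [seq k <- iota 1 K | (q <= level k)%N]).
Proof.
move=> qK; rewrite -(perm_filterC (fun k => (level k < q)%N) (iota 1 K)).
have -> : [seq k <- iota 1 K | predC (fun k => (level k < q)%N) k] =
          [seq k <- iota 1 K | (q <= level k)%N].
  by apply: eq_filter => k /=; rewrite -leqNgt.
rewrite perm_cat2r; apply: uniq_perm; rewrite ?filter_uniq ?iota_uniq // => k.
rewrite mem_low_indices mem_filter mem_iota andbC; case: (ltnP (level k) q) => //; rewrite ?andbF ?andbT //.
move=> kq; case: (posnP k) => [->//|k1] /=.
by have := level_index_bound k1 kq; lia.
Qed.

Lemma low_indicesS_new q k : (1 <= k)%N -> level k = q ->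
  perm_eq (low_indices q.+1) (k :: low_indices q).
Proof.
move=> k1 kq; apply: uniq_perm; first by rewrite filter_uniq ?iota_uniq.
  by rewrite /= mem_low_indices kq ltnn andbF filter_uniq ?iota_uniq.
move=> i; rewrite inE !mem_low_indices ltnS [(level i <= q)%N]leq_eqVlt andb_orr; congr (_ || _).
apply/andP/eqP => [[i1 /eqP iq]|->]; last by rewrite kq.
by apply: level_inj; rewrite // iq.
Qed.

Lemma low_indicesS_old q : (forall k, (1 <= k)%N -> level k <> q) ->
  perm_eq (low_indices q.+1) (low_indices q).
Proof.
move=> no; apply: uniq_perm; rewrite ?filter_uniq ?iota_uniq //.
move=> i; rewrite !mem_low_indices ltnS [(level i <= q)%N]leq_eqVlt.
by case: posnP => //= i1; case: eqP => // /(no i i1).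
Qed.

Let PR_neq0 k : (P k)%:~R != 0 :> R. Proof. by rewrite intr_eq0. Qed.

Lemma digit_step_denom h k : (k <= h)%N ->
  digit_step k * (P h)%:~R = (numer b t h k)%:~R.
Proof.
move=> kh; apply: (mulfI (PR_neq0 k)); rewrite -intrM denom_numer //.
by rewrite /digit_step intrM; field; exact: PR_neq0.
Qed.

Let NR_neq0 e : N%:R ^+ e != 0 :> R.
Proof. by rewrite expf_neq0 // pnatr_eq0 -lt0n prime_gt0. Qed.

Lemma digit_step_lattice h k E : (1 <= k <= h)%N -> (E <= tau N (numer b t h k))%N ->
  exists a : int, digit_step k * ((P h)%:~R / N%:R ^+ E) = a%:~R.
Proof.
move=> kh; rewrite -(dvdz_tau N_prime) ?numer_neq0 // => /dvdzP[a aE].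
exists a; have /andP[k1 kleh] := kh; rewrite mulrA digit_step_denom // aE.
by rewrite intrM rmorphXn /= -[(N%:Z)%:~R]/(N%:R) mulfK.
Qed.

(** The right-hand side is independent of k: a low level means that P_h x_k is highly divisible by
    N, so P_h / N^E is a period of the digits of low level. *)
Lemma tau_numer_level h k : (1 <= k <= h)%N ->
  (tau N (numer b t h k) + level k)%N = (tau N (P h) + C)%N.
Proof.
move=> kh; have := tau_numer N b_neq0 t_neq0 kh.
have /andP[k1 _] := kh; have := tau_t k1; rewrite /level; lia.
Qed.

(* z advances the digit at level q: it is a period of the lower levels. *)
Lemma level_generator q k : (1 <= k)%N -> level k = q ->
  exists z : R, (forall i, i \in low_indices q -> exists a : int, digit_step i * z = a%:~R) /\
    exists2 w : int, ~~ (N%:Z %| w)%Z & digit_step k * z = w%:~R / N%:R.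
Proof.
move=> k1 kq; pose h := (q.+1 + C)%N.
have kh : (1 <= k <= h)%N.
  by rewrite k1 /h level_index_bound // kq.
have tk := tau_numer_level kh.
have [w [wE w0 tw]] := tau_decomp N_prime (numer_neq0 b_neq0 t_neq0 kh).
(* One power of N too many for digit k, whence the denominator N; lower levels have larger
   valuations and still give integers. *)
pose e := (tau N (numer b t h k)).+1.
exists ((P h)%:~R / N%:R ^+ e); split.
  move=> i; rewrite mem_low_indices => /andP[i1 iq].
  have ih : (1 <= i <= h)%N by rewrite i1 /h level_index_bound // ltnW.
  by apply: digit_step_lattice => //; have := tau_numer_level ih; lia.
exists w; first by rewrite -[N%:Z]expr1 dvdz_tau // tw.
have /andP[_ kleh] := kh; rewrite mulrA digit_step_denom // wE intrM rmorphXn /= -/e.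
rewrite -[(N%:Z)%:~R]/(N%:R) /e exprS; field.
by rewrite (NR_neq0 1) /= NR_neq0.
Qed.

Section lower_bound.
Variables (M m0 : nat).
Hypothesis b_ge2 : forall k, (1 <= k)%N -> 2 <= `|b k|.
Hypothesis t_le : forall k, (1 <= k)%N -> `|t k| <= M%:Z.
Hypothesis m0_ge1 : (1 <= m0)%N.
Hypothesis b_large : forall k, (m0 <= k)%N -> (N%:Z - 1) * `|t k| < `|b k|.

(** For integers the growth condition reads |b_k| >= (N-1)|t_k| + 1, so |t_k| / |b_k| <= M / ((N-1)M
    + 1). The factor 1/2 comes from reducing frequencies to size at most |P_h| / 2, and N >= 2 gives
    kappa < 1/N. *)
Let kappa : R := M%:R / ((N%:R - 1) * M%:R + 1) / 2.

Let N_ge1 : 1 <= N%:R :> R. Proof. by rewrite ler1n prime_gt0. Qed.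
Let den_gt0 : 0 < (N%:R - 1) * M%:R + 1 :> R.
Proof. by rewrite ltr_wpDl // mulr_ge0 // subr_ge0. Qed.
Let kappa_ge0 : 0 <= kappa. Proof. by rewrite !divr_ge0 // ltW. Qed.
Let kappa_lt : kappa < N%:R^-1.
Proof.
have N2 : 2 <= N%:R :> R by rewrite ler_nat prime_gt1.
rewrite /kappa -mulrA -invfM ltr_pdivrMr ?mulr_gt0 // mulrC ltr_pdivlMr; last by lra.
have : 0 <= (N%:R - 2) * M%:R :> R by rewrite mulr_ge0 // subr_ge0.
by lra.
Qed.

Let tail_small h n (y : R) : (m0 <= h.+1)%N -> `|y| <= `|(P h)%:~R| / 2 ->
  `|digit_step (h.+1 + n) * y| <= kappa / 2 ^+ n.
Proof.
move=> hm y_le; set k := (h.+1 + n)%N; have k1 : (1 <= k)%N by rewrite /k.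
have intR (a : int) : `|a|%:~R = `|a%:~R| :> R by rewrite intr_norm.
have denom_ge : `|(P h)%:~R| * 2 ^+ n * `|(b k)%:~R| <= `|(P k)%:~R| :> R.
  have -> : P k = P (h + n) * b k by rewrite /k addSn denomS.
  rewrite intrM normrM ler_wpM2r //; elim: n {k k1} => [|n IH]; first by rewrite addn0 mulr1.
  rewrite addnS denomS intrM normrM exprSr mulrA; apply: ler_pM => //.
  by rewrite -intR -[2]/(2%:~R) ler_int b_ge2.
have bk : (N%:R - 1) * `|(t k)%:~R| + 1 <= `|(b k)%:~R| :> R.
  have := b_large (leq_trans hm (leq_addr n _)); rewrite -/k -lezD1 -(ler_int R) intrD intrM intrB !intR.
  by [].
have tk : `|(t k)%:~R| <= M%:R :> R.
  by have := t_le k1; rewrite -(ler_int R) intR.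
have ratio : `|(t k)%:~R| <= 2 * kappa * `|(b k)%:~R|.
  apply: (@le_trans _ _ (2 * kappa * ((N%:R - 1) * `|(t k)%:~R| + 1))); last first.
    by rewrite ler_wpM2l // mulr_ge0.
  rewrite /kappa -[leLHS]divr1 (_ : 2 * _ * _ = M%:R * ((N%:R - 1) * `|(t k)%:~R| + 1) / ((N%:R - 1) * M%:R + 1)).
    by rewrite ler_pdivlMr // divr1; have := normr_ge0 ((t k)%:~R : R); nra.
  by field; rewrite gt_eqF.
rewrite normrM /digit_step normrM normfV mulrAC ler_pdivrMr ?normr_gt0 //.
apply: (@le_trans _ _ (2 * kappa * `|(b k)%:~R| * (`|(P h)%:~R| / 2))).
  by apply: ler_pM.
apply: (@le_trans _ _ (kappa / 2 ^+ n * (`|(P h)%:~R| * 2 ^+ n * `|(b k)%:~R|))); last first.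
  by rewrite ler_wpM2l // divr_ge0 // exprn_ge0.
rewrite le_eqVlt; apply/orP; left; apply/eqP; field.
by rewrite expf_neq0.
Qed.

(** Let h be the last index with tau (P_h) < q. Among the digits up to h, at most C have level >= q;
    a multiple of P_h / N^E, a period of the levels below q, makes each of their factors at least
    1/N. A multiple of P_h, which disturbs no digit up to h, then brings the frequency into the
    range of [tail_small] for the digits after h. *)
Lemma shifted_tail_bound : exists2 c : R, 0 < c &
  forall q, (tau N (P m0) < q)%N -> forall l : R, exists g : R,
    (forall k, k \in low_indices q -> exists a : int, digit_step k * g = a%:~R) /\
    forall K, c <= \prod_(k <- [seq k <- iota 1 K | (q <= level k)%N])
                     nsq (dirichlet N ((l + g) * digit_step k)).
Proof.
have [c c0 cP] := dirichlet_prod_ge N_prime kappa_ge0 kappa_lt.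
have NV_gt0 : 0 < N%:R^-1 :> R by rewrite invr_gt0 ltr0n prime_gt0.
have NV_le1 : N%:R^-1 <= 1 :> R by rewrite invf_le1 // ltr0n prime_gt0.
exists (N%:R^-1 ^+ C * c); first by rewrite mulr_gt0 ?exprn_gt0.
move=> q qm0 l.
have [h hq hmax] := @ex_maxnP (fun h => (tau N (P h) < q)%N) (q + C)
  (ex_intro _ m0 qm0) (fun h => @denom_index_bound h q).
have m0h : (m0 <= h)%N := hmax m0 qm0.
(* The threshold given by [tau_numer_level]: for indices up to h, level >= q means valuation < E,
   and level < q means valuation >= E. *)
pose E := (tau N (P h) + C + 1 - q)%N; have EC : (E <= C)%N by rewrite /E; lia.
pose r := [seq k <- iota 1 h | (q <= level k)%N].
have rP k : k \in r -> (1 <= k <= h)%N /\ (q <= level k)%N.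
  by rewrite mem_filter mem_iota => /andP[qk /andP[k1 kh]]; split; [lia|].
have r_tau k : k \in r -> (tau N (numer b t h k) < E)%N.
  move=> /rP[kh qk]; have := tau_numer_level kh; have /andP[k1 _] := kh.
  by have := tau_denom_level k1; rewrite /E; have /andP[_ /tau_denom_le] := kh; lia.
have r_inj : {in r &, injective (fun k => tau N (numer b t h k))}.
  move=> i j /rP[ih _] /rP[jh _] /= ij.
  have := tau_numer_level ih; have := tau_numer_level jh.
  have /andP[i1 _] := ih; have /andP[j1 _] := jh => *; apply: level_inj => //; lia.
have size_r : (size r <= C)%N.
  apply: leq_trans EC; rewrite -[E](size_iota 0) -(size_map (fun k => tau N (numer b t h k))).
  apply: uniq_leq_size; first by rewrite map_inj_in_uniq // filter_uniq ?iota_uniq.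
  by move=> _ /mapP[k kr ->]; rewrite mem_iota /= add0n r_tau.
have r_neq0 k : k \in r -> numer b t h k != 0 by move=> /rP[kh _]; exact: numer_neq0.
have [m mP] := dirichlet_digits N_prime (fun k => l * digit_step k) r_neq0 r_inj r_tau.
pose W : R := (P h)%:~R; have W0 : W != 0 by exact: PR_neq0.
pose l1 := l + m%:R * (W / N%:R ^+ E).
(* Nearest integer to l1 / W, which leaves at most |W| / 2. *)
pose a := Num.floor (l1 / W + 1 / 2).
pose g := m%:R * (W / N%:R ^+ E) - a%:~R * W.
have small : `|l + g| <= `|W| / 2.
  have -> : l + g = (l1 / W - a%:~R) * W by rewrite /g /l1; field; rewrite W0 NR_neq0.
  rewrite normrM mulrC ler_wpM2l // ler_norml.
  have := ge_floor (l1 / W + 1 / 2); have := floorD1_gt (l1 / W + 1 / 2).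
  rewrite -/a intrD => *; apply/andP; split; lra.
have gE k : digit_step k * g = m%:R * (digit_step k * (W / N%:R ^+ E)) - a%:~R * (digit_step k * W).
  by rewrite /g; ring.
exists g; split.
  move=> k; rewrite mem_low_indices => /andP[k1 kq].
  have kh : (1 <= k <= h)%N.
    by rewrite k1; apply: hmax; have /andP[tk _] := tau_denom_level k1; exact: leq_ltn_trans tk kq.
  have [|u uE] := @digit_step_lattice h k E kh.
    by have := tau_numer_level kh; rewrite /E; move: kq; clear; lia.
  have /andP[_ kleh] := kh.
  exists (m%:Z * u - a * numer b t h k).
  by rewrite gE uE digit_step_denom // intrB !intrM.
have factor01 k : 0 <= nsq (dirichlet N ((l + g) * digit_step k)) <= 1.
  by rewrite nsq_ge0 nsq_dirichlet_le1.
pose F K := \prod_(k <- [seq k <- iota 1 K | (q <= level k)%N])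
                     nsq (dirichlet N ((l + g) * digit_step k)).
(* All factors are at most 1, so the bound is only needed for h + K digits, split at h. *)
have F_anti K n : F (K + n)%N <= F K.
  rewrite /F iotaD filter_cat big_cat /= ler_piMr //.
    by apply: prodr_ge0 => k _; exact: nsq_ge0.
    suff /andP[] : 0 <= \prod_(k <- [seq k <- iota (1 + K) n | (q <= level k)%N])
                     nsq (dirichlet N ((l + g) * digit_step k)) <= 1 by [].
    elim/big_ind: _ => [|u v /andP[? ?] /andP[? ?]|k _]; rewrite ?ler01 ?lexx ?factor01 //.
    by rewrite mulr_ge0 // mulr_ile1.
move=> K; apply: (@le_trans _ _ (F (h + K)%N)); last by rewrite addnC; exact: F_anti.
rewrite /F iotaD filter_cat big_cat /=; apply: ler_pM; [by rewrite exprn_ge0 // ltW | exact: ltW | |].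
  apply: (@le_trans _ _ (N%:R^-1 ^+ size r)); first by rewrite ler_wiXn2l // ltW.
  apply: prod_ge_exp; first exact: ltW.
  move=> k kr; apply: le_trans (mP k kr) _; have [/andP[k1 kh] _] := rP k kr.
  rewrite -(digit_step_denom kh) -/W -(dirichletD_int N (_ + _) (- a * numer b t h k)).
  rewrite intrM intrN -(digit_step_denom kh) -/W.
  by rewrite le_eqVlt; apply/orP; left; apply/eqP; congr (nsq (dirichlet _ _)); rewrite /g; ring.
(* By maximality of h, every index beyond h has level at least q. *)
rewrite (eq_in_filter (a2 := predT)); last first.
  move=> k; rewrite mem_iota => /andP[hk _]; apply/idP.
  have k1 : (1 <= k)%N := leq_trans (leq_addr h 1) hk.
  apply: leq_trans (_ : tau N (P k) <= _)%N; last by case/andP: (tau_denom_level k1).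
  by rewrite leqNgt; apply/negP => /hmax kh; have := leq_trans hk kh; rewrite add1n ltnn.
rewrite filter_predT -[(1 + h)%N]addn0 iotaDl big_map -[X in iota 0 X]subn0 -/(index_iota 0 K) big_mkord.
apply: (cP K (fun i => (l + g) * digit_step (1 + h + i)%N)) => k; rewrite mulrC add1n; apply: tail_small => //.
by rewrite ltnW // ltnS.
Qed.

End lower_bound.
End levels.

(** * Spectra of finitely many digits *)

Section finite_spectra.
Variables (R : realType) (N : nat).
Hypothesis N_prime : prime N.
Let N_gt0 : (0 < N)%N := prime_gt0 N_prime.
Implicit Types (xs ts L : seq R) (f : R -> R[i]).

(* L is a spectrum of every translate of the finite measure given by avgs. *)
Definition parseval xs L := forall f y,
  \sum_(l <- L) nsq (avgs N xs (fun z => f z * cis (- (l * z))) y) =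
  avgs N xs (fun z => nsq (f z)) y.

(** All points averaged differ from y by sums of multiples of the steps, and on these the
    exponential of frequency g is 1. *)
Lemma avgs_period xs (g : R) f y :
  (forall x, x \in xs -> exists a : int, x * g = a%:~R) ->
  avgs N xs (fun z => f z * cis (- (g * z))) y = avgs N xs f y * cis (- (g * y)).
Proof.
elim: xs y => //= x xs IH y gx; rewrite /avg -mulrA mulr_suml; congr (_ * _).
apply: eq_bigr => j _; rewrite IH; last by move=> x' x'xs; apply: gx; rewrite inE x'xs orbT.
have [|a ga] := gx x; first exact: mem_head.
congr (_ * _); rewrite -[RHS](cisD_int _ (- (j%:Z * a))); congr cis.
by rewrite intrN intrM -ga -[(j%:Z)%:~R]/(j%:R); ring.
Qed.

Lemma parseval_nil : parseval [::] [:: 0].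
Proof. by move=> f y; rewrite big_seq1 /= nsqM nsq_cis mulr1. Qed.

Lemma parseval_perm xs xs' L : perm_eq xs xs' -> parseval xs L -> parseval xs' L.
Proof.
move=> pxs pL f y; rewrite -(avgs_perm N _ pxs) -pL.
by apply: eq_bigr => l _; rewrite -(avgs_perm N _ pxs).
Qed.

(** Each frequency may be moved by its own period: by [avgs_period] its coefficient only changes by
    a factor of modulus 1. *)
Lemma parseval_adjust xs L (G : R -> R) :
  (forall l x, x \in xs -> exists a : int, x * G l = a%:~R) ->
  parseval xs L -> parseval xs [seq l + G l | l <- L].
Proof.
move=> Gx pL f y; rewrite big_map -pL; apply: eq_bigr => l _.
have -> : (fun z => f z * cis (- ((l + G l) * z))) =
          (fun z => (f z * cis (- (l * z))) * cis (- (G l * z))).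
  by apply/boolp.funext => z; rewrite mulrDl opprD cisD mulrA.
by rewrite avgs_period ?nsqM ?nsq_cis ?mulr1 // => x xxs; exact: Gx.
Qed.

(** Since z is a period of xs, the coefficient at l + j z is, up to a phase, the j-th Fourier
    coefficient on Z/NZ of the N translated coefficients at l, one for each multiple of x. Parseval
    on Z/NZ reduces the claim to xs. *)
Lemma parseval_step xs L (x z : R) (w : int) :
  (forall x', x' \in xs -> exists a : int, x' * z = a%:~R) ->
  ~~ (N%:Z %| w)%Z -> x * z = w%:~R / N%:R ->
  parseval xs L -> parseval (x :: xs) [seq l + j%:R * z | l <- L, j <- iota 0 N].
Proof.
move=> zxs Nw zx pL f y; rewrite big_allpairs_dep.
transitivity (\sum_(l <- L) N%:R^-1 * \sum_(i < N)
    nsq (avgs N xs (fun u => f u * cis (- (l * u))) (y + i%:R * x))).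
  apply: eq_bigr => l _; pose H (i : 'I_N) := avgs N xs (fun u => f u * cis (- (l * u))) (y + i%:R * x).
  rewrite -[RHS]/(N%:R^-1 * \sum_i nsq (H i)) -(dft_parseval N_prime H Nw) -[X in iota 0 X]subn0 -/(index_iota 0 N) big_mkord.
  apply: eq_bigr => j _; rewrite -[RHS]mul1r -[X in _ = X * _](nsq_cis (- (j%:R * z * y))) -nsqM; congr nsq.
  rewrite avgsS /avg [RHS]mulrCA; congr (_ * _); rewrite mulr_sumr; apply: eq_bigr => i _.
  have -> : (fun u => f u * cis (- ((l + j%:R * z) * u))) =
            (fun u => (f u * cis (- (l * u))) * cis (- (j%:R * z * u))).
    by apply/boolp.funext => u; rewrite mulrDl opprD cisD mulrA.
  rewrite avgs_period; last first.
    move=> x' /zxs[a ax']; exists (j%:Z * a).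
    by rewrite intrM -ax' -[(j%:Z)%:~R]/(j%:R); ring.
  by rewrite [RHS]mulrA -cisD -zx mulrC; congr (cis _ * _); ring.
rewrite -mulr_sumr exchange_big /= /avg; congr (_ * _).
by apply: eq_bigr => i _; rewrite pL.
Qed.

Lemma parseval_dirichlet xs L l : parseval xs L ->
  \sum_(l' <- L) \prod_(x <- xs) nsq (dirichlet N ((l - l') * x)) = 1.
Proof.
move=> pL; have := pL (fun z => cis (l * z)) 0.
have -> : (fun z : R => nsq (cis (l * z))) = (fun=> 1).
  by apply/boolp.funext => z; rewrite nsq_cis.
rewrite avgs_const // => pL1; rewrite -[RHS]pL1; apply: eq_bigr => l' _.
have -> : (fun z => cis (l * z) * cis (- (l' * z))) = (fun z => cis ((l - l') * z)).
  by apply/boolp.funext => z; rewrite -cisD; congr cis; ring.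
by rewrite avgs_cis // mulr0 cis0 mul1r nsq_prod.
Qed.

(** One occurrence of l already contributes 1 to a sum of non-negative terms equal to 1. Stating it
    with [rem] also covers a repeated l, which yields [parseval_uniq]. *)
Lemma parseval_rem xs L l l' : parseval xs L -> l \in L -> l' \in rem l L ->
  \prod_(x <- xs) nsq (dirichlet N ((l - l') * x)) = 0.
Proof.
move=> pL lL l'L; have := parseval_dirichlet l pL.
rewrite (perm_big _ (perm_to_rem lL)) big_cons /= big1_seq => [|x _]; last first.
  by rewrite subrr mul0r dirichlet0 ?nsq1.
move=> /eqP; rewrite -subr_eq0 [1 + _]addrC addrK => /eqP.
rewrite (perm_big _ (perm_to_rem l'L)) big_cons /= => /eqP.
have F0 v : 0 <= \prod_(x <- xs) nsq (dirichlet N ((l - v) * x)).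
  by apply: prodr_ge0 => x _; exact: nsq_ge0.
by rewrite paddr_eq0 ?F0 ?sumr_ge0 // => /andP[/eqP].
Qed.

Lemma parseval_uniq xs L : parseval xs L -> uniq L.
Proof.
move=> pL; apply: count_mem_uniq => l; have [lL|/count_memPn -> //] := boolP (l \in L).
have /count_memPn : l \notin rem l L.
  apply/negP => /(parseval_rem pL lL); under eq_bigr do rewrite subrr mul0r dirichlet0 // nsq1.
  by rewrite big1_eq => /eqP; rewrite oner_eq0.
by rewrite (permP (perm_to_rem lL)) /= eqxx => ->.
Qed.

Lemma parseval_orth xs L l l' : parseval xs L -> l \in L -> l' \in L -> l != l' ->
  \prod_(x <- xs) dirichlet N ((l - l') * x) = 0.
Proof.
move=> pL lL l'L ll'; apply: nsq_eq0; rewrite nsq_prod; apply: parseval_rem lL _ => //.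
by rewrite (rem_filter _ (parseval_uniq pL)) mem_filter /= eq_sym ll'.
Qed.

(* Lower frame bound for Lipschitz f: integrating the exponentials over the tail
   ts multiplies the coefficients by the masks, which are bounded below, while f
   hardly varies on the tail. *)
Lemma frame_lower xs ts L f (c B : R) : 0 <= B -> 0 <= c -> c <= 1 ->
  parseval xs L ->
  (forall l, l \in L -> c <= \prod_(x <- ts) nsq (dirichlet N (l * x))) ->
  (forall x y, nsq (f x - f y) <= B * (x - y) ^+ 2) ->
  c / 4 * avgs N (ts ++ xs) (fun z => nsq (f z)) 0 - 2 * (B * width N ts ^+ 2) <=
  \sum_(l <- L) nsq (avgs N (ts ++ xs) (fun z => f z * cis (- (l * z))) 0).
Proof.
move=> B0 c0 c1 pL cL lipf; set w := width N ts.
have w0 : 0 <= w := width_ge0 N ts.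
set e := fun l z : R => cis (- (l * z)).
pose U l y := avgs N xs (fun z => f z * e l z) y.
pose V l := U l 0.
pose T l := avgs N ts (e l) 0.
pose A l := avgs N ts (U l) 0.
have AE l : avgs N (ts ++ xs) (fun z => f z * e l z) 0 = A l by rewrite avgs_cat.
have sq_le y : `|y - 0| <= w -> B * y ^+ 2 <= B * w ^+ 2.
  rewrite subr0 => yw; rewrite ler_wpM2l // -[y ^+ 2]real_normK ?num_real //.
  by rewrite lerXn2r // nnegrE.
have T_ge l : l \in L -> c <= nsq (T l).
  move=> lL; apply: le_trans (cL l lL) _.
  rewrite /T (@eq_avgs _ _ _ _ _ (fun z => cis (- l * z))); last by move=> z; rewrite /e mulNr.
  rewrite avgs_cis // mulr0 cis0 mul1r nsq_prod le_eqVlt; apply/orP; left; apply/eqP.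
  by apply: eq_bigr => x _; rewrite mulNr dirichletN nsq_conj.
have diffE l y : U l y - V l * e l y = avgs N xs (fun z => (f z - f (z - y)) * e l z) y.
  rewrite /V /U -[X in avgs N xs _ X * _](subrr y) -avgs_shift mulrC -avgsZ -avgsB.
  apply: eq_avgs => z; rewrite mulrBl; congr (_ - _).
  by rewrite /e mulrCA -cisD; congr (_ * cis _); ring.
(* If f did not vary along the tail, A l would equal T l * V l. The difference is an average of
   coefficients of f z - f (z - y), with y in the tail, to which Parseval for xs applies. *)
have err : \sum_(l <- L) nsq (A l - T l * V l) <= B * w ^+ 2.
  apply: (@le_trans _ _ (\sum_(l <- L) avgs N ts (fun y => nsq (U l y - V l * e l y)) 0)).
    apply: ler_sum => l _; rewrite mulrC /A /T -avgsZ -avgsB; exact: nsq_avgs.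
  rewrite -avgs_sum -[leRHS](avgs_const N_gt0 _ ts 0); apply: avgs_le => // y yw.
  under eq_bigr do rewrite diffE.
  rewrite pL; apply: le_trans (sq_le y yw); rewrite -[leRHS](avgs_const N_gt0 _ xs y).
  apply: avgs_le => // z _; apply: le_trans (lipf _ _) _.
  by rewrite opprB addrCA subrr addr0.
have total : avgs N (ts ++ xs) (fun z => nsq (f z)) 0 <=
    2 * avgs N xs (fun z => nsq (f z)) 0 + 2 * (B * w ^+ 2).
  rewrite avgs_cat -[leRHS](avgs_const N_gt0 _ ts 0); apply: avgs_le => // y yw.
  rewrite -[X in avgs N xs _ X]add0r -avgs_shift -avgsZ.
  apply: (@le_trans _ _ (avgs N xs (fun z => 2 * nsq (f z) + 2 * (B * w ^+ 2)) 0)).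
    apply: avgs_le => // z _; rewrite -[f (z + y)](subrK (f z)) addrC.
    apply: le_trans (nsqD_le _ _) _; rewrite lerD2l ler_wpM2l //.
    apply: le_trans (sq_le y yw); apply: le_trans (lipf _ _) _.
    by rewrite addrAC subrr add0r.
  by rewrite avgsD avgs_const.
have lower : c * avgs N xs (fun z => nsq (f z)) 0 <=
    2 * \sum_(l <- L) nsq (A l) + 2 * (B * w ^+ 2).
  rewrite -pL mulr_sumr.
  apply: (@le_trans _ _ (\sum_(l <- L) (2 * nsq (A l) + 2 * nsq (A l - T l * V l)))).
    rewrite big_seq [leRHS]big_seq; apply: ler_sum => l lL.
    apply: (@le_trans _ _ (nsq (T l * V l))).
      by rewrite nsqM ler_wpM2r ?nsq_ge0 ?T_ge.
    rewrite -[nsq (A l - _)]nsqN opprB; apply: le_trans (nsqD_le _ _).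
    by rewrite addrCA subrr addr0.
  by rewrite big_split /= -!mulr_sumr lerD2l ler_wpM2l.
rewrite (eq_bigr (fun l => nsq (A l))) => [|l _]; last by rewrite -AE.
have Bw0 : 0 <= B * w ^+ 2 by rewrite mulr_ge0 ?sqr_ge0.
(* The factor 4 comes from using |z + w|^2 <= 2 |z|^2 + 2 |w|^2 twice. *)
have := ler_wpM2l c0 total; have : c * (B * w ^+ 2) <= B * w ^+ 2 by rewrite ler_piMl.
by lra.
Qed.

End finite_spectra.

(** * Geometric decay of the steps *)

Section steps_width.
Variables (R : realType) (N : nat) (x : nat -> R) (M : R).
Hypothesis x_le : forall k, (1 <= k)%N -> `|x k| <= M / 2 ^+ k.

Lemma steps_bound_ge0 : 0 <= M.
Proof.
have := x_le (leqnn 1); rewrite expr1 => /(le_trans (normr_ge0 _)).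
by rewrite pmulr_lge0.
Qed.

Lemma width_steps n K : width N [seq x k | k <- iota n.+1 K] <= N%:R * M / 2 ^+ n.
Proof.
have M0 := steps_bound_ge0.
suff : width N [seq x k | k <- iota n.+1 K] <= N%:R * M / 2 ^+ n - N%:R * M / 2 ^+ (n + K).
  by move=> /le_trans; apply; rewrite gerBl divr_ge0 ?mulr_ge0 ?exprn_ge0.
elim: K => [|K IH]; first by rewrite addn0 subrr /width big_nil.
rewrite -[K.+1]addn1 iotaD map_cat /width big_cat /= big_seq1 -/(width _ _).
have xk := @x_le (n.+1 + K) isT.
apply: le_trans (lerD IH (ler_wpM2l (ler0n _ N) xk)) _.
rewrite addn1 addnS addSn exprS le_eqVlt; apply/orP; left; apply/eqP; field.
by rewrite !expf_neq0.
Qed.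

Lemma width_filter (p : pred nat) (r : seq nat) :
  width N [seq x k | k <- [seq k <- r | p k]] <= width N [seq x k | k <- r].
Proof.
rewrite /width !big_map big_filter big_mkcond /=; apply: ler_sum => k _.
by case: ifP => // _; rewrite mulr_ge0.
Qed.

End steps_width.

Section spectral_sequence.
Variables (R : realType) (N : nat) (b t : nat -> int) (C : nat).
Hypothesis N_prime : prime N.
Hypothesis b_neq0 : forall k, (1 <= k)%N -> b k != 0.
Hypothesis t_neq0 : forall k, (1 <= k)%N -> t k != 0.
Hypothesis tau_t : forall k, (1 <= k)%N -> (tau N (t k) <= C)%N.
Hypothesis inj_s : injective_s N b t.

Local Notation x := (@digit_step R b t).
Local Notation low := (low_indices N b t C).
Local Notation lev := (level N b t C).

Definition low_steps q := map x (low q).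

(** At most one digit has level q: if there is one, [parseval_step] applies, otherwise L is kept.
    The choice j = 0 retains each old frequency up to G, so L' contains L when G vanishes on L. *)
Lemma level_step q (L : seq R) (G : R -> R) : parseval N (low_steps q) L ->
  (forall l k, k \in low q.+1 -> exists a : int, x k * G l = a%:~R) ->
  exists L', [/\ parseval N (low_steps q.+1) L',
     forall l, l \in L -> l + G l \in L' &
     forall l', l' \in L' -> exists l, l' = l + G l].
Proof.
move=> pL Gk; have Gx l y : y \in low_steps q.+1 -> exists a : int, y * G l = a%:~R.
  by move=> /mapP[k kq ->]; exact: Gk.
have [[k k1 kq]|no_new] := boolp.pselect (exists2 k, (1 <= k)%N & lev k = q).
  have perm := low_indicesS_new N_prime b_neq0 t_neq0 tau_t inj_s k1 kq.
  have [z [zq [w Nw zk]]] := level_generator R N_prime b_neq0 t_neq0 tau_t inj_s k1 kq.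
  have pL1 := parseval_step N_prime (fun y => _) Nw zk pL.
  have {}pL1 : parseval N (low_steps q.+1) [seq l + j%:R * z | l <- L, j <- iota 0 N].
    apply: (@parseval_perm _ _ (x k :: low_steps q)); first by rewrite perm_sym -map_cons perm_map.
    by apply: pL1 => y /mapP[i iq ->]; exact: zq.
  exists [seq l + G l | l <- [seq l + j%:R * z | l <- L, j <- iota 0 N]].
  split; first exact: parseval_adjust.
    move=> l lL; apply/mapP; exists l => //; apply/allpairsP; exists (l, 0%N).
    by rewrite /= mul0r addr0 mem_iota prime_gt0.
  by move=> l' /mapP[l _ ->]; exists l.
have perm : perm_eq (low_steps q.+1) (low_steps q).
  apply: perm_map; apply: (low_indicesS_old N_prime b_neq0 t_neq0 tau_t inj_s) => k k1 kq.
  by apply: no_new; exists k.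
exists [seq l + G l | l <- L]; split.
- by apply: parseval_adjust => //; apply: parseval_perm pL; rewrite perm_sym.
- by move=> l lL; apply/mapP; exists l.
- by move=> l' /mapP[l _ ->]; exists l.
Qed.

Lemma low_spectrum q : exists L, parseval N (low_steps q) L.
Proof.
elim: q => [|q [L pL]].
  exists [:: 0]; rewrite /low_steps /low_indices (eq_filter (a2 := pred0)) // filter_pred0.
  exact: parseval_nil.
have [|L' [pL' _ _]] := @level_step q L (fun=> 0) pL; last by exists L'.
by move=> l k _; exists 0; rewrite mulr0.
Qed.

Variables (M : nat).
Hypothesis b_ge2 : forall k, (1 <= k)%N -> 2 <= `|b k|.
Hypothesis t_le : forall k, (1 <= k)%N -> `|t k| <= M%:Z.

Lemma digit_step_le k : (1 <= k)%N -> `|x k| <= M%:R / 2 ^+ k.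
Proof.
move=> k1; have intR (a : int) : `|a|%:~R = `|a%:~R| :> R by rewrite intr_norm.
rewrite normrM normfV; apply: ler_pM; rewrite ?invr_ge0 //.
  by rewrite -intR -[M%:R]/((M%:Z)%:~R) ler_int t_le.
rewrite lef_pV2 ?posrE ?exprn_gt0 ?normr_gt0 ?intr_eq0 ?denom_neq0 //.
elim: k {k1} => [|k IH]; first by rewrite /denom big_geq // normr1.
rewrite denomS intrM normrM exprSr ler_pM // -intR -[2]/(2%:~R) ler_int b_ge2 //.
Qed.

(** Once q exceeds the levels of the first n digits, only later digits remain, and their total width
    is at most N M / 2^n. *)
Lemma width_high (d : R) : 0 < d -> exists q1, forall q K, (q1 <= q)%N ->
  width N [seq x k | k <- [seq k <- iota 1 K | (q <= lev k)%N]] <= d.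
Proof.
move=> d0; pose A : R := N%:R * M%:R / d.
pose n := Num.truncn A; exists (\max_(k < n.+1) lev k).+1 => q K q1q.
apply: (@le_trans _ _ (N%:R * M%:R / 2 ^+ n)); last first.
  rewrite ler_pdivrMr ?exprn_gt0 // [leRHS]mulrC -ler_pdivrMr // -/A.
  apply: (@le_trans _ _ n.+1%:R); first by apply: ltW; exact: truncnS_gt.
  by rewrite -natrX ler_nat ltn_expl.
have [Kn|nK] := leqP K n.
  rewrite (@eq_in_filter _ _ pred0) ?filter_pred0 /width ?big_nil ?divr_ge0 ?mulr_ge0 ?exprn_ge0 //.
  move=> k; rewrite mem_iota => /andP[k1 kK]; apply/negbTE; rewrite -ltnNge.
  apply: leq_trans q1q; rewrite ltnS.
  have kn : (k < n.+1)%N by lia.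
  exact: (leq_bigmax (Ordinal kn)).
rewrite -(subnKC (ltnW nK)) iotaD filter_cat (@eq_in_filter _ _ pred0) ?filter_pred0 /=.
  by apply: le_trans (width_filter _ _ _ _) _; rewrite add1n; exact: (width_steps N digit_step_le).
move=> k; rewrite mem_iota => /andP[k1 kK]; apply/negbTE; rewrite -ltnNge.
apply: leq_trans q1q; rewrite ltnS.
have kn : (k < n.+1)%N by lia.
exact: (leq_bigmax (Ordinal kn)).
Qed.

Variable m0 : nat.
Hypothesis m0_ge1 : (1 <= m0)%N.
Hypothesis b_large : forall k, (m0 <= k)%N -> (N%:Z - 1) * `|t k| < `|b k|.

Definition tail_ge c q (l : R) := forall K,
  c <= \prod_(k <- [seq k <- iota 1 K | (q <= lev k)%N]) nsq (dirichlet N (l * x k)).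

Lemma tail_geS c q l : tail_ge c q l -> tail_ge c q.+1 l.
Proof.
move=> tl K; apply: le_trans (tl K) _; rewrite !big_filter [leLHS]big_mkcond [leRHS]big_mkcond /=.
apply: ler_prod => k _; have := nsq_dirichlet_le1 N_prime (l * x k).
have := nsq_ge0 (dirichlet N (l * x k)).
case: (ltnP q (lev k)) => [qk F0 F1|_ F0 F1]; first by rewrite (ltnW qk) F0 lexx.
by case: ifP => _; rewrite ?F0 ?F1 ?ler01 ?lexx.
Qed.

Lemma spectral_sequence : exists2 c : R, 0 < c <= 1 & exists (q0 : nat) (L : nat -> seq R),
  forall q, [/\ parseval N (low_steps (q0 + q)) (L q), {subset L q <= L q.+1} &
                forall l, l \in L q -> tail_ge c (q0 + q) l].
Proof.
have [c c0 cP] := shifted_tail_bound R N_prime b_neq0 t_neq0 tau_t inj_s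
  b_ge2 t_le m0_ge1 b_large.
(* The first level from which [shifted_tail_bound] is available. *)
pose q0 := (tau N (denom b m0)).+1.
have c1 : c <= 1.
  by have [g [_ /(_ 0%N)]] := cP q0 (ltnSn _) 0; rewrite big_nil.
exists c; first by rewrite c0.
have [g gP] : exists g : nat * R -> R, forall p : nat * R, (q0 <= p.1)%N ->
    (forall k, k \in low p.1 -> exists a : int, x k * g p = a%:~R) /\ tail_ge c p.1 (p.2 + g p).
  have /boolp.choice[g gP] : forall p : nat * R, exists g, (q0 <= p.1)%N ->
      (forall k, k \in low p.1 -> exists a : int, x k * g = a%:~R) /\ tail_ge c p.1 (p.2 + g).
    move=> [q l] /=; have [qq|_] := leqP q0 q; last by exists 0.
    by have [g gP] := cP q qq l; exists g.
  by exists g.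
pose good q L := parseval N (low_steps q) L /\ forall l, l \in L -> tail_ge c q l.
have [L0 [pL0 tL0]] : exists L0, good q0 L0.
  have [L pL] := low_spectrum q0; exists [seq l + g (q0, l) | l <- L]; split.
    by apply: parseval_adjust => // l _ /mapP[k kq ->]; apply: (gP (q0, l) _).1.
  by move=> _ /mapP[l _ ->]; exact: (gP (q0, l) _).2.
have /boolp.choice[next nextP] : forall p : nat * seq R, exists L', (q0 <= p.1)%N -> good p.1 p.2 ->
    good p.1.+1 L' /\ {subset p.2 <= L'}.
  move=> [q L] /=; have [qq|_] := leqP q0 q; last by exists [::].
  have [[pL tL]|] := boolp.pselect (good q L); last by exists [::].
  (* Old frequencies stay, so that the spectra are nested; they keep their tail bound because the
     next level has fewer factors. Only new frequencies are shifted. *)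
  pose G l := if l \in L then 0 else g (q.+1, l).
  have [|L' [pL' LL' L'G]] := @level_step q L G pL.
    move=> l k kq; rewrite /G; case: ifP => _; first by exists 0; rewrite mulr0.
    by apply: (gP (q.+1, l) _).1 => //=; exact: leqW.
  exists L' => _ _; split; last by move=> l lL; have := LL' l lL; rewrite /G lL addr0.
  split=> // l' /L'G[l ->]; rewrite /G; case: ifPn => lL.
    by rewrite addr0; exact/tail_geS/tL.
  by apply: (gP (q.+1, l) _).2; exact: leqW.
pose fix L q := if q is q'.+1 then next (q0 + q', L q')%N else L0.
have goodL q : good (q0 + q)%N (L q).
  elim: q => [|q IH]; first by rewrite addn0.
  by rewrite addnS; exact: (nextP (_, _) (leq_addr _ _) IH).1.
exists q0, L => q; have [pL tL] := goodL q; split=> //.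
exact: (nextP (_, _) (leq_addr _ _) (goodL q)).2.
Qed.

End spectral_sequence.

(** * The infinite convolution *)

Section finite_convolutions.
Variables (R : realType) (N : nat) (b t : nat -> int).
Hypothesis N_gt0 : (0 < N)%N.
Hypothesis b_neq0 : forall k, (1 <= k)%N -> b k != 0.
Hypothesis t_neq0 : forall k, (1 <= k)%N -> t k != 0.
Local Notation mR := (measurableTypeR R).
Local Notation x := (@digit_step R b t).

Lemma integral_uniform_fset (E : {fset R}) (g : R -> R) :
  (0 < #|` E|)%N -> measurable_fun [set: R] g -> (forall y, 0 <= g y) ->
  (\int[uniform_fset E]_y (g y)%:E = (#|` E|%:R^-1 * \sum_(y <- E) g y)%:E)%E.
Proof.
move=> E0 mg g0; set n := #|` E|.
pose nu : {measure set mR -> \bar R} := msum (fun i => \d_(E`_i : mR)) n.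
have nuT : nu setT = n%:R%:E.
  rewrite /nu /= /msum (eq_bigr (fun=> 1%:E)) => [|i _]; last exact: diracT.
  by rewrite sumEFin sumr_const card_ord.
have n0 : 0 < n%:R :> R by rewrite ltr0n.
have iE : (0 : R) <= n%:R^-1 by rewrite invr_ge0.
rewrite (@eq_measure_integral _ _ _ _ (mscale (NngNum iE) nu)); last first.
  move=> A mA _; rewrite /uniform_fset /= /mnormalize -/nu nuT /=.
  by rewrite eqe gt_eqF //= /mscale /= muleC.
rewrite ge0_integral_mscale //=; last 2 first.
  exact/measurable_EFinP.
  by move=> y _; rewrite lee_fin.
rewrite ge0_integral_measure_sum //; last 2 first.
  by move=> y _; rewrite lee_fin.
  exact/measurable_EFinP.
rewrite (eq_bigr (fun i : 'I_n => (g E`_i)%:E)) => [|i _]; last first.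
  rewrite (@integral_dirac _ mR E`_i R setT) //; last exact/measurable_EFinP.
  by rewrite diracT mul1e.
rewrite sumEFin -EFinM (big_nth 0) big_mkord; congr (_ * _)%:E.
Qed.

Lemma integral_digits (k : nat) (g : R -> R) : (1 <= k)%N ->
  measurable_fun [set: R] g -> (forall y, 0 <= g y) ->
  (\int[uniform_fset (scaled_fset b (fun k => digits N (t k)) k)]_y (g y)%:E =
   (avg N (x k) g 0)%:E)%E.
Proof.
move=> k1 mg g0; set E := scaled_fset _ _ _.
have Pk : \prod_(1 <= i < k.+1) (b i)%:~R = (denom b k)%:~R :> R.
  by rewrite /denom rmorph_prod.
have Pk0 : (denom b k)%:~R != 0 :> R by rewrite intr_eq0 denom_neq0.
(* The N digits and their rescalings are distinct, so the normalising factor is indeed 1/N. *)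
have inj1 : {in iota 0 N &, injective (fun i : nat => i%:Z * t k)}.
  by move=> i j _ _ /= /(mulIf (t_neq0 k1)) [].
have inj2 : injective (fun d : int => (\prod_(1 <= i < k.+1) (b i)%:~R)^-1 * d%:~R : R).
  by move=> i j /= /mulfI; rewrite Pk invr_eq0 => /(_ Pk0) /intr_inj.
have sizeE : #|` E| = N.
  rewrite /E /scaled_fset card_in_imfset /=; last by move=> i j _ _; exact: inj2.
  by rewrite /digits card_in_imfset //= undup_id ?iota_uniq // size_iota.
have := @integral_uniform_fset E g; rewrite sizeE => -> //; congr (_ * _)%:E.
rewrite /E /scaled_fset big_imfset /=; last by move=> i j _ _; exact: inj2.
rewrite /digits big_imfset //= undup_id ?iota_uniq // -[X in iota 0 X]subn0 -/(index_iota 0 N) big_mkord.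
apply: eq_bigr => j _; rewrite Pk add0r /digit_step intrM; congr g.
by rewrite mulrC mulrA.
Qed.

Lemma measurable_avg (y : R) (g : R -> R) :
  measurable_fun [set: R] g -> measurable_fun [set: R] (avg N y g).
Proof.
move=> mg; apply: measurable_funM => //; apply: measurable_sum => j.
by apply: measurableT_comp => //; apply: measurable_funD.
Qed.

Lemma avg_ge0 (y : R) (g : R -> R) : (forall z, 0 <= g z) -> forall z, 0 <= avg N y g z.
Proof. by move=> g0 z; exact: (avgs_ge0 N_gt0 [:: y]). Qed.

Lemma ge0_integral_finite_convolution n (g : R -> R) :
  measurable_fun [set: R] g -> (forall y, 0 <= g y) ->
  (\int[finite_convolution b (fun k => digits N (t k)) n]_y (g y)%:E =
   (avgs N [seq x k | k <- iota 1 n] g 0)%:E)%E.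
Proof.
elim: n g => [|n IH] g mg g0.
  by rewrite /= integral_dirac ?diracT ?mul1e //; exact/measurable_EFinP.
rewrite [finite_convolution _ _ _]/= /convolution ge0_integral_distribution; last 2 first.
- exact/measurable_EFinP.
- by move=> y; rewrite lee_fin.
rewrite fubini_tonelli1; last 2 first.
- by apply/measurable_EFinP; apply: measurableT_comp => //; exact: measurable_addR2.
- by move=> y; rewrite /= lee_fin.
under eq_integral => y _.
  rewrite /fubini_F /= /addR2 /=.
  rewrite (@integral_digits n.+1 (fun z => g (y + z))) //; last first.
    by apply: measurableT_comp => //; apply: measurable_funD.
  have -> : avg N (x n.+1) (fun z => g (y + z)) 0 = avg N (x n.+1) g y.
    by rewrite /avg; congr (_ * _); apply: eq_bigr => j _; rewrite add0r.
  over.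
rewrite IH; last 2 first.
  exact: measurable_avg.
  exact: avg_ge0.
by have := iotaD 1 n 1; rewrite addn1 => ->; rewrite map_cat avgs_cat.
Qed.

End finite_convolutions.

Section bounded_integrals.
Variables (R : realType) (mu : probability (measurableTypeR R) R).

Lemma bounded_integrable (f : R -> R) (B : R) : measurable_fun [set: R] f ->
  (forall y, `|f y| <= B) -> mu.-integrable [set: R] (EFin \o f).
Proof.
move=> mf fB; apply: (@le_integrable _ _ _ _ _ _ _ (EFin \o cst B)) => //.
- exact/measurable_EFinP.
- by move=> y _ /=; rewrite lee_fin (le_trans (fB y)) // ler_norm.
- exact: finite_measure_integrable_cst.
Qed.

(** Adding B makes f non-negative, which carries over to bounded f the formula obtained from
    Tonelli's theorem. *)
Lemma Rintegral_shift (f : R -> R) (B : R) : measurable_fun [set: R] f ->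
  (forall y, `|f y| <= B) -> \int[mu]_y f y = fine (\int[mu]_y (f y + B)%:E)%E - B.
Proof.
move=> mf fB; have intf := bounded_integrable mf fB.
have intB : mu.-integrable [set: R] (EFin \o cst B) by exact: finite_measure_integrable_cst.
rewrite -/(Rintegral mu setT (fun y => f y + B)) RintegralD // Rintegral_cst //.
rewrite [X in B * X](_ : _ = 1) ?mulr1 ?addrK //; exact: (congr1 fine (probability_setT mu)).
Qed.

End bounded_integrals.

Lemma Rintegral_finite_convolution (R : realType) (N : nat) (b t : nat -> int) n
    (f : R -> R) (B : R) :
  (0 < N)%N -> (forall k, (1 <= k)%N -> b k != 0) -> (forall k, (1 <= k)%N -> t k != 0) ->
  measurable_fun [set: R] f -> (forall y, `|f y| <= B) ->
  \int[finite_convolution b (fun k => digits N (t k)) n]_y f y =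
  avgs N [seq @digit_step R b t k | k <- iota 1 n] f 0.
Proof.
move=> N0 b0 t0 mf fB; rewrite (Rintegral_shift _ mf fB).
rewrite ge0_integral_finite_convolution //=; last 2 first.
- exact: measurable_funD.
- by move=> y; have := fB y; rewrite ler_norml; lra.
by rewrite avgsD avgs_const // addrK.
Qed.

(* The random series of the digits is realised on [0, 1) with Lebesgue measure,
   the k-th base-N digit of w choosing the multiple of x k. *)
Section digit_series.
Variables (R : realType) (N : nat) (x : nat -> R) (M : R).
Hypothesis N_gt0 : (0 < N)%N.
Hypothesis x_le : forall k, (1 <= k)%N -> `|x k| <= M / 2 ^+ k.

(** m is read in base N; its least significant digit multiplies the last step x n. *)
Fixpoint node (n m : nat) : R :=
  if n is n'.+1 then node n' (m %/ N) + (m %% N)%:R * x n else 0.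

Definition partial_sum (n : nat) (w : R) : R :=
  if 0 <= w < 1 then node n (Num.truncn (N%:R ^+ n * w)) else 0.

Lemma sum_node n (f : R -> R) :
  \sum_(m < N ^ n) f (node n m) = N%:R ^+ n * avgs N [seq x k | k <- iota 1 n] f 0.
Proof.
have N0 : N%:R != 0 :> R by rewrite pnatr_eq0 -lt0n.
elim: n f => [|n IH] f; first by rewrite expn0 big_ord1 mul1r.
have -> : iota 1 n.+1 = iota 1 n ++ [:: n.+1] by have := iotaD 1 n 1; rewrite addn1 => ->.
rewrite map_cat avgs_cat -[avgs _ (map _ [:: _]) _]/(avg N (x n.+1) f).
rewrite exprS -mulrA -IH mulr_sumr expnSr.
rewrite -(big_mkord xpredT (fun m => f (node n.+1 m))) big_nat_mul big_mkord.
apply: eq_bigr => i _; rewrite /avg mulrA divff // mul1r.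
rewrite -{1}[(i * N)%N]add0n mulSn big_addn addnK big_mkord.
by apply: eq_bigr => j _ /=; rewrite addnC divnMDl // divn_small // addn0 modnMDl modn_small.
Qed.

Let NR_gt0 : 0 < N%:R :> R. Proof. by rewrite ltr0n. Qed.

Lemma partial_sumS n w :
  `|partial_sum n.+1 w - partial_sum n w| <= N%:R * M / 2 ^+ n.+1.
Proof.
have M_ge0 := steps_bound_ge0 x_le.
rewrite /partial_sum; case: ifPn => [/andP[w0 w1]|_]; last first.
  by rewrite subrr normr0 divr_ge0 ?exprn_ge0 ?mulr_ge0.
set m := Num.truncn (N%:R ^+ n.+1 * w).
have mw : m%:R <= N%:R ^+ n.+1 * w < m.+1%:R.
  by apply: truncn_itv; rewrite mulr_ge0 // exprn_ge0.
have -> : Num.truncn (N%:R ^+ n * w) = (m %/ N)%N.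
  apply: truncn_def; case/andP: mw; rewrite exprS -mulrA => mw wm; apply/andP; split.
    rewrite -(ler_pM2l NR_gt0); apply: le_trans mw.
    by rewrite mulrC -natrM ler_nat leq_trunc_div.
  rewrite -(ltr_pM2l NR_gt0); apply: lt_le_trans wm _.
  by rewrite mulrC -natrM ler_nat ltn_ceil.
rewrite /= addrAC subrr add0r normrM normr_nat -mulrA; apply: ler_pM => //.
  by rewrite ler_nat ltnW // ltn_mod.
exact: x_le.
Qed.

Lemma partial_sum_cvg w : cvg (partial_sum ^~ w @ \oo).
Proof.
set A := N%:R * M.
have geo : A / 2 ^+ n @[n --> \oo] --> (0 : R).
  rewrite -[X in _ --> X](mulr0 A); apply: cvgM; first exact: cvg_cst.
  under eq_fun do rewrite -exprVn.
  by apply: cvg_expr; rewrite ger0_norm ?invr_ge0 // invf_lt1 // ltr1n.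
have A_ge0 : 0 <= A by rewrite mulr_ge0 // (steps_bound_ge0 x_le).
have step n : A / 2 ^+ n.+1 = A / 2 ^+ n - A / 2 ^+ n.+1.
  by rewrite exprS; field; rewrite expf_neq0.
(* Subtracting the bound A / 2^n on the rest of the series makes the sequence monotone, so
   convergence follows from boundedness. *)
have down n : partial_sum n w - A / 2 ^+ n <= partial_sum n.+1 w - A / 2 ^+ n.+1.
  by have := partial_sumS n w; have := step n; rewrite ler_norml -/A => *; lra.
have up n : partial_sum n w <= A - A / 2 ^+ n.
  elim: n => [|n IH]; first by rewrite /partial_sum /= expr0 divr1 subrr if_same.
  by have := partial_sumS n w; have := step n; rewrite ler_norml -/A => *; lra.
have cv : cvg (partial_sum n w - A / 2 ^+ n @[n --> \oo]).
  apply: nondecreasing_is_cvgn; first by apply/nondecreasing_seqP.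
  exists A => _ [n _ <-]; have := up n.
  have : 0 <= A / 2 ^+ n by rewrite divr_ge0 ?exprn_ge0.
  by lra.
have -> : partial_sum ^~ w = (fun n => (partial_sum n w - A / 2 ^+ n) + A / 2 ^+ n).
  by apply/funext => n; rewrite subrK.
by apply: is_cvgD => //; apply/cvg_ex; exists 0.
Qed.

Definition cylinder n m : set R := `[m%:R / N%:R ^+ n, m.+1%:R / N%:R ^+ n[.

Lemma partial_sum_indic n (f : R -> R) w : f 0 = 0 ->
  f (partial_sum n w) = \sum_(m < N ^ n) f (node n m) * \1_(cylinder n m) w.
Proof.
move=> f0; have Nn0 : 0 < N%:R ^+ n :> R by rewrite exprn_gt0.
have cylinderP m : (w \in cylinder n m) = (m%:R <= N%:R ^+ n * w < m.+1%:R).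
  by rewrite /cylinder mem_setE in_itv /= ler_pdivrMr // ltr_pdivlMr // mulrC.
rewrite /partial_sum; case: ifPn => [/andP[w0 w1]|w01]; last first.
  rewrite f0 big1 // => m _; rewrite indicE cylinderP.
  case: (boolP (_ <= _ < _)) => [/andP[mw wm]|_]; last by rewrite mulr0.
  case/negP: w01; apply/andP; split.
    by rewrite -(pmulr_rge0 _ Nn0); apply: le_trans mw.
  rewrite -(ltr_pM2l Nn0) mulr1; apply: lt_le_trans wm _.
  by rewrite -natrX ler_nat ltn_ord.
set m0 := Num.truncn _.
have m0w : m0%:R <= N%:R ^+ n * w < m0.+1%:R.
  by apply: truncn_itv; rewrite mulr_ge0 // exprn_ge0.
have m0N : (m0 < N ^ n)%N.
  rewrite -(ltr_nat R) natrX; case/andP: m0w => m0w _; apply: le_lt_trans m0w _.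
  by rewrite gtr_pMr.
rewrite (bigD1 (Ordinal m0N)) //= indicE cylinderP m0w mulr1 big1 ?addr0 // => m mm0.
rewrite indicE cylinderP.
case: (boolP (_ <= _ < _)) => [mw|_]; last by rewrite mulr0.
case/negP: mm0; apply/eqP/val_inj => /=.
by rewrite -(truncn_def mw).
Qed.

Lemma measurable_cylinder n m : measurable (cylinder n m).
Proof. exact: measurable_itv. Qed.

Lemma measurable_partial_sum n : measurable_fun [set: R] (partial_sum n).
Proof.
have -> : partial_sum n = fun w => \sum_(m < N ^ n) node n m * \1_(cylinder n m) w.
  by apply/funext => w; rewrite (@partial_sum_indic n id).
apply: measurable_sum => m; apply: measurable_funM => //.
by apply: measurable_indic; exact: measurable_cylinder.
Qed.

Let P : probability (measurableTypeR R) R := uniform_prob (@ltr01 R).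

Lemma uniform_cylinder n m : (m < N ^ n)%N -> \int[P]_w \1_(cylinder n m) w = N%:R ^- n.
Proof.
move=> mN; have Nn0 : 0 < N%:R ^+ n :> R by rewrite exprn_gt0.
have mc := measurable_cylinder n m.
rewrite /Rintegral /P integral_uniform; last 2 first.
- by apply/measurable_EFinP; exact: measurable_indic.
- by move=> w; rewrite lee_fin.
rewrite subr0 invr1 mul1e integral_indic // setIidl; last first.
  move=> w; rewrite /cylinder /= !in_itv /= => /andP[mw wm]; apply/andP; split.
    by apply: le_trans mw; rewrite divr_ge0 // exprn_ge0.
  apply: (le_trans (ltW wm)); rewrite ler_pdivrMr // mul1r -natrX ler_nat //.
rewrite [X in fine X](@lebesgue_measure_itv R `[m%:R / N%:R ^+ n, m.+1%:R / N%:R ^+ n[) /= lte_fin ltr_pM2r ?invr_gt0 // ltr_nat ltnSn /=.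
by rewrite -mulrBl -natr1 addrAC subrr add0r mul1r.
Qed.

Lemma Rintegral_partial_sum n (f : R -> R) :
  \int[P]_w f (partial_sum n w) = avgs N [seq x k | k <- iota 1 n] f 0.
Proof.
pose g y := f y - f 0.
have fE w : f (partial_sum n w) = f 0 + \sum_(m < N ^ n) g (node n m) * \1_(cylinder n m) w.
  by rewrite -(@partial_sum_indic n g) /g ?subrr // addrC subrK.
have int1 m : P.-integrable [set: R] (EFin \o (\1_(cylinder n m) : R -> R)).
  apply: (@bounded_integrable _ _ _ 1); first by apply: measurable_indic; exact: measurable_cylinder.
  by move=> y; rewrite indicE; case: (_ \in _); rewrite ?normr1 ?normr0.
have intS (r : seq 'I_(N ^ n)) :
    P.-integrable [set: R] (EFin \o (fun w => \sum_(m <- r) g (node n m) * \1_(cylinder n m) w)) /\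
    \int[P]_w (\sum_(m <- r) g (node n m) * \1_(cylinder n m) w) =
    \sum_(m <- r) g (node n m) * N%:R ^- n.
  elim: r => [|m r [intr IH]].
    rewrite big_nil; under [X in Rintegral _ _ X]eq_fun do rewrite big_nil.
    split; last by rewrite Rintegral_cst // mul0r.
    by under eq_fun do rewrite big_nil; exact: finite_measure_integrable_cst.
  have intm : P.-integrable [set: R] (EFin \o (fun w => g (node n m) * \1_(cylinder n m) w)).
    by have := integrableZl measurableT (g (node n m)) (int1 m).
  split.
    under eq_fun do rewrite big_cons.
    exact: (integrableD measurableT intm intr).
  under [X in Rintegral _ _ X]eq_fun do rewrite big_cons.
  rewrite RintegralD // IH big_cons; congr (_ + _).
  rewrite -(uniform_cylinder (ltn_ord m)); apply: RintegralZl => //; exact: int1.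
have [intg gE] := intS (index_enum 'I_(N ^ n)).
under [X in Rintegral _ _ X]eq_fun do rewrite fE.
rewrite RintegralD //; last exact: finite_measure_integrable_cst.
rewrite Rintegral_cst // [X in f 0 * X](_ : _ = 1); last exact: (congr1 fine (probability_setT P)).
rewrite mulr1 gE -mulr_suml sum_node mulrAC divff ?mul1r; last first.
  by rewrite expf_neq0 // gt_eqF.
by rewrite avgsB avgs_const // addrC subrK.
Qed.

(** The measure is the law of the sum psi of the series; dominated convergence for f composed with
    the partial sums gives the weak limit. *)
Lemma digit_series_measure : exists mu : probability (measurableTypeR R) R,
  forall f : R -> R, continuous f -> (exists B : R, forall y, `|f y| <= B) ->
    avgs N [seq x k | k <- iota 1 n] f 0 @[n --> \oo] --> \int[mu]_y f y.
Proof.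
pose psi w := limn (partial_sum ^~ w).
have psi_cvg w : partial_sum ^~ w @ \oo --> psi w by exact: partial_sum_cvg.
have mpsi : measurable_fun [set: R] psi.
  by apply: (measurable_fun_cvg measurable_partial_sum) => w _; exact: psi_cvg.
have mpsi' : @measurable_fun _ _ (measurableTypeR R) (measurableTypeR R) setT psi by exact: mpsi.
pose X : {RV P >-> measurableTypeR R} := HB.pack
  (psi : measurableTypeR R -> measurableTypeR R) (isMeasurableFun.Build _ _ _ _ _ mpsi').
exists (distribution P X) => f cf [B fB].
have mf : measurable_fun [set: R] f by exact: continuous_measurable_fun.
have mfpsi : measurable_fun [set: R] (f \o psi) := measurableT_comp mf mpsi.
have -> : \int[distribution P X]_y f y = \int[P]_w f (psi w).
  rewrite /Rintegral integral_distribution //; first exact/measurable_EFinP.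
  apply: (@bounded_integrable _ _ (f \o psi) B mfpsi) => y; exact: fB.
under eq_fun do rewrite -Rintegral_partial_sum.
have mfn n : measurable_fun [set: R] (fun w => f (partial_sum n w)).
  by apply: measurableT_comp => //; exact: measurable_partial_sum.
have [|||||intf _ cvgf] := @dominated_convergence _ _ _ P setT measurableT
  (fun n w => (f (partial_sum n w))%:E) (fun w => (f (psi w))%:E) (cst B%:E).
- by move=> n; apply/measurable_EFinP; exact: mfn.
- by apply/measurable_EFinP; exact: mfpsi.
- by apply: aeW => w _; apply: cvg_EFin; [exact: nearW | apply: cvg_comp (psi_cvg w) _; exact: cf].
- exact: finite_measure_integrable_cst.
- by apply: aeW => w n _; rewrite /= lee_fin.
rewrite /Rintegral; apply: fine_cvg; rewrite fineK //.
exact: integrable_fin_num.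
Qed.

End digit_series.

(** * Density of Lipschitz functions *)

Section density.
Variables (R : realType) (mu : probability (measurableTypeR R) R).
Implicit Types u v g : R -> R.

Definition sqint u : \bar R := (\int[mu]_y ((u y) ^+ 2)%:E)%E.

Lemma measurable_sqr u : measurable_fun [set: R] u ->
  measurable_fun [set: measurableTypeR R] (fun y => ((u y) ^+ 2)%:E).
Proof. by move=> mu_; apply/measurable_EFinP; exact: measurable_funX. Qed.

Lemma sqintD_le u v : measurable_fun [set: R] u -> measurable_fun [set: R] v ->
  (sqint (fun y => u y + v y)%R <= 2%:E * sqint u + 2%:E * sqint v)%E.
Proof.
move=> mu_ mv; have msu := measurable_sqr mu_; have msv := measurable_sqr mv.
rewrite -!ge0_integralZl //; try by move=> y _; rewrite lee_fin sqr_ge0.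
rewrite -ge0_integralD //; last 4 first.
- by move=> y _; rewrite -EFinM lee_fin mulr_ge0 ?sqr_ge0.
- by apply: measurable_funeM.
- by move=> y _; rewrite -EFinM lee_fin mulr_ge0 ?sqr_ge0.
- by apply: measurable_funeM.
apply: ge0_le_integral => //.
- by move=> y _; rewrite lee_fin sqr_ge0.
- by apply: measurable_sqr; exact: measurable_funD.
- by apply: emeasurable_funD; exact: measurable_funeM.
move=> y _; rewrite -!EFinM -EFinD lee_fin.
by have := sqr_ge0 (u y - v y); lra.
Qed.

Definition lipschitz_approx u := measurable_fun [set: R] u /\ forall e : R, 0 < e ->
  exists2 g, bounded_lipschitz (fun y => (g y)%:C) & (sqint (fun y => u y - g y)%R < e%:E)%E.

Lemma bounded_lipschitz_real g : bounded_lipschitz (fun y => (g y)%:C) ->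
  measurable_fun [set: R] g.
Proof.
by move=> /bounded_lipschitz_Re cg; exact: continuous_measurable_fun.
Qed.

Lemma lipschitz_approxD u v : lipschitz_approx u -> lipschitz_approx v ->
  lipschitz_approx (fun y => u y + v y).
Proof.
move=> [mu_ au] [mv av]; split; first exact: measurable_funD.
move=> e e0; have e4 : 0 < e / 4 by lra.
have [g lg ug] := au _ e4; have [h lh vh] := av _ e4.
exists (fun y => g y + h y).
  by under eq_fun do rewrite rmorphD; exact: bounded_lipschitzD.
have mg := bounded_lipschitz_real lg; have mh := bounded_lipschitz_real lh.
have -> : (fun y => u y + v y - (g y + h y)) = (fun y => (u y - g y) + (v y - h y)).
  by apply/funext => y; ring.
apply: le_lt_trans (sqintD_le _ _) _; try exact: measurable_funB.
suff -> : e%:E = (2%:E * (e / 4)%:E + 2%:E * (e / 4)%:E)%E by apply: lteD; rewrite lte_pmul2l.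
by rewrite -EFinM -EFinD; congr EFin; lra.
Qed.

Lemma lipschitz_approxZ c u : lipschitz_approx u -> lipschitz_approx (fun y => c * u y).
Proof.
move=> [mu_ au]; split; first exact: measurable_funM.
move=> e e0; have e4 : 0 < e / (c ^+ 2 + 1) by rewrite divr_gt0 // ltr_wpDl ?sqr_ge0.
have c1 : 0 < c ^+ 2 + 1 by rewrite ltr_wpDl ?sqr_ge0.
have [g lg ug] := au _ e4; exists (fun y => c * g y).
  under eq_fun do rewrite rmorphM; apply: bounded_lipschitzM => //; exact: bounded_lipschitz_cst.
have mg := bounded_lipschitz_real lg.
apply: (@le_lt_trans _ _ ((c ^+ 2 + 1)%:E * sqint (fun y => u y - g y)%R)%E); last first.
  by rewrite -[e](@divfK _ (c ^+ 2 + 1)) ?gt_eqF // mulrC EFinM lte_pmul2l // lte_fin.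
have msu : measurable_fun [set: R] (fun y => u y - g y) by exact: measurable_funB.
rewrite -ge0_integralZl //; last 3 first.
- exact: measurable_sqr.
- by move=> y _; rewrite lee_fin sqr_ge0.
- by rewrite lee_fin ltW.
apply: ge0_le_integral => //.
- by move=> y _; rewrite lee_fin sqr_ge0.
- by apply: measurable_sqr; apply: measurable_funB; exact: measurable_funM.
- by apply: measurable_funeM; exact: measurable_sqr.
move=> y _; rewrite -EFinM lee_fin -mulrBr exprMn ler_wpM2r ?sqr_ge0 //.
by rewrite lerDl.
Qed.

(** Dominated convergence for the squared differences; used for ramps, countable unions and simple
    functions. *)
Lemma lipschitz_approx_lim (u_ : nat -> R -> R) u v :
  (forall n, lipschitz_approx (u_ n)) -> measurable_fun [set: R] u ->
  (forall y, u_ ^~ y @ \oo --> u y) ->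
  (forall n y, (u y - u_ n y) ^+ 2 <= v y) -> mu.-integrable [set: R] (EFin \o v) ->
  lipschitz_approx u.
Proof.
move=> au mu_ cvu dom intv; split=> // e e0; have e4 : 0 < e / 4 by lra.
have mu_n n : measurable_fun [set: R] (u_ n) := (au n).1.
have mdiff n : measurable_fun [set: R] (fun y => u y - u_ n y) by exact: measurable_funB.
have cv0 : (sqint (fun y => u y - u_ n y)%R @[n --> \oo] --> 0)%E.
  have [|||||_ _ +] := @dominated_convergence _ _ _ mu setT measurableT
    (fun n y => ((u y - u_ n y) ^+ 2)%:E) (fun=> 0%E) (EFin \o v) => //.
  - by move=> n; exact: measurable_sqr.
  - apply: aeW => y _; apply: cvg_EFin; first exact: nearW.
    have : (u y - u_ n y) ^+ 2 @[n --> \oo] --> (u y - u y) ^+ 2.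
      by under eq_fun do rewrite expr2; rewrite expr2; apply: cvgM; apply: cvgB => //; exact: cvg_cst.
    by rewrite subrr expr0n.
  - by apply: aeW => y n _; rewrite /= lee_fin ger0_norm ?sqr_ge0 ?dom.
  by rewrite integral0.
have [n nP] : exists n, (sqint (fun y => u y - u_ n y)%R < (e / 4)%:E)%E.
  have /fine_cvgP[fin cvf] := cv0.
  have [m _ mP] := (cvgr_lt _ cvf _ e4); have [m' _ m'P] := fin.
  exists (maxn m m'); rewrite -(fineK (m'P _ (leq_maxr _ _))) lte_fin.
  exact: mP (leq_maxl _ _).
have [g lg ug] := (au n).2 _ e4; exists g => //.
have mg := bounded_lipschitz_real lg.
have -> : (fun y => u y - g y) = (fun y => (u y - u_ n y) + (u_ n y - g y)).
  by apply/funext => y; ring.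
apply: le_lt_trans (sqintD_le _ _) _; try exact: measurable_funB.
suff -> : e%:E = (2%:E * (e / 4)%:E + 2%:E * (e / 4)%:E)%E by apply: lteD; rewrite lte_pmul2l.
by rewrite -EFinM -EFinD; congr EFin; lra.
Qed.

Lemma lipschitz_approx_bounded_lipschitz g :
  bounded_lipschitz (fun y => (g y)%:C) -> lipschitz_approx g.
Proof.
move=> lg; split; first exact: bounded_lipschitz_real.
move=> e e0; exists g => //; rewrite /sqint; under eq_integral do rewrite subrr expr0n.
by rewrite integral0 lte_fin.
Qed.

Lemma lipschitz_approx_sum (I : Type) (r : seq I) (F : I -> R -> R) :
  (forall i, lipschitz_approx (F i)) -> lipschitz_approx (fun y => \sum_(i <- r) F i y).
Proof.
move=> aF; elim: r => [|i r IH].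
  under eq_fun do rewrite big_nil.
  exact/lipschitz_approx_bounded_lipschitz/bounded_lipschitz_cst.
by under eq_fun do rewrite big_cons; exact: lipschitz_approxD.
Qed.

Let int1 (c : R) : mu.-integrable [set: R] (EFin \o cst c).
Proof. exact: finite_measure_integrable_cst. Qed.

(** Limit of ramps of slope n starting at a. *)
Lemma lipschitz_approx_ray a : lipschitz_approx (\1_(`]a, +oo[) : R -> R).
Proof.
apply: (@lipschitz_approx_lim (fun n y => clamp (n%:R * (y - a))) _ (cst 1)).
- move=> n; apply: lipschitz_approx_bounded_lipschitz.
  by under eq_fun do rewrite mulrBr; exact: bounded_lipschitz_clamp.
- by apply: measurable_indic; exact: measurable_itv.
- move=> y; have [ya|ay] := leP y a.
    rewrite indicE mem_setE in_itv /= andbT ltNge ya /=.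
    rewrite (_ : (fun n => _) = fun=> 0); first exact: cvg_cst.
    apply/funext => n; rewrite /clamp max_l; first by rewrite min_r.
    by rewrite mulr_ge0_le0 // subr_le0.
  rewrite indicE mem_setE in_itv /= andbT ay /=.
  apply: cvg_near_cst; exists (Num.truncn (y - a)^-1).+1 => // n /= nk.
  rewrite /clamp min_l // le_max; apply/orP; right.
  rewrite -ler_pdivrMr ?subr_gt0 // mul1r.
  apply: (@le_trans _ _ (Num.truncn (y - a)^-1).+1%:R); first by apply: ltW; exact: truncnS_gt.
  by rewrite ler_nat.
- move=> n y /=; have /andP[c0 c1] := clamp01 (n%:R * (y - a)); rewrite indicE.
  set z := clamp _ in c0 c1 *; case: (_ \in _) => /=.
    by rewrite expr_le1 //; lra.
  by rewrite sub0r sqrrN expr_le1.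
- exact: int1.
Qed.

(** The rays form a generating class stable under intersection, so Dynkin's theorem reduces the
    claim to complements and disjoint countable unions. *)
Lemma lipschitz_approx_indic (A : set R) : measurable A -> lipschitz_approx (\1_A : R -> R).
Proof.
move=> mA; pose P (S : set (measurableTypeR R)) := lipschitz_approx (\1_S : R -> R).
have cst1 : lipschitz_approx (cst 1).
  by apply: lipschitz_approx_bounded_lipschitz; exact: (bounded_lipschitz_cst 1%:C).
apply: (@dynkin_induction _ (measurableTypeR R) (@RGenOInfty.G R) P).
- exact: RGenOInfty.measurableE.
- move=> _ _ [a ->] [c ->]; exists (Num.max a c); rewrite predeqE => y /=.
  by rewrite !in_itv /= !andbT gt_max; split=> [[-> ->]|/andP[]].
- by rewrite /P indicT.
- by move=> _ [a ->]; exact: lipschitz_approx_ray.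
- move=> S mS aS; rewrite /P.
  rewrite (_ : \1_(~` S) = (fun y => cst 1 y + (-1) * \1_S y)).
    by apply: lipschitz_approxD => //; exact: lipschitz_approxZ.
  apply/funext => y; rewrite !indicE in_setC mulN1r /=.
  by case: (y \in S); rewrite ?subr0 ?subrr.
- move=> F mF tF aF; rewrite /P.
  have FE y k n : F k y -> \sum_(i < n) (\1_(F i) y : R) = (k < n)%:R.
    move=> Fky; have F0 i : i != k -> \1_(F i) y = 0 :> R.
      move=> ik; rewrite indicE memNset // => Fiy; case/eqP: ik.
      by apply: tF => //; exists y.
    case: ltnP => [kn|nk]; last first.
      by rewrite big1 // => i _; rewrite F0 // neq_ltn (leq_trans (ltn_ord i)).
    by rewrite (bigD1 (Ordinal kn)) //= indicE mem_set // big1 ?addr0 // => i ik; rewrite F0.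
  have F0 y n : ~ (\bigcup_k F k) y -> \sum_(i < n) (\1_(F i) y : R) = 0.
    by move=> NF; rewrite big1 // => i _; rewrite indicE (_ : (y \in F i) = false) //; apply/negbTE/negP => /set_mem Fy; apply: NF; exists i.
  apply: (@lipschitz_approx_lim (fun n y => \sum_(i < n) \1_(F i) y) _ (cst 1)).
  + by move=> n; apply: lipschitz_approx_sum => i; exact: aF.
  + by apply: measurable_indic; apply: bigcup_measurable => k _; exact: mF.
  + move=> y; have [[k _ Fky]|NF] := pselect ((\bigcup_k F k) y).
      rewrite indicE mem_set; last by exists k.
      by apply: cvg_near_cst; exists k.+1 => // n /= kn; rewrite (FE _ k) ?kn.
    rewrite indicE memNset //; apply: cvg_near_cst; apply: nearW => n; exact: F0.
  + move=> n y /=; have [[k _ Fky]|NF] := pselect ((\bigcup_k F k) y).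
      rewrite indicE mem_set; last by exists k.
      by rewrite (FE _ k) //; case: (k < n)%N; rewrite ?subrr ?subr0 ?expr0n ?expr1n.
    by rewrite indicE memNset // F0 // subrr expr0n.
  + exact: int1.
- have genE : @measurable _ (measurableTypeR R) = <<s @RGenOInfty.G R >> := RGenOInfty.measurableE R.
  by rewrite -genE.
Qed.

Import HBNNSimple.

Lemma lipschitz_approx_nneg u : measurable_fun [set: R] u -> (forall y, 0 <= u y) ->
  mu.-integrable [set: R] (fun y => ((u y) ^+ 2)%:E) -> lipschitz_approx u.
Proof.
move=> mu_ u0 intu; have mE : measurable_fun [set: measurableTypeR R] (EFin \o u).
  exact/measurable_EFinP.
pose g := nnsfun_approx measurableT mE.
have u0E (y : R) : setT y -> (0 <= (EFin \o u) y)%E by rewrite /= lee_fin.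
have gcvg (y : R) : (fun n => g n y) @ \oo --> u y.
  have H := cvg_nnsfun_approx measurableT mE u0E (x := y) I.
  exact: (fine_cvg (f := EFin \o (fun n => g n y)) H).
have g_le n (y : R) : g n y <= u y.
  have nd : nondecreasing_seq (fun n => g n y).
    by move=> i j ij; have /lefP := nd_nnsfun_approx measurableT mE ij; exact.
  by have := nondecreasing_cvgn_le nd (cvgP _ (gcvg y)) n; rewrite (cvg_lim _ (gcvg y)).
apply: (@lipschitz_approx_lim (fun n => g n : R -> R) _ (fun y => u y ^+ 2)) => //.
- move=> n; rewrite (_ : (g n : R -> R) = fun y => \sum_(i < #|` fset_set (range (g n))|)
     ((fset_set (range (g n)))`_i * \1_(g n @^-1` [set (fset_set (range (g n)))`_i]) y)).
    apply: lipschitz_approx_sum => i; apply: lipschitz_approxZ.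
    by apply: lipschitz_approx_indic; rewrite -[X in measurable X]setTI; exact: (measurable_funP (g n)).
  by apply/funext => y; rewrite fimfunEord.
- move=> n y; have := g_le n y; have : 0 <= g n y by [].
  by move=> g0 gu; rewrite lerXn2r ?nnegrE ?subr_ge0 // gerBl.
Qed.

Lemma lipschitz_dense u : measurable_fun [set: R] u -> (sqint u < +oo)%E -> lipschitz_approx u.
Proof.
move=> mu_ intu.
have dom v : measurable_fun [set: R] v -> (forall y, v y ^+ 2 <= u y ^+ 2) ->
    mu.-integrable [set: R] (fun y => (v y ^+ 2)%:E).
  move=> mv vu; apply/integrableP; split; first exact: measurable_sqr.
  apply: le_lt_trans intu; apply: ge0_le_integral => //.
  - by apply: measurableT_comp => //; exact: measurable_sqr.
  - exact: measurable_sqr.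
  - by move=> y _; rewrite gee0_abs lee_fin ?sqr_ge0.
have mp : measurable_fun [set: R] (fun y => Num.max (u y) 0) by exact: measurable_maxr.
have mn : measurable_fun [set: R] (fun y => Num.max (- u y) 0).
  by apply: measurable_maxr => //; exact: measurableT_comp.
rewrite (_ : u = fun y => Num.max (u y) 0 + (-1) * Num.max (- u y) 0); last first.
  by apply/funext => y; rewrite /Num.max; do !case: ifPn; rewrite -?leNgt => *; lra.
apply: lipschitz_approxD; last apply: lipschitz_approxZ.
all: apply: lipschitz_approx_nneg => // [y|]; rewrite ?le_max ?lexx ?orbT //.
all: apply: dom => // y; rewrite /Num.max; case: ifPn; rewrite ?expr0n ?sqrrN ?sqr_ge0 //.
Qed.

End density.

(** * Coefficients of finite averages and of weak limits *)

Section finite_expansions.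
Variables (R : realType) (N : nat).
Hypothesis N_gt0 : (0 < N)%N.
Implicit Types (xs s zs ts : seq R) (f : R -> R[i]).

Definition coef xs f (l : R) : R[i] := avgs N xs (fun y => f y * cis (- (l * y))) 0.
Definition energy xs f : R := avgs N xs (fun y => nsq (f y)) 0.

Lemma nsqB (z w : R[i]) : nsq (z - w) = nsq z + nsq w - 2 * complex.Re (z * conjc w).
Proof. by case: z w => a b [c d]; rewrite /nsq; simpc => /=; ring. Qed.

Lemma coef_sub xs f g l : coef xs (fun y => f y - g y) l = coef xs f l - coef xs g l.
Proof. by rewrite /coef -avgsB; apply: eq_avgs => y; rewrite mulrBl. Qed.

Lemma coef_cis xs (c : R[i]) (m l : R) :
  coef xs (fun y => c * cis (m * y)) l = c * \prod_(x <- xs) dirichlet N ((m - l) * x).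
Proof.
rewrite /coef (@eq_avgs _ _ _ _ _ (fun y => c * cis ((m - l) * y))); last first.
  by move=> y; rewrite -mulrA -cisD; congr (_ * cis _); ring.
by rewrite avgsZ avgs_cis // mulr0 cis0 mul1r.
Qed.

Lemma energyB1 xs f c l : energy xs (fun y => f y - c * cis (l * y)) =
  energy xs f - nsq (coef xs f l) + nsq (c - coef xs f l).
Proof.
have -> : energy xs (fun y => f y - c * cis (l * y)) =
    energy xs f + nsq c - 2 * complex.Re (conjc c * coef xs f l).
  rewrite /energy /coef -avgsZ avgs_Re -avgsZ -[nsq c](avgs_const N_gt0 _ xs 0) -avgsD -avgsB.
  apply: eq_avgs => y; rewrite nsqB nsqM nsq_cis mulr1 conjcM conjc_cis; congr (_ - 2 * complex.Re _).
  by rewrite mulrCA.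
rewrite nsqB; have -> : complex.Re (c * conjc (coef xs f l)) = complex.Re (conjc c * coef xs f l).
  by case: c (coef xs f l) => a b [u v]; simpc => /=; ring.
by ring.
Qed.

(** Pythagoras by completing the square one frequency at a time: subtracting a multiple of one
    exponential leaves the other coefficients unchanged. *)
Lemma energy_expansion xs s f (c : R -> R[i]) : uniq s ->
  {in s &, forall l m, l != m -> \prod_(x <- xs) dirichlet N ((l - m) * x) = 0} ->
  energy xs (fun y => f y - \sum_(l <- s) c l * cis (l * y)) =
  energy xs f - \sum_(l <- s) nsq (coef xs f l) + \sum_(l <- s) nsq (c l - coef xs f l).
Proof.
elim: s f => [|l s IH] f /=.
  by rewrite !big_nil subr0 addr0 => _ _; apply: eq_avgs => y; rewrite big_nil subr0.
case/andP=> ls us orth.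
have orth_s : {in s &, forall l m, l != m -> \prod_(x <- xs) dirichlet N ((l - m) * x) = 0}.
  by move=> l1 l2 l1s l2s; apply: orth; rewrite inE ?l1s ?l2s orbT.
have coefE m : m \in s -> coef xs (fun y => f y - c l * cis (l * y)) m = coef xs f m.
  move=> ms; rewrite coef_sub coef_cis orth ?mulr0 ?subr0 ?mem_head ?inE ?ms ?orbT //.
  by apply: contraNneq ls => ->.
have -> : (fun y => f y - \sum_(m <- l :: s) c m * cis (m * y)) =
          (fun y => (f y - c l * cis (l * y)) - \sum_(m <- s) c m * cis (m * y)).
  by apply/boolp.funext => y; rewrite big_cons opprD addrA.
rewrite IH // energyB1 !big_cons.
rewrite (@eq_big_seq _ _ _ _ s (fun m => nsq (coef xs _ m)) (fun m => nsq (coef xs f m))); last first.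
  by move=> m ms; rewrite coefE.
rewrite (@eq_big_seq _ _ _ _ s (fun m => nsq (c m - coef xs _ m)) (fun m => nsq (c m - coef xs f m))); last first.
  by move=> m ms; rewrite coefE.
by ring.
Qed.

Lemma energy_ge0 xs f : 0 <= energy xs f.
Proof. by apply: avgs_ge0 => // y; exact: nsq_ge0. Qed.

Lemma bessel xs s f : uniq s ->
  {in s &, forall l m, l != m -> \prod_(x <- xs) dirichlet N ((l - m) * x) = 0} ->
  \sum_(l <- s) nsq (coef xs f l) <= energy xs f.
Proof.
move=> us orth; have := energy_expansion f (coef xs f) us orth.
rewrite [X in _ + X]big1 => [|l _]; last by rewrite subrr nsq0.
by rewrite addr0 -subr_ge0 => <-; exact: energy_ge0.
Qed.

Lemma energy_residual_ge xs s f c : uniq s ->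
  {in s &, forall l m, l != m -> \prod_(x <- xs) dirichlet N ((l - m) * x) = 0} ->
  energy xs f - \sum_(l <- s) nsq (coef xs f l) <=
  energy xs (fun y => f y - \sum_(l <- s) c l * cis (l * y)).
Proof.
move=> us orth; rewrite energy_expansion // lerDl.
by apply: sumr_ge0 => l _; exact: nsq_ge0.
Qed.

(* corner zs is the smallest sum of multiples j z, j < N, one for each z in zs. *)
Definition lower (z : R) : R := Num.min 0 (N.-1%:R * z).
Definition corner zs : R := \sum_(z <- zs) lower z.

Lemma corner_cat zs ts : corner (zs ++ ts) = corner zs + corner ts.
Proof. by rewrite /corner big_cat. Qed.

Lemma corner_width zs : `|corner zs| <= width N zs.
Proof.
apply: le_trans (ler_norm_sum _ _ _) _; apply: ler_sum => z _.
apply: (@le_trans _ _ `|N.-1%:R * z|).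
  by rewrite /lower /Num.min; case: ifP => _; rewrite ?normr0.
by rewrite normrM normr_nat ler_wpM2r // ler_nat leq_pred.
Qed.

Lemma lower_le (z : R) (j : nat) : (j < N)%N -> lower z <= j%:R * z.
Proof.
move=> jN; rewrite /lower ge_min; have [z0|z0] := leP 0 z; first by rewrite mulr_ge0.
apply/orP; right; apply: ler_wnM2r; [exact: ltW | by rewrite ler_nat; lia].
Qed.

Lemma lower_gap (z : R) : exists2 j0, (j0 < N)%N & j0%:R * z = lower z /\
  forall j, (j < N)%N -> j != j0 -> lower z + `|z| <= j%:R * z.
Proof.
have [z0|z0] := leP 0 z.
  have lz : lower z = 0 by rewrite /lower min_l // mulr_ge0.
  exists 0%N => //; rewrite mul0r lz; split=> // j jN j0; rewrite add0r ger0_norm //.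
  by rewrite ler_peMl // ler1n lt0n.
have lz : lower z = N.-1%:R * z by rewrite /lower min_r // mulr_ge0_le0 // ltW.
exists N.-1; rewrite ?lz; [by lia|split=> // j jN jN1].
rewrite ltr0_norm // -subr_ge0.
rewrite (_ : _ - _ = (N.-1%:R - j.+1%:R) * - z); last by rewrite -(natr1 j); ring.
by apply: mulr_ge0; [rewrite subr_ge0 ler_nat; lia | rewrite oppr_ge0; exact: ltW].
Qed.

Section field.
Variable F : numFieldType.
Implicit Types g : R -> F.

Lemma avgs_vanish zs g y : (forall u, y + corner zs <= u -> g u = 0) -> avgs N zs g y = 0.
Proof.
elim: zs y => [|z zs IH] y g0 /=; first by apply: g0; rewrite /corner big_nil addr0.
rewrite /avg big1 ?mulr0 // => j _; apply: IH => u uy; apply: g0; apply: le_trans uy.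
by rewrite /corner big_cons -/(corner zs) addrA lerD2r lerD2l lower_le.
Qed.

(** Changing any digit of the extreme sum raises it by at least eta, beyond the support of g; the
    extreme choice has weight N^-(size zs). *)
Lemma avgs_corner zs (eta : R) g y :
  {in zs, forall z : R, eta <= `|z|} -> (forall u, y + corner zs + eta <= u -> g u = 0) ->
  avgs N zs g y = N%:R ^- size zs * g (y + corner zs).
Proof.
elim: zs y => [|z zs IH] y eta_z g0 /=.
  by rewrite /corner big_nil addr0 expr0 invr1 mul1r.
have [j0 j0N [j0z gap]] := lower_gap z.
have cE : corner (z :: zs) = lower z + corner zs by rewrite /corner big_cons.
rewrite /avg (bigD1 (Ordinal j0N)) //= big1 ?addr0 => [|j jj0]; last first.
  apply: avgs_vanish => u uy; apply: g0; apply: le_trans uy; rewrite cE.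
  have := gap j (ltn_ord j) jj0; have := eta_z z (mem_head _ _); lra.
rewrite j0z IH; last 2 first.
- by move=> w wzs; apply: eta_z; rewrite inE wzs orbT.
- by move=> u uy; apply: g0; apply: le_trans uy; rewrite cE; lra.
by rewrite cE addrA exprS invfM mulrA.
Qed.

End field.

Lemma avgs_ge_corner zs (g : R -> R) y : (forall u, 0 <= g u) ->
  N%:R ^- size zs * g (y + corner zs) <= avgs N zs g y.
Proof.
move=> g0; elim: zs y => [|z zs IH] y /=.
  by rewrite /corner big_nil addr0 expr0 invr1 mul1r.
have [j0 j0N [j0z _]] := lower_gap z.
rewrite /avg exprS invfM -mulrA ler_wpM2l ?invr_ge0 // (bigD1 (Ordinal j0N)) //= j0z.
apply: (@le_trans _ _ (avgs N zs g (y + lower z))).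
  by apply: le_trans (IH _); rewrite /corner big_cons addrA.
by rewrite lerDl; apply: sumr_ge0 => j _; exact: avgs_ge0.
Qed.

Lemma steps_lower_bound zs : {in zs, forall z : R, z != 0} ->
  exists2 eta : R, 0 < eta & {in zs, forall z : R, eta <= `|z|}.
Proof.
elim: zs => [|z zs IH] z0; first by exists 1.
have [|eta eta0 etaP] := IH; first by move=> w wzs; apply: z0; rewrite inE wzs orbT.
exists (Num.min `|z| eta); first by rewrite lt_min eta0 normr_gt0 z0 ?mem_head.
move=> w; rewrite inE => /orP[/eqP->|wzs]; first by rewrite ge_min lexx.
by rewrite ge_min etaP ?orbT.
Qed.

(* A Lipschitz cut-off at level a: 1 far to the left of a, 0 to the right of a. *)
Definition cutoff (a eta y : R) : R := clamp ((a - y) / eta).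

Lemma cutoff_right a eta y : 0 < eta -> a <= y -> cutoff a eta y = 0.
Proof.
move=> eta0 ay; rewrite /cutoff /clamp max_l ?min_r //.
by rewrite ler_pdivrMr // mul0r subr_le0.
Qed.

Lemma cutoff_half a eta y : 0 < eta -> y <= a - eta / 2 -> 2^-1 <= cutoff a eta y.
Proof.
move=> eta0 ya; rewrite /cutoff /clamp le_min le_max ler_pdivlMr //; apply/andP; split; first by lra.
by apply/orP; right; lra.
Qed.

Lemma cutoff_shift a eta y c : cutoff (a + c) eta (y + c) = cutoff a eta y.
Proof. by rewrite /cutoff (_ : a + c - (y + c) = a - y) //; ring. Qed.

Lemma bounded_lipschitz_cutoff a eta : 
  bounded_lipschitz (fun y => (cutoff a eta y)%:C).
Proof.
have -> : (fun y => (cutoff a eta y)%:C) = fun y => (clamp (- eta^-1 * y + a / eta))%:C.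
  by apply/boolp.funext => y; rewrite /cutoff; congr (clamp _)%:C; ring.
exact: bounded_lipschitz_clamp.
Qed.

End finite_expansions.

(** * Approximation in the square norm of mu *)

Section L2.
Variables (R : realType) (mu : probability (measurableTypeR R) R).

Lemma bounded_lipschitz_measurable (f : R -> R[i]) : bounded_lipschitz f ->
  measurable_fun [set: R] (fun y => complex.Re (f y)) /\
  measurable_fun [set: R] (fun y => complex.Im (f y)).
Proof.
by move=> bl; split; apply: continuous_measurable_fun;
  [exact: bounded_lipschitz_Re|exact: bounded_lipschitz_Im].
Qed.

Lemma L2sqnorm_sqint (f : R -> R[i]) :
  measurable_fun [set: R] (fun y => complex.Re (f y)) ->
  measurable_fun [set: R] (fun y => complex.Im (f y)) ->
  L2sqnorm mu f = (sqint mu (fun y => complex.Re (f y)) + sqint mu (fun y => complex.Im (f y)))%E.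
Proof.
move=> mRe mIm; rewrite /L2sqnorm; under eq_integral do rewrite EFinD.
rewrite ge0_integralD //; try (by move=> y _; rewrite lee_fin sqr_ge0); exact: measurable_sqr.
Qed.

Lemma L2sqnorm_bounded_lipschitz (f : R -> R[i]) : bounded_lipschitz f ->
  L2sqnorm mu f = (\int[mu]_y nsq (f y))%:E.
Proof.
move=> [B B0 [fB fL]]; have bl : bounded_lipschitz f by exists B.
rewrite /L2sqnorm /Rintegral fineK //; apply: integrable_fin_num => //.
apply: (@bounded_integrable _ _ _ B).
  apply: continuous_measurable_fun.
  exact: bounded_lipschitz_Re (bounded_lipschitz_nsq bl).
by move=> y; rewrite ger0_norm ?nsq_ge0.
Qed.

(** Here e bounds squared norms: with g within e of f, the inequality |f - p|^2 <= 2 |f - g|^2 + 2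
    |g - p|^2 gives 4 e. *)
Lemma bounded_lipschitz_dense (f : R -> R[i]) (e : R) : cL2 mu f -> 0 < e ->
  exists2 g, bounded_lipschitz g & forall p, bounded_lipschitz p ->
    (L2sqnorm mu (fun y => g y - p y)%R < e%:E)%E ->
    (L2sqnorm mu (fun y => f y - p y)%R < (4 * e)%:E)%E.
Proof.
move=> [mRe mIm fin] e0; rewrite L2sqnorm_sqint // in fin.
have sq0 u : (0 <= sqint mu u)%E by apply: integral_ge0 => y _; rewrite lee_fin sqr_ge0.
have finRe : (sqint mu (fun y => complex.Re (f y)) < +oo)%E.
  by apply: le_lt_trans fin; rewrite leeDl.
have finIm : (sqint mu (fun y => complex.Im (f y)) < +oo)%E.
  by apply: le_lt_trans fin; rewrite leeDr.
have e2 : 0 < e / 2 by rewrite divr_gt0.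
have [g1 l1 a1] := (lipschitz_dense mRe finRe).2 _ e2.
have [g2 l2 a2] := (lipschitz_dense mIm finIm).2 _ e2.
pose g y := (g1 y)%:C + 'i%C * (g2 y)%:C.
have gE y : g y = g1 y +i* g2 y by rewrite /g; simpc.
have lg : bounded_lipschitz g.
  apply: bounded_lipschitzD => //; apply: bounded_lipschitzM => //; exact: bounded_lipschitz_cst.
exists g => // p lp gp.
have [mp1 mp2] := bounded_lipschitz_measurable lp.
have m1 := bounded_lipschitz_real l1; have m2 := bounded_lipschitz_real l2.
have ReB (u v : R -> R[i]) y : complex.Re (u y - v y) = complex.Re (u y) - complex.Re (v y).
  exact: raddfB.
have ImB (u v : R -> R[i]) y : complex.Im (u y - v y) = complex.Im (u y) - complex.Im (v y).
  exact: raddfB.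
rewrite L2sqnorm_sqint; last 2 first.
- by under eq_fun do rewrite ReB; exact: measurable_funB.
- by under eq_fun do rewrite ImB; exact: measurable_funB.
move: gp; rewrite L2sqnorm_sqint; last 2 first.
- by under eq_fun do rewrite ReB gE; exact: measurable_funB.
- by under eq_fun do rewrite ImB gE; exact: measurable_funB.
set G1 := sqint _ _; set G2 := sqint _ _ => gp.
have s1 : (sqint mu (fun y => complex.Re (f y - p y)%R) <=
           2%:E * sqint mu (fun y => complex.Re (f y) - g1 y)%R + 2%:E * G1)%E.
  rewrite (_ : (fun y => complex.Re (f y - p y)) =
     (fun y => (complex.Re (f y) - g1 y) + complex.Re (g y - p y))); last first.
    by apply/funext => y; rewrite !ReB gE /=; ring.
  by apply: sqintD_le; [exact: measurable_funB | under eq_fun do rewrite ReB gE; exact: measurable_funB].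
have s2 : (sqint mu (fun y => complex.Im (f y - p y)%R) <=
           2%:E * sqint mu (fun y => complex.Im (f y) - g2 y)%R + 2%:E * G2)%E.
  rewrite (_ : (fun y => complex.Im (f y - p y)) =
     (fun y => (complex.Im (f y) - g2 y) + complex.Im (g y - p y))); last first.
    by apply/funext => y; rewrite !ImB gE /=; ring.
  by apply: sqintD_le; [exact: measurable_funB | under eq_fun do rewrite ImB gE; exact: measurable_funB].
apply: le_lt_trans (leeD s1 s2) _.
have gp_oo := lt_trans gp (ltry _).
have fin1 : G1 \is a fin_num.
  by rewrite ge0_fin_numE ?sq0 //; apply: (le_lt_trans _ gp_oo); rewrite leeDl ?sq0.
have fin2 : G2 \is a fin_num.
  by rewrite ge0_fin_numE ?sq0 //; apply: (le_lt_trans _ gp_oo); rewrite leeDr ?sq0.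
have fa1 := ge0_fin_numE (sq0 (fun y => complex.Re (f y) - g1 y)).
have fa2 := ge0_fin_numE (sq0 (fun y => complex.Im (f y) - g2 y)).
rewrite (lt_trans a1 (ltry _)) in fa1; rewrite (lt_trans a2 (ltry _)) in fa2.
move: a1 a2 gp; rewrite -(fineK fin1) -(fineK fin2) -(fineK fa1) -(fineK fa2).
by rewrite -!EFinM -!EFinD !lte_fin => *; lra.
Qed.

End L2.

(** * From finite averages to the limit measure *)

Section weak_limit.
Variables (R : realType) (N : nat) (x : nat -> R) (M : R) (mu : probability (measurableTypeR R) R).
Hypothesis N_prime : prime N.
Let N_gt0 : (0 < N)%N := prime_gt0 N_prime.
Hypothesis x_le : forall k, (1 <= k)%N -> `|x k| <= M / 2 ^+ k.
Local Notation X n := [seq x k | k <- iota 1 n].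
Hypothesis mu_limit : forall f : R -> R, continuous f -> (exists B : R, forall y, `|f y| <= B) ->
  avgs N (X n) f 0 @[n --> \oo] --> \int[mu]_y f y.
Implicit Types (f g : R -> R[i]).

Lemma bounded_of_sqr (u : R -> R) (B : R) : (forall y, u y ^+ 2 <= B) ->
  exists B' : R, forall y, `|u y| <= B'.
Proof.
move=> uB; exists (1 + B) => y; have := uB y; rewrite -[u y ^+ 2]real_normK ?num_real // => uy.
by have := sqr_ge0 (`|u y| - 1); have := normr_ge0 (u y); rewrite sqrrB1 -mulr_natr; nra.
Qed.

Lemma avgs_cvg f : bounded_lipschitz f ->
  complex.Re (avgs N (X n) f 0) @[n --> \oo] --> complex.Re (cRintegral mu f) /\
  complex.Im (avgs N (X n) f 0) @[n --> \oo] --> complex.Im (cRintegral mu f).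
Proof.
move=> bl; have [B B0 [fB _]] := bl; split.
  under eq_fun do rewrite avgs_Re; apply: mu_limit; first exact: bounded_lipschitz_Re.
  by apply: (@bounded_of_sqr _ B) => y; apply: le_trans (fB y); exact: nsq_Re.
under eq_fun do rewrite avgs_Im; apply: mu_limit; first exact: bounded_lipschitz_Im.
by apply: (@bounded_of_sqr _ B) => y; apply: le_trans (fB y); exact: nsq_Im.
Qed.

Lemma nsq_cvg (u : nat -> R[i]) (z : R[i]) :
  complex.Re (u n) @[n --> \oo] --> complex.Re z ->
  complex.Im (u n) @[n --> \oo] --> complex.Im z ->
  nsq (u n) @[n --> \oo] --> nsq z.
Proof. by move=> uRe uIm; rewrite /nsq; under eq_fun do rewrite !expr2; rewrite !expr2; apply: cvgD; apply: cvgM. Qed.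

Lemma energy_cvg f : bounded_lipschitz f ->
  energy N (X n) f @[n --> \oo] --> \int[mu]_y nsq (f y).
Proof.
move=> bl; have [B B0 [fB _]] := bl; apply: mu_limit.
  exact: bounded_lipschitz_Re (bounded_lipschitz_nsq bl).
by exists B => y; rewrite ger0_norm ?nsq_ge0.
Qed.

Definition fcoef f (l : R) : R[i] := cRintegral mu (fun y => f y * cis (- (l * y))).

Lemma bounded_lipschitz_mulcis f l : bounded_lipschitz f ->
  bounded_lipschitz (fun y => f y * cis (- (l * y))).
Proof.
move=> bl; apply: bounded_lipschitzM => //.
by under eq_fun do rewrite -mulNr; exact: bounded_lipschitz_cis.
Qed.

Lemma coef_cvg f (a : R[i]) l : bounded_lipschitz f ->
  nsq (coef N (X n) f l - a) @[n --> \oo] --> nsq (fcoef f l - a).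
Proof.
move=> bl; have [cRe cIm] := avgs_cvg (bounded_lipschitz_mulcis l bl).
apply: nsq_cvg; rewrite raddfB; under eq_fun do rewrite raddfB; (apply: cvgB; last exact: cvg_cst).
  exact: cRe.
exact: cIm.
Qed.

Lemma sum_coef_cvg f (a : R -> R[i]) (s : seq R) : bounded_lipschitz f ->
  \sum_(l <- s) nsq (coef N (X n) f l - a l) @[n --> \oo] --> \sum_(l <- s) nsq (fcoef f l - a l).
Proof.
move=> bl; elim: s => [|l s IH].
  by under eq_fun do rewrite big_nil; rewrite big_nil; exact: cvg_cst.
under eq_fun do rewrite big_cons; rewrite big_cons; apply: cvgD => //; exact: coef_cvg.
Qed.

(** All finite digit sums lie in [-N M, N M]. A non-negative continuous test function vanishing
    exactly there has limit integral 0, so it vanishes almost everywhere. *)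
Lemma weak_limit_compactly_supported : compactly_supported mu.
Proof.
pose B := N%:R * M; exists (`[- B, B]%classic : set R); first exact: segment_compact.
pose f (y : R) : R := clamp (1 * y + - B) + clamp (- 1 * y + - B).
have clamp0 (z : R) : z <= 0 -> clamp z = 0 by move=> z0; rewrite /clamp max_l ?min_r.
have clamp_ge0 (z : R) : 0 <= clamp z by case/andP: (clamp01 z).
have blf : bounded_lipschitz (fun y => (f y)%:C).
  by under eq_fun do rewrite rmorphD; apply: bounded_lipschitzD; exact: bounded_lipschitz_clamp.
have cf : continuous f := bounded_lipschitz_Re blf.
have f_ge0 y : 0 <= f y by rewrite addr_ge0.
have f2 y : `|f y| <= 2.
  rewrite ger0_norm // /f; have /andP[_ ?] := clamp01 (1 * y + - B).
  by have /andP[_ ?] := clamp01 (- 1 * y + - B); lra.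
have int0 : \int[mu]_y f y = 0.
  apply: (cvg_unique _ (mu_limit cf (ex_intro _ 2 f2))) => //.
  rewrite (_ : (fun n => _) = fun=> 0); first exact: cvg_cst.
  apply/funext => n; rewrite -[RHS](avgs_const N_gt0 0 (X n) 0).
  have small z : `|z - 0| <= width N (X n) -> f z = 0.
    rewrite subr0 => zw; have : `|z| <= B.
      by apply: le_trans zw _; have := width_steps N x_le 0 n; rewrite expr0 divr1.
    by rewrite ler_norml => /andP[? ?]; rewrite /f !clamp0 ?addr0 //; lra.
  by apply/eqP; rewrite eq_le; apply/andP; split; apply: avgs_le => // z /small ->.
have mf : measurable_fun [set: R] f by exact: continuous_measurable_fun.
have intf : mu.-integrable [set: R] (EFin \o f) by exact: (@bounded_integrable _ _ _ 2).
have [S [mS muS subS]] : ae_eq mu setT (EFin \o f) (cst 0%E).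
  apply/ae_eq_integral_abs => //; first exact/measurable_EFinP.
  have -> : (\int[mu]_y `|(EFin \o f) y| = \int[mu]_y (f y)%:E)%E.
    by apply: eq_integral => y _; rewrite /= ger0_norm.
  rewrite -(fineK (integrable_fin_num measurableT intf)).
  by move: int0; rewrite /Rintegral => ->.
apply: (subset_measure0 _ _ _ muS) => //; first by apply: measurableC; exact: measurable_itv.
move=> y /= yB; apply: subS => /= f0E; apply: yB; have f0 := EFin_inj (f0E I); rewrite in_itv /=.
have := clamp_ge0 (1 * y + - B); have := clamp_ge0 (- 1 * y + - B); rewrite /f in f0 => c1 c2.
have {}c1 : clamp (- 1 * y + - B) = 0 by lra.
have {}c2 : clamp (1 * y + - B) = 0 by lra.
have cl (z : R) : clamp z = 0 -> z <= 0.
  by rewrite /clamp /Num.min /Num.max; do !case: ifPn => //; rewrite -?leNgt => *; lra.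
by have := cl _ c1; have := cl _ c2; move=> *; apply/andP; split; lra.
Qed.

End weak_limit.

(** * Distinct valuations give a spectrum *)

Lemma prod_seq_eq0_sub (F : idomainType) (T : eqType) (r r' : seq T) (f : T -> F) :
  {subset r <= r'} -> \prod_(i <- r) f i = 0 -> \prod_(i <- r') f i = 0.
Proof.
move=> rr' /eqP; rewrite prodf_seq_eq0 => /hasP[i ir /= fi0].
by apply/eqP; rewrite prodf_seq_eq0; apply/hasP; exists i => //; exact: rr'.
Qed.

Section sufficiency.
Variables (R : realType) (N : nat) (b t : nat -> int) (C M : nat).
Variable mu : probability (measurableTypeR R) R.
Hypothesis N_prime : prime N.
Let N_gt0 : (0 < N)%N := prime_gt0 N_prime.
Hypothesis b_neq0 : forall k, (1 <= k)%N -> b k != 0.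
Hypothesis t_neq0 : forall k, (1 <= k)%N -> t k != 0.
Hypothesis tau_t : forall k, (1 <= k)%N -> (tau N (t k) <= C)%N.
Hypothesis inj_s : injective_s N b t.
Hypothesis b_ge2 : forall k, (1 <= k)%N -> 2 <= `|b k|.
Hypothesis t_le : forall k, (1 <= k)%N -> `|t k| <= M%:Z.
Local Notation x := (@digit_step R b t).
Local Notation X n := [seq x k | k <- iota 1 n].
Hypothesis mu_limit : forall f : R -> R, continuous f -> (exists B : R, forall y, `|f y| <= B) ->
  avgs N (X n) f 0 @[n --> \oo] --> \int[mu]_y f y.
Local Notation low := (low_indices N b t C).
Local Notation lev := (level N b t C).

Variables (c : R) (q0 : nat) (L : nat -> seq R).
Hypothesis c01 : 0 < c <= 1.
Hypothesis L_parseval : forall q, parseval N (low_steps R N b t C (q0 + q)) (L q).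
Hypothesis L_sub : forall q, {subset L q <= L q.+1}.
Hypothesis L_tail : forall q l, l \in L q -> tail_ge N b t C c (q0 + q) l.

Let L_mono q q' : (q <= q')%N -> {subset L q <= L q'}.
Proof.
move=> /subnKC <-; elim: (q' - q)%N => [|n IH] l lL; first by rewrite addn0.
by rewrite addnS; apply: L_sub; exact: IH.
Qed.

Let L_uniq q : uniq (L q) := parseval_uniq N_prime (L_parseval q).

(** The first K digits include all those of level below q0 + q, and one of these has a vanishing
    mask. *)
Let L_orth q K l m : (q0 + q + C <= K)%N -> l \in L q -> m \in L q -> l != m ->
  \prod_(y <- X K) dirichlet N ((l - m) * y) = 0.
Proof.
move=> qK lL mL lm; apply: prod_seq_eq0_sub (parseval_orth N_prime (L_parseval q) lL mL lm).
move=> _ /mapP[k kq ->]; apply/mapP; exists k => //.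
move: kq; rewrite mem_low_indices // mem_iota => /andP[k1 kq]; rewrite k1 /=.
have := level_index_bound N_prime b_neq0 t_neq0 tau_t inj_s k1 kq; lia.
Qed.

Section residual.
Variable g : R -> R[i].
Hypothesis g_lip : bounded_lipschitz g.
Let A l := fcoef mu g l.
Let S q := \sum_(l <- L q) nsq (A l).
Let r q y := g y - \sum_(l <- L q) A l * cis (l * y).

Let r_lip q : bounded_lipschitz (r q).
Proof.
apply: bounded_lipschitzD => //; apply: bounded_lipschitzN; apply: bounded_lipschitz_sum => l.
by apply: bounded_lipschitzM; [exact: bounded_lipschitz_cst|exact: bounded_lipschitz_cis].
Qed.

(** The coefficients already removed in [r q]. They are limit coefficients, so at finite K those of
    [r q] on L q are only close to 0. *)
Let a q l := if l \in L q then A l else 0.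

Let coef_r q q' K l : (q <= q')%N -> (q0 + q' + C <= K)%N -> l \in L q' ->
  coef N (X K) (r q) l = coef N (X K) g l - a q l.
Proof.
move=> qq' qK lL; rewrite coef_sub; congr (_ - _).
have -> : coef N (X K) (fun y => \sum_(m <- L q) A m * cis (m * y)) l =
          \sum_(m <- L q) A m * \prod_(y <- X K) dirichlet N ((m - l) * y).
  under eq_bigr do rewrite -coef_cis //.
  rewrite /coef -avgs_sum; apply: eq_avgs => y.
  by rewrite mulr_suml.
rewrite /a; case: ifPn => lLq.
  rewrite (bigD1_seq l) //= [Z in _ + Z]big1_seq ?addr0 => [|m /andP[ml mLq]]; last first.
    by rewrite (L_orth qK) ?mulr0 // (L_mono qq').
  by rewrite big1 ?mulr1 // => y _; rewrite subrr mul0r dirichlet0.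
rewrite big1_seq // => m /= mLq; rewrite (L_orth qK) ?mulr0 // ?(L_mono qq') //.
by apply: contraNneq lLq => <-.
Qed.

Let S_diff q q' : (q <= q')%N -> \sum_(l <- L q') nsq (A l - a q l) = S q' - S q.
Proof.
move=> qq'; have -> : S q' = \sum_(l <- L q') nsq (A l - a q l) + \sum_(l <- L q' | l \in L q) nsq (A l).
  rewrite /S [Z in _ = _ + Z]big_mkcond -big_split /=; apply: eq_bigr => l _.
  by rewrite /a; case: ifP; rewrite ?subrr ?nsq0 ?add0r ?subr0 ?addr0.
suff -> : \sum_(l <- L q' | l \in L q) nsq (A l) = S q by rewrite addrK.
rewrite -big_filter; apply: perm_big; apply: uniq_perm; rewrite ?filter_uniq // => l; rewrite mem_filter.
by case: (boolP (l \in L q)) => // /(L_mono qq').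
Qed.

Let S_le q : S q <= \int[mu]_y nsq (g y).
Proof.
have cS := sum_coef_cvg mu_limit g_lip (a := fun=> 0) (s := L q).
have := ler_cvg_to cS (energy_cvg mu_limit g_lip).
rewrite /S; under eq_bigr do rewrite subr0; apply.
exists (q0 + q + C)%N => // K /= qK.
under eq_bigr do rewrite subr0.
by apply: bessel => // l m lL mL lm; exact: (L_orth qK).
Qed.

(** The residual of stage q is tested on the larger spectrum of stage q'. In the limit only the new
    frequencies contribute, and their sum is S q' - S q. *)
Let residual_le q q' (B d : R) : (q <= q')%N -> 0 <= B -> 0 <= d ->
  (forall y z, nsq (r q y - r q z) <= B * (y - z) ^+ 2) ->
  (forall K, width N [seq x k | k <- [seq k <- iota 1 K | (q0 + q' <= lev k)%N]] <= d) ->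
  c / 4 * \int[mu]_y nsq (r q y) <= S q' - S q + 2 * (B * d ^+ 2).
Proof.
move=> qq' B0 d0 rB wd; have /andP[c0 c1] := c01.
rewrite -S_diff // -lerBlDr.
have cS := sum_coef_cvg mu_limit g_lip (a := a q) (s := L q').
have cE : c / 4 * energy N (X n) (r q) - 2 * (B * d ^+ 2) @[n --> \oo] -->
    c / 4 * \int[mu]_y nsq (r q y) - 2 * (B * d ^+ 2).
  by apply: cvgB; last exact: cvg_cst; apply: cvgM; [exact: cvg_cst|exact: energy_cvg].
apply: (ler_cvg_to cE cS); exists (q0 + q' + C)%N => // K /= qK.
have perm := perm_map x (low_indices_split N_prime b_neq0 t_neq0 tau_t inj_s qK).
rewrite map_cat in perm; have {}perm := perm_trans perm (permEl (perm_catC _ _)).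
have tail l : l \in L q' ->
    c <= \prod_(y <- [seq x k | k <- [seq k <- iota 1 K | (q0 + q' <= lev k)%N]]) nsq (dirichlet N (l * y)).
  by move=> lL; rewrite big_map; exact: L_tail.
have := frame_lower N_prime B0 (ltW c0) c1 (L_parseval q') tail rB.
rewrite -!(avgs_perm N _ perm) -/(energy N (X K) (r q)).
rewrite (@eq_big_seq _ _ _ _ (L q') _ (fun l => nsq (coef N (X K) g l - a q l))); last first.
  by move=> l lL /=; rewrite -(avgs_perm N _ perm) -(coef_r qq' qK lL).
apply: le_trans; rewrite lerD2l lerN2 ler_wpM2l // ler_wpM2l // lerXn2r ?nnegrE //.
exact: width_ge0.
Qed.

Lemma residual_small e : 0 < e -> exists q, \int[mu]_y nsq (r q y) < e.
Proof.
move=> e0; have /andP[c0 c1] := c01.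
have S_nd : nondecreasing_seq S.
  move=> q q' qq'; rewrite -subr_ge0 -S_diff //; apply: sumr_ge0 => l _; exact: nsq_ge0.
have S_cv : cvg (S @ \oo).
  by apply: nondecreasing_is_cvgn => //; exists (\int[mu]_y nsq (g y)) => _ [q _ <-].
(* The gain of Bessel's sum and the Lipschitz error will each cost at most eps, and 2 eps < (c / 4)
   e. *)
pose eps := c * e / 16; have eps0 : 0 < eps by rewrite divr_gt0 ?mulr_gt0.
have below : limn S - eps < limn S by rewrite gtrBl.
have [q _ qP] := cvgr_gt _ S_cv _ below.
exists q; have Sq : limn S - eps < S q by apply: qP; exact: leqnn.
(* The Lipschitz constant of the residual depends on q, so q is fixed before d and q' are chosen. *)
have [B B0 [_ rB]] := r_lip q.
pose d := Num.min 1 (eps / (2 * B + 1)).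
have B1 : 0 < 2 * B + 1 by lra.
have d0 : 0 < d by rewrite lt_min ltr01 divr_gt0.
have [q1 q1P] := width_high C N_prime b_neq0 b_ge2 t_le d0.
pose q' := maxn q q1.
have := residual_le (leq_maxl q q1) B0 (ltW d0) rB
  (fun K => q1P (q0 + q')%N K (leq_trans (leq_maxr q q1) (leq_addl _ _))).
have Sq' : S q' <= limn S by exact: nondecreasing_cvgn_le.
have Bd : 2 * (B * d ^+ 2) <= eps.
  apply: (@le_trans _ _ ((2 * B + 1) * d)); last first.
    by rewrite mulrC -ler_pdivlMr // ge_min lexx orbT.
  have d1 : d <= 1 by rewrite ge_min lexx.
  have dd : d ^+ 2 <= d by rewrite expr2 ler_piMl // ltW.
  have : B * d ^+ 2 <= B * d by rewrite ler_wpM2l.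
  by have := ltW d0; nra.
rewrite -/q' => H; have {}H : c / 4 * \int[mu]_y nsq (r q y) < 2 * eps by lra.
have : c / 4 * \int[mu]_y nsq (r q y) < c / 4 * e.
  by apply: lt_le_trans H _; rewrite /eps; have := mulr_gt0 c0 e0; lra.
by rewrite ltr_pM2l // divr_gt0.
Qed.

End residual.

Lemma spectral_of_sequence : spectral_measure mu.
Proof.
have x_le := @digit_step_le R b t b_neq0 M b_ge2 t_le.
split; first exact: (weak_limit_compactly_supported N_prime x_le mu_limit).
exists [set l | exists q, l \in L q]; split.
  move=> l m [q lL] [q' mL] lm; set Q := maxn q q'.
  have lQ : l \in L Q by apply: (L_mono _ lL); exact: leq_maxl.
  have mQ : m \in L Q by apply: (L_mono _ mL); exact: leq_maxr.
  have -> : (fun y => expi l y * conjc (expi m y)) = (fun y => cis ((l - m) * y)).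
    by apply/funext => y; rewrite !expiE conjc_cis -cisD; congr cis; ring.
  apply: nsq_eq0; apply: (cvg_unique _ (nsq_cvg (avgs_cvg mu_limit (bounded_lipschitz_cis (l - m))).1
     (avgs_cvg mu_limit (bounded_lipschitz_cis (l - m))).2)) => //.
  apply: cvg_near_cst; exists (q0 + Q + C)%N => // K /= qK.
  by rewrite avgs_cis // (L_orth qK lQ mQ) ?mulr0 ?nsq0 //; exact/eqP.
move=> f fL2 e e0; have e4 : 0 < e ^+ 2 / 4 by rewrite divr_gt0 ?exprn_gt0.
have [g g_lip gP] := bounded_lipschitz_dense fL2 e4.
have [q qP] := residual_small g_lip e4.
exists [fset l | l in L q]%fset, (fcoef mu g); split.
  by move=> l /=; rewrite inE /= => lL; exists q.
rewrite (_ : e ^+ 2 = 4 * (e ^+ 2 / 4)); last by lra.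
have sumE y : \sum_(l <- [fset l | l in L q]%fset) fcoef mu g l * expi l y =
    \sum_(l <- L q) fcoef mu g l * cis (l * y).
  rewrite big_imfset //= undup_id //; by apply: eq_bigr => l _; rewrite expiE.
have p_lip : bounded_lipschitz (fun y => \sum_(l <- [fset l | l in L q]%fset) fcoef mu g l * expi l y).
  under eq_fun do rewrite sumE; apply: bounded_lipschitz_sum => l.
  by apply: bounded_lipschitzM; [exact: bounded_lipschitz_cst|exact: bounded_lipschitz_cis].
apply: gP => //; under [Z in L2sqnorm _ Z]eq_fun do rewrite sumE.
rewrite L2sqnorm_bounded_lipschitz ?lte_fin //.
apply: bounded_lipschitzD => //; apply: bounded_lipschitzN.
by under eq_fun do rewrite -sumE.
Qed.

End sufficiency.

(** * A spectrum gives distinct valuations *)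

Section necessity.
Variables (R : realType) (N : nat) (b t : nat -> int) (M : nat).
Variable mu : probability (measurableTypeR R) R.
Hypothesis N_prime : prime N.
Let N_gt0 : (0 < N)%N := prime_gt0 N_prime.
Hypothesis b_neq0 : forall k, (1 <= k)%N -> b k != 0.
Hypothesis t_neq0 : forall k, (1 <= k)%N -> t k != 0.
Hypothesis b_ge2 : forall k, (1 <= k)%N -> 2 <= `|b k|.
Hypothesis t_le : forall k, (1 <= k)%N -> `|t k| <= M%:Z.
Local Notation x := (@digit_step R b t).
Local Notation X n := [seq x k | k <- iota 1 n].
Hypothesis mu_limit : forall f : R -> R, continuous f -> (exists B : R, forall y, `|f y| <= B) ->
  avgs N (X n) f 0 @[n --> \oo] --> \int[mu]_y f y.

Let x_le : forall k, (1 <= k)%N -> `|x k| <= M%:R / 2 ^+ k := @digit_step_le R b t b_neq0 M b_ge2 t_le.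

(* The Fourier transform of mu is the product of the masks of all the digits;
   the factors tend to 1 fast enough for it to vanish only if a factor does. *)
Lemma fourier_zero (xi : R) : cRintegral mu (fun y => cis (xi * y)) = 0 ->
  exists2 k, (1 <= k)%N & dirichlet N (xi * x k) = 0.
Proof.
move=> int0; apply: contrapT => no_zero.
have [n nP] : exists n, `|xi| * M%:R / 2 ^+ n.+1 < N%:R^-1 :> R.
  pose A := `|xi| * M%:R * N%:R : R.
  exists (Num.truncn A); rewrite ltr_pdivrMr ?exprn_gt0 // [ltRHS]mulrC ltr_pdivlMr ?ltr0n //.
  apply: (@lt_trans _ _ (Num.truncn A).+1%:R); first exact: truncnS_gt.
  by rewrite -natrX ltr_nat ltn_expl.
have k0 : 0 <= `|xi| * M%:R / 2 ^+ n.+1 :> R by rewrite divr_ge0 ?mulr_ge0 ?exprn_ge0.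
have [c c0 cP] := dirichlet_prod_ge N_prime k0 nP.
pose p := \prod_(y <- X n) nsq (dirichlet N (xi * y)).
have p0 : 0 < p.
  rewrite /p big_map big_seq; apply: prodr_gt0 => k; rewrite mem_iota => /andP[k1 _].
  rewrite lt_neqAle nsq_ge0 andbT eq_sym; apply/eqP => /nsq_eq0 kz.
  by apply: no_zero; exists k.
have bl := bounded_lipschitz_cis xi.
have cv := nsq_cvg (avgs_cvg mu_limit bl).1 (avgs_cvg mu_limit bl).2.
rewrite int0 nsq0 in cv.
have : p * c <= 0.
  apply: (ler_cvg_to (cvg_cst (p * c)) cv); exists n => // K /= nK.
  rewrite avgs_cis // mulr0 cis0 mul1r nsq_prod -(subnKC nK) iotaD map_cat big_cat /=.
  apply: ler_pM => //; [exact: ltW | exact: ltW |].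
  rewrite big_map -[(1 + n)%N]addn0 iotaDl big_map -[Z in iota 0 Z]subn0 -/(index_iota 0 _) big_mkord.
  apply: (cP _ (fun i => xi * x (1 + n + i)%N)) => i.
  rewrite normrM; apply: le_trans (ler_wpM2l (normr_ge0 _) (x_le _)) _ => //.
  by rewrite add1n exprD invfM !mulrA.
by rewrite leNgt mulr_gt0.
Qed.

(** Multiplication by m prime to N preserves the fractions a/N with N not dividing a. *)
Lemma dirichlet_eq0_mul (y : R) (m : int) : coprime `|m| N ->
  dirichlet N y = 0 -> dirichlet N (m%:~R * y) = 0.
Proof.
move=> mN /(dirichlet_eq0P N_prime)[a ya Na].
apply: (@dirichlet_eq0 R N _ (m * a)); first by rewrite mulrCA ya intrM.
by rewrite Gauss_dvdzr // /coprimez /gcdz absz_nat gcdnC; move: mN => /eqP ->.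
Qed.

Lemma common_step i j : (1 <= i)%N -> (1 <= j)%N -> s_seq N b t i = s_seq N b t j ->
  exists z : R, [/\ z != 0,
    forall xi, dirichlet N (xi * x i) = 0 -> dirichlet N (xi * z) = 0 &
    forall xi, dirichlet N (xi * x j) = 0 -> dirichlet N (xi * z) = 0].
Proof.
move=> i1 j1 sij.
have Pi := denom_neq0 b_neq0 i; have Pj := denom_neq0 b_neq0 j.
have ti := t_neq0 i1; have tj := t_neq0 j1.
have [u [uE u0 tu]] := tau_decomp N_prime (mulf_neq0 tj Pi).
have [v [vE v0 tv]] := tau_decomp N_prime (mulf_neq0 ti Pj).
(* This equality of valuations is what s_i = s_j says; u and v are the parts prime to N. *)
have tau_eq : tau N (t j * denom b i) = tau N (t i * denom b j).
  by move: sij; rewrite !(s_seqE b N_prime t_neq0) // !tauM //; lia.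
(* The common value of u x_i and v x_j, u and v prime to N, is the required step. *)
have zE : u%:~R * x i = v%:~R * x j :> R.
  have PiR : (denom b i)%:~R != 0 :> R by rewrite intr_eq0.
  have PjR : (denom b j)%:~R != 0 :> R by rewrite intr_eq0.
  have uv : u * (t i * denom b j) = v * (t j * denom b i).
    by rewrite vE uE tau_eq; ring.
  apply: (mulIf PiR); apply: (mulIf PjR); rewrite /digit_step.
  have /(congr1 (fun a : int => a%:~R : R)) := uv; rewrite !intrM => uvR.
  rewrite (_ : _ * _ * _ * _ = u%:~R * ((t i)%:~R * (denom b j)%:~R)); last by field.
  by rewrite uvR; field.
have xi0 : x i != 0 by rewrite mulf_neq0 ?invr_eq0 ?intr_eq0.
exists (u%:~R * x i); split.
- by rewrite mulf_neq0 // intr_eq0.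
- by move=> xi /(dirichlet_eq0_mul (tau_coprime N_prime u0 tu)); rewrite mulrCA.
- by move=> xi /(dirichlet_eq0_mul (tau_coprime N_prime v0 tv)); rewrite zE mulrCA.
Qed.

Section cells.
(* Here zs will be either the first n steps, or these steps with x_i and x_j
   replaced by a single common_step. *)
Variables (n : nat) (eta beta : R) (zs : seq R).
Hypothesis eta_gt0 : 0 < eta.
Local Notation T K := [seq x k | k <- iota n.+1 K].
Hypothesis beta_le : forall K, beta <= corner N (T K).
Hypothesis eta_le : {in zs, forall z : R, eta <= `|z|}.

(** Supported within eta above beta, a lower bound of all tail sums. *)
Definition bump (y : R) : R[i] := (cutoff (beta + eta) eta y)%:C.

Definition cell (y : R) : R[i] := (cutoff (corner N zs + beta + eta) eta y)%:C.

Let cell_shift y : cell (y + corner N zs) = bump y.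
Proof.
rewrite /cell /bump -(cutoff_shift (beta + eta) eta y (corner N zs)).
by congr (cutoff _ _ _)%:C; ring.
Qed.

(* Among the digit sums of zs, only the extreme one meets the support of h. *)
Lemma cell_average (F : numFieldType) (h : R -> F) K :
  (forall u, corner N zs + beta + eta <= u -> h u = 0) ->
  avgs N (zs ++ T K) h 0 =
  N%:R ^- size zs * avgs N (T K) (fun y => h (y + corner N zs)) 0.
Proof.
move=> h0; rewrite avgs_cat (@avgs_corner _ _ N_gt0 _ zs eta) //.
  by rewrite -[avgs N (T K) h _]avgs_shift.
move=> u uz; apply: avgs_vanish => // v uv; apply: h0.
by apply: le_trans uv; have := beta_le K; lra.
Qed.

Lemma cell_energy K : energy N (zs ++ T K) cell = N%:R ^- size zs * energy N (T K) bump.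
Proof.
rewrite /energy (@cell_average R) => [|u uz]; last by rewrite /cell cutoff_right ?nsq0.
by congr (_ * _); apply: eq_avgs => y; rewrite cell_shift.
Qed.

Lemma cell_coef K l : nsq (coef N (zs ++ T K) cell l) =
  (N%:R ^- size zs) ^+ 2 * nsq (coef N (T K) bump l).
Proof.
rewrite /coef (@cell_average _ (fun y => cell y * cis (- (l * y)))) => [|u uz]; last first.
  by rewrite /cell cutoff_right // mul0r.
rewrite (@eq_avgs _ _ _ _ _ (fun y => cis (- (l * corner N zs)) * (bump y * cis (- (l * y))))).
  rewrite avgsZ !nsqM nsq_cis mul1r; congr (_ * _); rewrite -nsq_real; congr nsq.
  by rewrite fmorphV rmorphXn /= rmorph_nat.
by move=> y; rewrite cell_shift mulrCA -cisD; congr (_ * cis _); ring.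
Qed.

End cells.
Lemma corner_le0 (zs : seq R) : corner N zs <= 0.
Proof. by rewrite /corner; apply: sumr_le0 => z _; rewrite /lower ge_min lexx. Qed.

Local Notation T n K := [seq x k | k <- iota n.+1 K].

Lemma tail_split n m K : T n (m + K) = T n m ++ T (n + m) K.
Proof. by rewrite iotaD map_cat addSn. Qed.

(** The first m tail digits sit at their corner with weight N^-m, and all later ones move the point
    by at most w <= eta / 4. There the cut-off is at least 1/2, whence delta = N^-m / 4, independent
    of K. *)
Lemma tail_corner n (eta : R) : 0 < eta -> exists beta : R,
  (forall K, beta <= corner N (T n K)) /\
  exists (m : nat) (delta : R), 0 < delta /\
    forall K, (m <= K)%N -> delta <= energy N (T n K) (bump eta beta).
Proof.
move=> eta0; pose A : R := N%:R * M%:R * 4 / eta.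
pose m := Num.truncn A; pose w : R := N%:R * M%:R / 2 ^+ (n + m).
have w_ge0 : 0 <= w by rewrite divr_ge0 ?mulr_ge0 ?exprn_ge0.
have w_le : w <= eta / 4.
  rewrite ler_pdivlMr // mulrAC ler_pdivrMr ?exprn_gt0 // [leRHS]mulrC -ler_pdivrMr // -/A.
  apply: (@le_trans _ _ m.+1%:R); first by apply: ltW; exact: truncnS_gt.
  rewrite -natrX ler_nat; apply: leq_trans (_ : 2 ^ m <= _)%N; first exact: ltn_expl.
  by rewrite leq_pexp2l // leq_addl.
have width_w K : width N (T (n + m) K) <= w by exact: (width_steps N x_le).
exists (corner N (T n m) - w); split.
  move=> K; have [Km|mK] := leqP K m.
    rewrite -(subnKC Km) tail_split corner_cat.
    by have := corner_le0 (T (n + K) (m - K)); lra.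
  rewrite -(subnKC (ltnW mK)) tail_split corner_cat.
  have := corner_width N (T (n + m) (K - m)); have := width_w (K - m)%N.
  by move=> ww cw; have := le_trans cw ww; rewrite ler_norml => /andP[? ?]; lra.
exists m, (N%:R ^- m / 4); split; first by rewrite divr_gt0 ?invr_gt0 ?exprn_gt0 ?ltr0n.
move=> K mK; rewrite -(subnKC mK) tail_split /energy avgs_cat.
set h := avgs N (T (n + m) _) _.
have h0 u : 0 <= h u by apply: avgs_ge0 => // v; exact: nsq_ge0.
have := avgs_ge_corner N_gt0 (T n m) 0 h0; apply: le_trans.
rewrite size_map size_iota add0r ler_wpM2l ?invr_ge0 ?exprn_ge0 //.
rewrite -[leLHS](avgs_const N_gt0 _ (T (n + m) (K - m)) (corner N (T n m))).
apply: avgs_le => // u uw; rewrite nsq_real.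
have : 2^-1 <= cutoff (corner N (T n m) - w + eta) eta u.
  apply: cutoff_half => //; have := le_trans uw (width_w _); rewrite ler_norml; lra.
by move=> h2; rewrite (_ : 4^-1 = 2^-1 ^+ 2); [rewrite lerXn2r // nnegrE; lra | field].
Qed.

Lemma spectrum_injective_s (L : set R) : is_spectrum mu L -> injective_s N b t.
Proof.
move=> [orth total] i j i1 j1 ij sij.
have [z [z0 zi zj]] := common_step i1 j1 sij.
pose n := maxn i j; pose rest := rem j (rem i (iota 1 n)).
have i_in : i \in iota 1 n by rewrite mem_iota i1 add1n ltnS leq_maxl.
have j_in : j \in rem i (iota 1 n).
  rewrite rem_filter ?iota_uniq // mem_filter /= mem_iota j1 add1n ltnS leq_maxr !andbT.
  by apply/eqP => ji; exact: ij.
have perm_n : perm_eq (iota 1 n) (i :: j :: rest).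
  by apply: perm_trans (perm_to_rem i_in) _; rewrite perm_cons perm_to_rem.
pose zs := X n; pose ws := z :: [seq x k | k <- rest].
have n_gt1 : size rest = (n - 2)%N /\ (2 <= n)%N.
  by have := perm_size perm_n; rewrite size_iota /= => ->; lia.
have size_zs : size zs = n by rewrite size_map size_iota.
have size_ws : size ws = n.-1 by rewrite /= size_map n_gt1.1; lia.
have x0 k : (1 <= k)%N -> x k != 0.
  by move=> k1; rewrite mulf_neq0 ?invr_eq0 ?intr_eq0 ?denom_neq0 ?t_neq0.
(* A single eta for the merged step and the original ones, so that both systems share the same
   bump. *)
have [|eta eta0 etaP] := @steps_lower_bound R (z :: zs).
  move=> y; rewrite inE => /orP[/eqP-> //|/mapP[k + ->]].
  by rewrite mem_iota => /andP[k1 _]; exact: x0.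
have eta_zs : {in zs, forall y : R, eta <= `|y|}.
  by move=> y yzs; apply: etaP; rewrite inE yzs orbT.
have eta_ws : {in ws, forall y : R, eta <= `|y|}.
  move=> y; rewrite inE => /orP[/eqP->|/mapP[k kr ->]]; first by apply: etaP; rewrite mem_head.
  apply: eta_zs; apply/mapP; exists k => //.
  by rewrite (perm_mem perm_n) !inE kr !orbT.
have [beta [betaP [m [delta [delta0 deltaP]]]]] := tail_corner n eta0.
pose f := cell eta beta zs.
have f_lip : bounded_lipschitz f by exact: bounded_lipschitz_cutoff.
have fL2 : cL2 mu f.
  have [mRe mIm] := bounded_lipschitz_measurable f_lip; split => //.
  by rewrite L2sqnorm_bounded_lipschitz // ltry.
have NR0 : 0 < N%:R :> R by rewrite ltr0n.
(* The residual inequality will be multiplied by N^(2n), leaving delta / 2. Neither n nor delta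
   depends on K, which is chosen after the approximating sum. *)
pose e2 : R := delta / 2 / (N%:R ^+ n) ^+ 2.
have e20 : 0 < e2 by rewrite !divr_gt0 ?exprn_gt0.
have [s [c [sL fs]]] := total f fL2 (Num.sqrt e2) (eq_ind_r (fun v => is_true v) e20 (sqrtr_gt0 e2)).
rewrite sqr_sqrtr ?ltW // in fs.
pose p y := \sum_(l <- s) c l * cis (l * y).
have p_lip : bounded_lipschitz (fun y => f y - p y).
  apply: bounded_lipschitzD => //; apply: bounded_lipschitzN; apply: bounded_lipschitz_sum => l.
  by apply: bounded_lipschitzM; [exact: bounded_lipschitz_cst|exact: bounded_lipschitz_cis].
have {}fs : \int[mu]_y nsq (f y - p y) < e2.
  rewrite -lte_fin -L2sqnorm_bounded_lipschitz //; apply: le_lt_trans fs.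
  rewrite le_eqVlt; apply/orP; left; apply/eqP; congr L2sqnorm; apply/funext => y.
  by rewrite /p; congr (_ - _); apply: eq_bigr => l _; rewrite expiE.
have [K0 _ K0P] := cvgr_lt _ (energy_cvg mu_limit p_lip) _ fs.
(* Each of the finitely many pairs in s is orthogonal because of some digit; K will exceed all these
   indices, so orthogonality holds already for the finite averages. *)
have /boolp.choice[kk kkP] : forall q : R * R, exists k, q.1 \in s -> q.2 \in s -> q.1 != q.2 ->
    (1 <= k)%N /\ dirichlet N ((q.1 - q.2) * x k) = 0.
  move=> [l l'] /=; have [ls|_] := boolP (l \in s); last by exists 0%N.
  have [l's|_] := boolP (l' \in s); last by exists 0%N.
  have [ll'|ll'] := eqVneq l l'; first by exists 0%N.
  have [k k1 kz] : exists2 k, (1 <= k)%N & dirichlet N ((l - l') * x k) = 0.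
    apply: fourier_zero; rewrite -(orth l l' (sL l ls) (sL l' l's) (elimN eqP ll')).
    congr cRintegral; apply/funext => y.
    by rewrite !expiE conjc_cis -cisD; congr cis; ring.
  by exists k.
pose K1 := \max_(l <- s) \max_(l' <- s) kk (l, l').
pose K := (m + K0 + K1)%N.
have XK : X (n + K)%N = zs ++ T n K by rewrite iotaD map_cat.
have zero l l' : l \in s -> l' \in s -> l != l' ->
    exists2 k, (1 <= k <= n + K)%N & dirichlet N ((l - l') * x k) = 0.
  move=> ls l's ll'; have [k1 kz] := kkP (l, l') ls l's ll'.
  exists (kk (l, l')) => //; rewrite k1 /=.
  have : (kk (l, l') <= K1)%N.
    apply: (@leq_trans (\max_(l' <- s) kk (l, l'))).
      by rewrite (big_rem l') //=; exact: leq_maxl.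
    by rewrite /K1 [leqRHS](big_rem l) //=; exact: leq_maxl.
  by move=> h; apply: leq_trans h _; rewrite /K addnA leq_addl.
have orth_zs : {in s &, forall l l', l != l' ->
    \prod_(y <- zs ++ T n K) dirichlet N ((l - l') * y) = 0}.
  move=> l l' ls l's ll'; have [k /andP[k1 kK] kz] := zero l l' ls l's ll'.
  rewrite -XK; apply/eqP; rewrite prodf_seq_eq0; apply/hasP; exists (x k); last exact/eqP.
  by apply/mapP; exists k => //; rewrite mem_iota k1 add1n ltnS.
have orth_ws : {in s &, forall l l', l != l' ->
    \prod_(y <- ws ++ T n K) dirichlet N ((l - l') * y) = 0}.
  move=> l l' ls l's ll'; have [k /andP[k1 kK] kz] := zero l l' ls l's ll'.
  apply/eqP; rewrite prodf_seq_eq0; apply/hasP.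
  have [ki|/eqP ki] := eqVneq k i.
    exists z; first by rewrite mem_head.
    by apply/eqP; apply: zi; rewrite -ki.
  have [kj|/eqP kj] := eqVneq k j.
    exists z; first by rewrite mem_head.
    by apply/eqP; apply: zj; rewrite -kj.
  exists (x k); last exact/eqP.
  rewrite mem_cat inE; apply/orP; have [kn|nk] := leqP k n.
    left; apply/orP; right; apply/mapP; exists k => //.
    have : k \in iota 1 n by rewrite mem_iota k1 add1n ltnS.
    rewrite (perm_mem perm_n) !inE => /orP[/eqP //|/orP[/eqP //|//]].
  by right; apply/mapP; exists k => //; rewrite mem_iota nk addSn ltnS.
have us : uniq s by exact: fset_uniq.
have res := energy_residual_ge N_gt0 f c us orth_zs.
have {}res : energy N (zs ++ T n K) f - \sum_(l <- s) nsq (coef N (zs ++ T n K) f l) < e2.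
  apply: le_lt_trans res _; rewrite -XK; apply: K0P.
  by apply: leq_trans (leq_addl n _); rewrite /K -addnA addnCA leq_addr.
have bes := bessel N_gt0 (cell eta beta ws) us orth_ws.
have cellE := cell_energy eta0 betaP; have cellC := cell_coef eta0 betaP.
(* A and E involve only the common tail: zs and ws enter through their sizes n and n - 1 alone. *)
pose A := \sum_(l <- s) nsq (coef N (T n K) (bump eta beta) l).
pose E := energy N (T n K) (bump eta beta).
have E_ge : delta <= E by apply: deltaP; rewrite /K -addnA leq_addr.
have sumE ys : {in ys, forall y : R, eta <= `|y|} ->
    \sum_(l <- s) nsq (coef N (ys ++ T n K) (cell eta beta ys) l) = (N%:R ^- size ys) ^+ 2 * A.
  by move=> ysP; rewrite mulr_sumr; apply: eq_bigr => l _; rewrite cellC.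
move: res; rewrite /f sumE // cellE // size_zs -/E => res.
move: bes; rewrite sumE // cellE // size_ws -/E => bes.
pose Q : R := N%:R ^+ n.-1; have Q1 : 1 <= Q by rewrite exprn_ege1 // ler1n.
have N2 : 2 <= N%:R :> R by rewrite ler_nat prime_gt1.
have nE : N%:R ^+ n = N%:R * Q by rewrite /Q -exprS prednK // (leq_trans _ n_gt1.2).
have Q0 : 0 < Q by lra.
(* Bessel for the merged digits gives A <= Q E; near-completeness for mu gives N Q E - A < delta /
   2. Together (N - 1) Q E < delta / 2, against E >= delta. *)
have {}bes : A <= Q * E.
  rewrite (_ : A = Q ^+ 2 * (Q ^- 1 ^+ 2 * A)); last by field; rewrite gt_eqF.
  by rewrite (_ : Q * E = Q ^+ 2 * (Q ^- 1 * E)) ?ler_pM2l ?exprn_gt0 //; field; rewrite gt_eqF.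
have {}res : N%:R * Q * E - A < delta / 2.
  have W0 : 0 < N%:R * Q by rewrite mulr_gt0.
  rewrite (_ : _ - A = ((N%:R * Q)^-1 * E - (N%:R * Q)^-1 ^+ 2 * A) * (N%:R * Q) ^+ 2).
    by rewrite -ltr_pdivlMr ?exprn_gt0 // -nE.
  by field; rewrite !gt_eqF.
have QE : E <= Q * E by rewrite ler_peMl //; lra.
have : 2 * (Q * E) <= N%:R * Q * E by rewrite -mulrA ler_wpM2r //; lra.
lra.
Qed.

End necessity.

(** * Assembly of the equivalences *)

Lemma tau_le N A M : prime N -> A != 0 -> `|A| <= M%:Z -> (tau N A <= M)%N.
Proof.
move=> N_prime A0 AM; rewrite /tau; apply: leq_trans (_ : `|A| <= M)%N; last by lia.
apply: leq_trans (ltnW (ltn_expl _ (prime_gt1 N_prime))) _.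
by apply: dvdn_leq; [rewrite absz_gt0 | exact: pfactor_dvdnn].
Qed.

(** The law of the digit series shows that a weak limit exists, so the measure returned by [get] is
    itself a weak limit. *)
Lemma infinite_convolution_limit (R : realType) (N : nat) (b t : nat -> int) (M : nat) :
  (0 < N)%N -> (forall k, (1 <= k)%N -> b k != 0) -> (forall k, (1 <= k)%N -> t k != 0) ->
  (forall k, (1 <= k)%N -> 2 <= `|b k|) -> (forall k, (1 <= k)%N -> `|t k| <= M%:Z) ->
  forall f : R -> R, continuous f -> (exists B : R, forall y, `|f y| <= B) ->
    avgs N [seq digit_step R b t k | k <- iota 1 n] f 0 @[n --> \oo] -->
      \int[infinite_convolution R b (fun k => digits N (t k))]_y f y.
Proof.
move=> N_gt0 b_neq0 t_neq0 b_ge2 t_le.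
have convE n (f : R -> R) : continuous f -> (exists B : R, forall y, `|f y| <= B) ->
    \int[finite_convolution b (fun k => digits N (t k)) n]_y f y =
    avgs N [seq digit_step R b t k | k <- iota 1 n] f 0.
  move=> cf [B fB]; apply: (Rintegral_finite_convolution n N_gt0 b_neq0 t_neq0 _ fB).
  exact: continuous_measurable_fun.
have [nu nu_lim] := digit_series_measure N_gt0 (@digit_step_le R b t b_neq0 M b_ge2 t_le).
have nonempty : exists mu : probability (measurableTypeR R) R,
    weak_limit (finite_convolution b (fun k => digits N (t k))) mu.
  by exists nu => f cf fB; under eq_fun do rewrite convE //; exact: nu_lim.
have lim := getPex nonempty => f cf fB.
by under eq_fun do rewrite -convE //; exact: lim.
Qed.

Theorem theorem1p4 (R : realType) (N : nat) (b t : nat -> int)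
    (N_prime : prime N)
    (b_ge2 : forall k, (1 <= k)%N -> 2 <= `|b k|)
    (t_bounded : exists M : int, forall k, (1 <= k)%N -> `|t k| <= M)
    (t_ge1 : forall k, (1 <= k)%N -> 1 <= `|t k|)
    (b_large : exists m0 : nat, (1 <= m0)%N /\
       forall k, (m0 <= k)%N -> (N%:Z - 1) * `|t k| < `|b k|) :
  let D := fun k => digits N (t k) in
  let s := s_seq N b t in
  (spectral_measure (infinite_convolution R b D) <->
   (forall i j : nat, (1 <= i)%N -> (1 <= j)%N -> i <> j -> s i <> s j)) /\
  ((forall i j : nat, (1 <= i)%N -> (1 <= j)%N -> i <> j -> s i <> s j) <->
   (forall k : nat, (1 <= k)%N ->
      direct_sumset (tile_term b D (k := k)) /\
      integer_tile (sumset (tile_term b D (k := k))))).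
Proof.
move=> D s.
have b_neq0 k : (1 <= k)%N -> b k != 0 by move=> /b_ge2; lia.
have t_neq0 k : (1 <= k)%N -> t k != 0 by move=> /t_ge1; lia.
have [M t_le] : exists M : nat, forall k, (1 <= k)%N -> `|t k| <= M%:Z.
  by have [M t_le] := t_bounded; exists `|M|%N => k /t_le; lia.
have [m0 [m0_ge1 {}b_large]] := b_large.
have mu_limit := @infinite_convolution_limit R N b t M (prime_gt0 N_prime) b_neq0 t_neq0 b_ge2 t_le.
split; last first.
  split=> [inj_s k|]; first exact: (injective_s_tile N_prime b_neq0 t_neq0 inj_s).
  exact: (tile_injective_s N_prime b_neq0 t_neq0).
split=> [[_ [L]]|inj_s]; first exact: (spectrum_injective_s N_prime b_neq0 t_neq0 b_ge2 t_le mu_limit).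
(* The bound M on |t_k| also serves as the bound C on valuations. *)
have tau_t k : (1 <= k)%N -> (tau N (t k) <= M)%N.
  by move=> k1; apply: tau_le => //; [exact: t_neq0 | exact: t_le].
have [c c01 [q0 [L LP]]] := spectral_sequence R N_prime b_neq0 t_neq0 tau_t inj_s b_ge2 t_le m0_ge1 b_large.
apply: (spectral_of_sequence N_prime b_neq0 t_neq0 tau_t inj_s b_ge2 t_le mu_limit c01 (q0 := q0) (L := L)).
- by move=> q; case: (LP q).
- by move=> q; case: (LP q).
- by move=> q; case: (LP q).
Qed.
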